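(* Let $k$ and $n$ be positive integers, and let $\Omega$ be a bounded domain in $\mathbb{R}^k$ with smooth boundary. If $f\in W^{1,1}(\Omega;\mathbb{R}^{2n+1})$ satisfies the weak contact equation $$\operatorname{im}\,\operatorname{wk}df_x\subset\ker\alpha(f(x))\quad\text{for }\mathcal{H}^k\text{-almost every }x\in\Omega,$$ then for any $\varepsilon>0$ there is a set $E_\varepsilon\subset\Omega$ such that $\mathcal{H}^k(\Omega\setminus E_\varepsilon)<\varepsilon$ and $f|_{E_\varepsilon}\colon E_\varepsilon\to\mathbb{H}^n$ is Lipschitz continuous (with respect to the Euclidean metric on $E_\varepsilon$ and the Carnot–Carathéodory metric $d_{cc}$ on $\mathbb{H}^n$).
   Context: The Heisenberg group $\mathbb{H}^n$ is $\mathbb{C}^n\times\mathbb{R}=\mathbb{R}^{2n+1}$, with points $(z,t)=(x_1,y_1,\ldots,x_n,y_n,t)$, $z_j=x_j+iy_j$, and group law $(z,t)*(z',t')=\left(z+z',\,t+t'+2\,\mathrm{Im}\sum_{j=1}^n z_j\overline{z_j'}\right)$. The left-invariant horizontal vector fields are $X_j=\frac{\partial}{\partial x_j}+2y_j\frac{\partial}{\partial t}$, $Y_j=\frac{\partial}{\partial y_j}-2x_j\frac{\partial}{\partial t}$ ($j=1,\ldots,n$). The horizontal space at $p$ is $H_p\mathbb{H}^n=\mathrm{span}\{X_1(p),\ldots,X_n(p),Y_1(p),\ldots,Y_n(p)\}$, equipped with the inner product making these $2n$ vectors orthonormal; it equals $\ker\alpha(p)$, the kernel at $p$ of the standard contact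 form $\alpha=dt+2\sum_{j=1}^n(x_j\,dy_j-y_j\,dx_j)$. An absolutely continuous curve $\gamma\colon[a,b]\to\mathbb{R}^{2n+1}$ is horizontal if $\gamma'(s)\in H_{\gamma(s)}\mathbb{H}^n$ for almost every $s$; its length is the integral of the norm of $\gamma'$ with respect to this inner product. The Carnot–Carathéodory metric $d_{cc}(p,q)$ is the infimum of lengths of horizontal curves joining $p$ to $q$. $\mathbb{H}^n$ is always regarded as the metric space $(\mathbb{H}^n,d_{cc})$. $W^{1,1}(\Omega;\mathbb{R}^{2n+1})$ is the Sobolev space of integrable mappings with integrable weak derivative, denoted $\operatorname{wk}df$. $\mathcal{H}^k$ is Lebesgue measure on $\mathbb{R}^k$. *)

(* Defs.v *)
From HB Require Import structures.
From mathcomp Require Import all_boot all_order all_algebra.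
From mathcomp Require Import all_classical all_reals all_analysis.
From mathcomp Require Import zify ring.

Set Implicit Arguments.
Unset Strict Implicit.
Unset Printing Implicit Defensive.
Import Order.TTheory GRing.Theory Num.Theory.
Import numFieldNormedType.Exports.
Local Open Scope classical_set_scope.
Local Open Scope ring_scope.

(* The library norm on ['rV_m] is the sup norm. *)
Definition enorm (R : realType) (m : nat) (v : 'rV[R]_m) : R :=
  Num.sqrt (\sum_(i < m) v 0 i ^+ 2).

Definition box (R : realType) (k : nat) (c : 'rV[R]_k * 'rV[R]_k) :
  set 'rV[R]_k := [set x | forall i, c.1 0 i <= x 0 i <= c.2 0 i].

Definition box_volume (R : realType) (k : nat) (c : 'rV[R]_k * 'rV[R]_k) : R :=
  \prod_(i < k) (c.2 0 i - c.1 0 i).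

(* Covers are countable sets of boxes, not sequences, so that the empty set has
   the empty cover; sequences of boxes would give it measure +oo when k = 0. *)
Definition box_cover (R : realType) (k : nat) (A : set 'rV[R]_k)
    (C : set ('rV[R]_k * 'rV[R]_k)) : Prop :=
  [/\ countable C, forall c, C c -> forall i, c.1 0 i <= c.2 0 i
    & A `<=` \bigcup_(c in C) box c].

Definition lebesgue_outer (R : realType) (k : nat) (A : set 'rV[R]_k) : \bar R :=
  ereal_inf [set (\esum_(c in C) (box_volume c)%:E)%E | C in box_cover A].

Section lebesgue_outer_theory.
Variables (R : realType) (k : nat).
Local Open Scope ereal_scope.
Let mu := @lebesgue_outer R k.

Let cover_esum_ge0 A (C : set ('rV[R]_k * 'rV[R]_k)) : box_cover A C ->
  0 <= \esum_(c in C) (box_volume c)%:E.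
Proof.
move=> [_ C0 _]; apply: esum_ge0 => c /C0 c0.
by rewrite lee_fin; apply: prodr_ge0 => i _; rewrite subr_ge0.
Qed.

Lemma lebesgue_outer0 : mu set0 = 0.
Proof.
apply/eqP; rewrite eq_le; apply/andP; split.
  apply: ereal_inf_lbound; exists set0; last exact: esum_set0.
  by split.
by apply: le_ereal_inf_tmp => _ [C /cover_esum_ge0 C0 <-].
Qed.

Lemma lebesgue_outer_ge0 A : 0 <= mu A.
Proof. by apply: le_ereal_inf_tmp => _ [C /cover_esum_ge0 C0 <-]. Qed.

Lemma le_lebesgue_outer : {homo mu : A B / A `<=` B >-> A <= B}.
Proof.
move=> A B AB; apply: ereal_inf_le_tmp => _ [C [cC C0 BC] <-].
by exists C => //; split => //; exact: subset_trans BC.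
Qed.

Lemma lebesgue_outer_sigma_subadditive : sigma_subadditive mu.
Proof.
move=> A; have [[i ioo]|] := pselect (exists i, mu (A i) = +oo).
  rewrite (eseries_pinfty _ _ ioo) ?leey// => n _.
  by rewrite -ltNye (lt_le_trans _ (lebesgue_outer_ge0 _)).
rewrite -forallNE => Aoo.
apply/lee_addgt0Pr => e e0.
rewrite (le_trans _ (epsilon_trick _ _ (ltW e0)))//; last first.
  by move=> n; exact: lebesgue_outer_ge0.
pose P n (C : set ('rV[R]_k * 'rV[R]_k)) := box_cover (A n) C /\
  \esum_(c in C) (box_volume c)%:E <= mu (A n) + (e / (2 ^ n.+1)%:R)%:E.
have [G PG] : {G : (set ('rV[R]_k * 'rV[R]_k))^nat & forall n, P n (G n)}.
  apply: (@choice _ _ P) => n.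
  have muAn : mu (A n) \is a fin_num.
    by rewrite ge0_fin_numE ?lebesgue_outer_ge0// ltey; exact/eqP/Aoo.
  have en1 : (0 < e / (2 ^ n.+1)%:R)%R by rewrite divr_gt0.
  have [_ [C AC <-] muC] := lb_ereal_inf_adherent en1 muAn.
  by exists C; split => //; exact: ltW.
have vol0 n c : G n c -> 0 <= (box_volume c)%:E.
  move=> Gc; rewrite lee_fin; apply: prodr_ge0 => i _.
  by have [[_ C0 _] _] := PG n; rewrite subr_ge0 C0.
apply: (@le_trans _ _ (\esum_(c in \bigcup_n G n) (box_volume c)%:E)).
  apply: ereal_inf_lbound; exists (\bigcup_n G n) => //; split.
  - by apply: bigcup_countable => // n _; have [[]] := PG n.
  - by move=> c [n _ Gc]; have [[_ C0 _] _] := PG n; exact: C0.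
  - move=> x [n _ Ax]; have [[_ _ /(_ _ Ax)[c Gc xc]] _] := PG n.
    by exists c => //; exists n.
rewrite seqDU_bigcup_eq esum_bigcup; last 2 first.
  - exact: sub_trivIset (trivIset_seqDU G).
  - by move=> c [n _ [Gc _]]; exact: vol0 Gc.
have sG0 n : 0 <= \esum_(c in seqDU G n) (box_volume c)%:E.
  by apply: esum_ge0 => c [Gc _]; exact: vol0 Gc.
rewrite -nneseries_esumT//; apply: lee_nneseries => [n _ _|n _]; first exact: sG0.
apply: le_trans (PG n).2; apply: ereal_sup_le => _ [F [finF FG] <-].
by exists F => //; split => //; exact: subset_trans (@subset_seqDU _ G n).
Qed.

HB.instance Definition _ := isOuterMeasure.Build R 'rV[R]_k (@lebesgue_outer R k)
  lebesgue_outer0 lebesgue_outer_ge0 le_lebesgue_outer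
  lebesgue_outer_sigma_subadditive.

End lebesgue_outer_theory.

Definition lebesgue_outer_measure (R : realType) (k : nat)
  : {outer_measure set 'rV[R]_k -> \bar R} := @lebesgue_outer R k.

(* A copy of ['rV[R]_k] whose measurable sets are the Lebesgue (Caratheodory)
   measurable ones. *)
Notation Rn R k := (caratheodory_type (lebesgue_outer_measure R k)).

Definition lebesgueRn (R : realType) (k : nat) : {measure set Rn R k -> \bar R} :=
  lebesgue_outer_measure R k : set (Rn R k) -> \bar R.

Definition partial (R : realType) (k : nat) (i : 'I_k) (g : 'rV[R]_k -> R) :
  'rV[R]_k -> R := 'D_(delta_mx 0 i) g.

(* Differentiability at every order includes continuity of all the iterated
   partial derivatives. *)
Definition smooth (R : realType) (k : nat) (g : 'rV[R]_k -> R) : Prop :=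
  forall (s : seq 'I_k) (x : 'rV[R]_k), differentiable (foldr (@partial R k) g s) x.

(* Smoothness of the boundary in terms of local defining functions; it implies
   that the domain lies locally on one side of its boundary. *)
Definition smooth_boundary (R : realType) (k : nat) (Omega : set 'rV[R]_k) :
  Prop :=
  forall p, (closure Omega `\` interior Omega) p ->
  exists rho : 'rV[R]_k -> R, [/\ smooth rho, exists i, partial i rho p != 0
    & \forall x \near p, Omega x <-> rho x < 0].

Definition smooth_bounded_domain (R : realType) (k : nat)
    (Omega : set 'rV[R]_k) : Prop :=
  [/\ open Omega, connected Omega, Omega !=set0, bounded_set Omega
    & smooth_boundary Omega].

Definition test_function (R : realType) (k : nat) (Omega : set 'rV[R]_k)
    (phi : 'rV[R]_k -> R) : Prop :=
  [/\ smooth phi, compact (closure [set x | phi x != 0])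
    & closure [set x | phi x != 0] `<=` Omega].

Definition integrable_on (R : realType) (k : nat) (Omega : set 'rV[R]_k)
    (g : 'rV[R]_k -> R) : Prop :=
  (lebesgueRn R k).-integrable Omega (EFin \o g).

(* Derivatives act on row vectors on the right, as the library's ['J f x]:
   [Df x i j] is the weak derivative of the j-th component of [f] along the
   i-th coordinate. *)
Definition weak_derivative (R : realType) (k m : nat) (Omega : set 'rV[R]_k)
    (f : 'rV[R]_k -> 'rV[R]_m) (Df : 'rV[R]_k -> 'M[R]_(k, m)) : Prop :=
  forall (i : 'I_k) (j : 'I_m) (phi : 'rV[R]_k -> R), test_function Omega phi ->
    \int[lebesgueRn R k]_(x in Omega) (f x 0 j * partial i phi x) =
    - \int[lebesgueRn R k]_(x in Omega) (Df x i j * phi x).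

Definition sobolev11 (R : realType) (k m : nat) (Omega : set 'rV[R]_k)
    (f : 'rV[R]_k -> 'rV[R]_m) (Df : 'rV[R]_k -> 'M[R]_(k, m)) : Prop :=
  [/\ forall j, integrable_on Omega (fun x => f x 0 j),
      forall i j, integrable_on Omega (fun x => Df x i j)
    & weak_derivative Omega f Df].

(* Points are (x_1, y_1, ..., x_n, y_n, t); [xi], [yi] and [ti] are the positions
   of these coordinates. *)
Notation heis R n := 'rV[R]_((2 * n).+1).

Definition xi (n : nat) (j : 'I_n) : 'I_((2 * n).+1) := inord (2 * j)%N.
Definition yi (n : nat) (j : 'I_n) : 'I_((2 * n).+1) := inord (2 * j).+1%N.
Definition ti (n : nat) : 'I_((2 * n).+1) := ord_max.

Definition Xfield (R : realType) (n : nat) (j : 'I_n) (p : heis R n) : heis R n :=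
  delta_mx 0 (xi j) + (2 * p 0 (yi j)) *: delta_mx 0 (ti n).

Definition Yfield (R : realType) (n : nat) (j : 'I_n) (p : heis R n) : heis R n :=
  delta_mx 0 (yi j) - (2 * p 0 (xi j)) *: delta_mx 0 (ti n).

Definition contact_form (R : realType) (n : nat) (p v : heis R n) : R :=
  v 0 (ti n) + 2 * \sum_(j < n) (p 0 (xi j) * v 0 (yi j) - p 0 (yi j) * v 0 (xi j)).

Definition horizontal_space (R : realType) (n : nat) (p : heis R n) :
  set (heis R n) :=
  [set v | exists a b : 'I_n -> R,
    v = \sum_(j < n) (a j *: Xfield j p + b j *: Yfield j p)].

(* The inner product on the horizontal space; the base point does not occur
   because the coefficients of a horizontal vector along the fields X_j and Y_j
   are its dx_j and dy_j components. *)
Definition hdot (R : realType) (n : nat) (u v : heis R n) : R :=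
  \sum_(j < n) (u 0 (xi j) * v 0 (xi j) + u 0 (yi j) * v 0 (yi j)).

Definition hnorm (R : realType) (n : nat) (v : heis R n) : R :=
  Num.sqrt (hdot v v).

Section horizontal_frame.
Variables (R : realType) (n : nat).
Implicit Types (p : heis R n) (i j : 'I_n).

Lemma xi_eq i j : (xi i == xi j) = (i == j).
Proof.
have := ltn_ord i; have := ltn_ord j => ? ?.
by rewrite -!(inj_eq val_inj) /xi /= !inordK; lia.
Qed.

Lemma yi_eq i j : (yi i == yi j) = (i == j).
Proof.
have := ltn_ord i; have := ltn_ord j => ? ?.
by rewrite -!(inj_eq val_inj) /yi /= !inordK; lia.
Qed.

Lemma xi_yi i j : (xi i == yi j) = false.
Proof.
have := ltn_ord i; have := ltn_ord j => ? ?.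
by rewrite -(inj_eq val_inj) /xi /yi /= !inordK; lia.
Qed.

Lemma xi_ti i : (xi i == ti n) = false.
Proof.
have := ltn_ord i => ?.
by rewrite -(inj_eq val_inj) /xi /ti /= !inordK; lia.
Qed.

Lemma yi_ti i : (yi i == ti n) = false.
Proof.
have := ltn_ord i => ?.
by rewrite -(inj_eq val_inj) /yi /ti /= !inordK; lia.
Qed.

Lemma heis_indexP (l : 'I_((2 * n).+1)) :
  [\/ exists j, l = xi j, exists j, l = yi j | l = ti n].
Proof.
have [ln|nl] := ltnP l (2 * n); last first.
  by apply: Or33; apply/val_inj; rewrite /=; have := ltn_ord l; lia.
have hn : (l./2 < n)%N by lia.
have [ol|el] := boolP (odd l).
  by apply: Or32; exists (Ordinal hn); apply/val_inj; rewrite /= inordK /=; lia.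
by apply: Or31; exists (Ordinal hn); apply/val_inj; rewrite /= inordK /=; lia.
Qed.

Let XYE := (mxE, xi_eq, yi_eq, xi_yi,
  (fun i j => etrans (eq_sym _ _) (xi_yi i j)),
  xi_ti, yi_ti, (fun i => etrans (eq_sym _ _) (xi_ti i)),
  (fun i => etrans (eq_sym _ _) (yi_ti i)), eqxx).

Let simp := (mulr0, mul0r, addr0, add0r, oppr0, mulr1, mul1r).

Lemma hdotXX p i j : hdot (Xfield i p) (Xfield j p) = (i == j)%:R.
Proof.
rewrite /hdot (bigD1 i)//= big1 => [|l /negPf li]; rewrite !XYE/= ?li !simp//.
Qed.

Lemma hdotXY p i j : hdot (Xfield i p) (Yfield j p) = 0.
Proof. by rewrite /hdot big1// => l _; rewrite !XYE/= !simp. Qed.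

Lemma hdotYY p i j : hdot (Yfield i p) (Yfield j p) = (i == j)%:R.
Proof.
rewrite /hdot (bigD1 i)//= big1 => [|l /negPf li]; rewrite !XYE/= ?li !simp//.
Qed.

Lemma horizontal_spaceE p :
  horizontal_space p = [set v | contact_form p v = 0].
Proof.
pose w (a b : 'I_n -> R) := \sum_(j < n) (a j *: Xfield j p + b j *: Yfield j p).
have wx a b i : w a b 0 (xi i) = a i.
  rewrite summxE (bigD1 i)//= big1 => [|l /negPf li]; rewrite !XYE/=
    ?[i == l]eq_sym ?li !simp//.
have wy a b i : w a b 0 (yi i) = b i.
  rewrite summxE (bigD1 i)//= big1 => [|l /negPf li]; rewrite !XYE/=
    ?[i == l]eq_sym ?li !simp//.
have wt a b : w a b 0 (ti n) =
    2 * \sum_(j < n) (p 0 (yi j) * a j - p 0 (xi j) * b j).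
  rewrite summxE mulr_sumr; apply: eq_bigr => j _.
  by rewrite !XYE/= !simp; ring.
apply/seteqP; split => v /=.
  move=> [a [b ->]]; rewrite /contact_form -/(w a b) wt -mulrDr -big_split/=.
  by rewrite big1 ?mulr0// => j _; rewrite wx wy; ring.
move=> /eqP; rewrite /contact_form addr_eq0 => /eqP vt.
exists (fun j => v 0 (xi j)), (fun j => v 0 (yi j)); apply/rowP => l.
rewrite -/(w _ _).
have [[j ->]|[j ->]| ->] := heis_indexP l; rewrite ?wx ?wy//.
rewrite wt vt -mulrN -sumrN; congr (_ * _).
by apply: eq_bigr => j _; rewrite opprB.
Qed.

End horizontal_frame.

Definition absolutely_continuous_on (R : realType) (m : nat) (a b : R)
    (gamma : R -> 'rV[R]_m) : Prop :=
  forall eps : R, 0 < eps -> exists2 delta : R, 0 < delta &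
  forall (N : nat) (s t : 'I_N -> R),
    (forall i, a <= s i /\ s i <= t i /\ t i <= b) ->
    trivIset setT (fun i => `]s i, t i[%classic) ->
    \sum_(i < N) (t i - s i) < delta ->
    \sum_(i < N) enorm (gamma (t i) - gamma (s i)) < eps.

Definition horizontal_curve (R : realType) (n : nat) (a b : R)
    (gamma : R -> heis R n) : Prop :=
  absolutely_continuous_on a b gamma /\
  {ae lebesgue_measure, forall s : R, `[a, b]%classic s ->
    derivable gamma s 1 /\ horizontal_space (gamma s) (derive1 gamma s)}.

Definition horizontal_length (R : realType) (n : nat) (a b : R)
    (gamma : R -> heis R n) : \bar R :=
  (\int[lebesgue_measure]_(s in `[a, b]) (hnorm (derive1 gamma s))%:E)%E.

Definition dcc (R : realType) (n : nat) (p q : heis R n) : \bar R :=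
  ereal_inf [set l : \bar R | exists (a b : R) (gamma : R -> heis R n),
    [/\ a <= b, horizontal_curve a b gamma, gamma a = p, gamma b = q
      & l = horizontal_length a b gamma]].

(* Main.v *)
(* On almost every line in a coordinate direction a W^{1,1} map f is the integral
   of its weak derivative. Along such a line the contact equation integrates to
   |contact_form (f x) (f y - f x)| <= 2 l^2, where l is the L^1 norm of the
   horizontal part of the derivative on the segment from x to y, and at almost
   every x a maximal inequality gives l <= m |x - y|. So, up to a null set of
   moves, moving x in a coordinate direction moves f x by at most a multiple of
   |x - y| in the sense of the Heisenberg group. On a set whose complement has
   small measure the constant m is uniform and, after passing k times to points
   of density along the successive coordinate directions, two points at distance
   r can be brought together by k pairs of such moves of length at most 2 r,
   which stay in the preceding sets. *)
From HB Require Import structures.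
Require Import Defs.
From mathcomp Require Import all_boot all_order all_algebra.
From mathcomp Require Import all_classical all_reals all_analysis.
From mathcomp Require Import measurable_realfun.
From mathcomp Require Import zify ring lra.
Set Implicit Arguments.
Unset Strict Implicit.
Unset Printing Implicit Defensive.
Import Order.TTheory GRing.Theory Num.Theory.
Import numFieldNormedType.Exports.
Local Open Scope classical_set_scope.
Local Open Scope ring_scope.

(** * Nearness in the Heisenberg group *)

(** Nearness in the Heisenberg group asks for a quadratic bound on the vertical displacement,
    whereas Lipschitz bounds on the components give only a linear one. The gain comes from
    integration: at each point of a segment the contact form based at the current value annihilates
    the derivative, and the form based at the initial value differs from it by at most the
    horizontal distance already covered.

    The weak derivative says nothing about any individual line, and no absolutely continuous
    representative is constructed. For each fixed shift s, the identity between f(x + s e) - f(x)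
    and the integral of the weak derivative is tested against bumps and so holds at almost every x;
    Fubini then exchanges the quantifiers. The price is that even at a good x a null set of shifts
    stays uncontrolled. Two points are therefore joined through shifts chosen outside small sets,
    and density points make the admissible shifts of both points meet. *)

Section heisenberg_near.
Variables (R : realType) (n : nat).
Implicit Types (p q r : heis R n) (a b : R).

(* Comparable to the statement that the Heisenberg distance from [p] to [q] is
   at most [a]; the constants make the relation exactly additive in [a]. *)
Definition heis_near p q a : Prop :=
  (forall j : 'I_n, `|q 0 (xi j) - p 0 (xi j)| <= a /\
                    `|q 0 (yi j) - p 0 (yi j)| <= a) /\
  `|contact_form p (q - p)| <= 2 * n%:R * a ^+ 2.

(** [contact_form p (q - p)] is the vertical coordinate of the group quotient p^-1 * q, and the last
    sum is the area term of the group law in (p^-1 * q) * (q^-1 * r). *)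
Lemma contact_formB p q r : contact_form p (r - p) =
  contact_form p (q - p) + contact_form q (r - q) +
  2 * \sum_(j < n) ((p 0 (xi j) - q 0 (xi j)) * (r 0 (yi j) - q 0 (yi j))
                  - (p 0 (yi j) - q 0 (yi j)) * (r 0 (xi j) - q 0 (xi j))).
Proof.
have E u v w : contact_form u (w - v) = w 0 (ti n) - v 0 (ti n) +
  2 * \sum_(j < n) (u 0 (xi j) * (w 0 (yi j) - v 0 (yi j))
                   - u 0 (yi j) * (w 0 (xi j) - v 0 (xi j))).
  rewrite /contact_form !mxE; congr (_ + 2 * _).
  by apply: eq_bigr => j _; rewrite !mxE.
rewrite !E.
have -> : \sum_(j < n) (p 0 (xi j) * (r 0 (yi j) - p 0 (yi j)) -
     p 0 (yi j) * (r 0 (xi j) - p 0 (xi j))) =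
  \sum_(j < n) (p 0 (xi j) * (q 0 (yi j) - p 0 (yi j)) -
     p 0 (yi j) * (q 0 (xi j) - p 0 (xi j))) +
  \sum_(j < n) (q 0 (xi j) * (r 0 (yi j) - q 0 (yi j)) -
     q 0 (yi j) * (r 0 (xi j) - q 0 (xi j))) +
   \sum_(j < n) ((p 0 (xi j) - q 0 (xi j)) * (r 0 (yi j) - q 0 (yi j))
                  - (p 0 (yi j) - q 0 (yi j)) * (r 0 (xi j) - q 0 (xi j))).
  by rewrite -!big_split /=; apply: eq_bigr => j _; ring.
ring.
Qed.

Lemma contact_formC p q : contact_form q (p - q) = - contact_form p (q - p).
Proof.
have := contact_formB q p q.
rewrite (_ : contact_form q (q - q) = 0); last first.
  rewrite /contact_form subrr mxE add0r big1 ?mulr0// => j _.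
  by rewrite !mxE !mulr0 subrr.
rewrite big1 ?mulr0 ?addr0 => [|j _]; last by ring.
by move=> /esym/eqP; rewrite addr_eq0 => /eqP.
Qed.

Lemma heis_nearC p q a : heis_near p q a -> heis_near q p a.
Proof.
move=> [xy t]; split.
  by move=> j; have [] := xy j; rewrite ![`|p _ _ - _|]distrC.
by rewrite contact_formC normrN.
Qed.

Lemma heis_near_le p q a b : 0 <= a -> a <= b -> heis_near p q a -> heis_near p q b.
Proof.
move=> a0 ab [xy t]; split.
  by move=> j; have [? ?] := xy j; split; exact: le_trans ab.
apply: le_trans t _; rewrite ler_wpM2l// ?mulr_ge0//.
by rewrite ler_pXn2r// nnegrE// (le_trans a0).
Qed.

Lemma heis_near_trans p q r a b : heis_near p q a -> heis_near q r b ->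
  heis_near p r (a + b).
Proof.
move=> [xyp tp] [xyq tq]; split.
  move=> j; have [? ?] := xyp j; have [? ?] := xyq j.
  split; rewrite [leRHS]addrC.
    by apply: le_trans (ler_distD (q 0 (xi j)) _ _) _; rewrite lerD.
  by apply: le_trans (ler_distD (q 0 (yi j)) _ _) _; rewrite lerD.
rewrite (contact_formB p q r).
apply: le_trans (ler_normD _ _) _.
apply: le_trans (lerD (ler_normD _ _) (lexx _)) _.
(* The cross term 4 n a b is exactly the bound for the area term, which is the origin of the
   constant 2 n in [heis_near]. *)
have -> : 2 * n%:R * (a + b) ^+ 2 = 2 * n%:R * a ^+ 2 + 2 * n%:R * b ^+ 2 +
  2 * (\sum_(j < n) (a * b + a * b)) by rewrite sumr_const card_ord -mulr_natr; ring.
rewrite !lerD// normrM ger0_norm// ler_wpM2l//.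
apply: le_trans (ler_norm_sum _ _ _) _; apply: ler_sum => j _.
have [? ?] := xyp j; have [? ?] := xyq j.
apply: le_trans (ler_normB _ _) _.
by rewrite !normrM ![`|p _ _ - _|]distrC lerD// ler_pM.
Qed.

End heisenberg_near.

(** * Bounding the Carnot-Caratheodory distance by polynomial horizontal curves *)

Lemma horner_bounded01 (R : realType) (P : {poly R}) :
  exists2 K : R, 0 <= K & forall s, 0 <= s <= 1 -> `|P.[s]| <= K.
Proof.
elim/poly_ind: P => [|P c [K K0 PK]].
  by exists 0 => // s _; rewrite horner0 normr0.
exists (K + `|c|) => [|s s01]; first by rewrite addr_ge0.
rewrite hornerMXaddC (le_trans (ler_normD _ _))// lerD2r normrM.
case/andP: (s01) => s0 s1; rewrite (ger0_norm s0) -[K]mulr1.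
by apply: ler_pM => //; exact: PK.
Qed.

Lemma horner_lipschitz01 (R : realType) (P : {poly R}) :
  exists2 K : R, 0 <= K & forall s t, 0 <= s <= 1 -> 0 <= t <= 1 ->
    `|P.[t] - P.[s]| <= K * `|t - s|.
Proof.
elim/poly_ind: P => [|P c [K K0 PK]].
  by exists 0 => // s t _ _; rewrite !horner0 subrr normr0 mul0r.
have [M M0 PM] := horner_bounded01 P.
exists (K + M) => [|s t s01 t01]; first by rewrite addr_ge0.
have -> : (P * 'X + c%:P).[t] - (P * 'X + c%:P).[s] =
    (P.[t] - P.[s]) * t + P.[s] * (t - s) by rewrite !hornerMXaddC; ring.
rewrite (le_trans (ler_normD _ _))// [leRHS]mulrDl !normrM lerD//.
  case/andP: (t01) => t0 t1; rewrite (ger0_norm t0).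
  rewrite -[leRHS]mulr1; apply: ler_pM => //; exact: PK.
by rewrite ler_wpM2r// PM.
Qed.

Lemma enorm_le_sum (R : realType) (m : nat) (v : 'rV[R]_m) :
  enorm v <= \sum_(i < m) `|v 0 i|.
Proof.
have S0 : 0 <= \sum_(i < m) `|v 0 i| by apply: sumr_ge0.
rewrite -[leRHS]ger0_norm// -sqrtr_sqr /enorm ler_wsqrtr//.
rewrite expr2 mulr_suml; apply: ler_sum => i _.
rewrite -real_normK ?num_real// expr2 ler_wpM2l//.
by rewrite (bigD1 i)//= lerDl sumr_ge0.
Qed.

Section polynomial_curve.
Variables (R : realType) (n : nat) (gx gy : 'I_n -> {poly R}) (gt : {poly R}).

(** The sum with Kronecker factors selects the right polynomial without recovering j from the index
    l. *)
Definition poly_coord (l : 'I_((2 * n).+1)) : {poly R} :=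
  if l == ti n then gt else
  \sum_(j < n) (gx j *+ (l == xi j) + gy j *+ (l == yi j)).

Lemma poly_coord_ti : poly_coord (ti n) = gt.
Proof. by rewrite /poly_coord eqxx. Qed.

Lemma poly_coord_xi j : poly_coord (xi j) = gx j.
Proof.
rewrite /poly_coord xi_ti (bigD1 j)//= eqxx xi_yi addr0 big1 ?addr0// => l lj.
by rewrite xi_eq eq_sym (negPf lj) xi_yi addr0.
Qed.

Lemma poly_coord_yi j : poly_coord (yi j) = gy j.
Proof.
rewrite /poly_coord yi_ti (bigD1 j)//= eqxx eq_sym xi_yi add0r.
rewrite big1 ?addr0// => l lj.
by rewrite yi_eq [j == l]eq_sym (negPf lj) eq_sym xi_yi addr0.
Qed.

Definition poly_curve (s : R) : heis R n := \row_l (poly_coord l).[s].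

Lemma derivable_poly_curve s : derivable poly_curve s 1.
Proof.
apply/derivable_mxP => i j.
rewrite (_ : (fun x => _) = horner (poly_coord j)).
  exact: derivable_horner.
by apply/funext => x; rewrite mxE.
Qed.

Lemma derive1_poly_curve s : derive1 poly_curve s = \row_l (poly_coord l)^`().[s].
Proof.
rewrite derive1E derive_mx; last exact: derivable_poly_curve.
apply/matrixP => i j; rewrite !mxE.
rewrite (_ : (fun x => _) = horner (poly_coord j)).
  by rewrite -derive1E derivE.
by apply/funext => x; rewrite mxE.
Qed.

Lemma poly_curve_ac : absolutely_continuous_on 0 1 poly_curve.
Proof.
have [K K0 PK] : exists2 K : R, 0 <= K & forall s t, 0 <= s <= 1 -> 0 <= t <= 1 ->
    enorm (poly_curve t - poly_curve s) <= K * `|t - s|.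
  have /choice[K KP] : forall l, exists K : R, 0 <= K /\
      forall s t, 0 <= s <= 1 -> 0 <= t <= 1 ->
      `|(poly_coord l).[t] - (poly_coord l).[s]| <= K * `|t - s|.
    by move=> l; have [K K0 PK] := horner_lipschitz01 (poly_coord l); exists K.
  exists (\sum_l K l) => [|s t s01 t01].
    by apply: sumr_ge0 => l _; have [] := KP l.
  apply: le_trans (enorm_le_sum _) _.
  rewrite mulr_suml; apply: ler_sum => l _; rewrite !mxE.
  by have [_] := KP l; exact.
move=> e e0; have K1 : 0 < K + 1 by rewrite ltr_wpDl.
(* K may be 0, so the Lipschitz constant is enlarged by 1 before dividing. *)
exists (e / (K + 1)); first by rewrite divr_gt0.
move=> N s t st _ /[!ltr_pdivlMr]//; apply: le_lt_trans.
rewrite mulr_suml; apply: ler_sum => i _.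
have [s0 [tsi t1]] := st i.
apply: le_trans (PK _ _ _ _) _.
- by rewrite s0 (le_trans tsi).
- by rewrite t1 (le_trans s0).
- by rewrite ger0_norm ?subr_ge0// mulrC ler_wpM2l ?subr_ge0// lerDl.
Qed.

(** The contact condition is an identity of polynomials, so that it can be checked by [ring]. The
    speed is at most sqrt(2 n) M; the cruder 2 n M keeps the bound free of roots. *)
Lemma dcc_poly_curve (M : R) (p q : heis R n) : 0 <= M ->
  gt^`() + 2%:R * \sum_(j < n) (gx j * (gy j)^`() - gy j * (gx j)^`()) = 0 ->
  (forall j s, 0 <= s <= 1 -> `|(gx j)^`().[s]| <= M /\ `|(gy j)^`().[s]| <= M) ->
  poly_curve 0 = p -> poly_curve 1 = q ->
  (dcc p q <= (2 * n%:R * M)%:E)%E.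
Proof.
move=> M0 contact bnd p0 q1.
apply: (@le_trans _ _ (horizontal_length 0 1 poly_curve)).
  apply: ereal_inf_lbound; exists 0, 1, poly_curve; split => //.
  split; first exact: poly_curve_ac.
  apply: aeW => s _; split; first exact: derivable_poly_curve.
  rewrite horizontal_spaceE/= derive1_poly_curve /contact_form mxE poly_coord_ti.
  have := congr1 (fun P : {poly R} => P.[s]) contact; rewrite horner0 => E0; rewrite -[RHS]E0.
  rewrite hornerD hornerM hornerMn hornerC horner_sum; congr (_ + _ * _).
  by apply: eq_bigr => j _; rewrite !mxE !poly_coord_xi !poly_coord_yi !hornerE.
rewrite /horizontal_length.
pose Q : {poly R} := \sum_(j < n) (((gx j)^`()) ^+ 2 + ((gy j)^`()) ^+ 2).
have hE s : hnorm (derive1 poly_curve s) = Num.sqrt Q.[s].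
  rewrite derive1_poly_curve /hnorm /hdot /Q horner_sum; congr Num.sqrt.
  by apply: eq_bigr => j _; rewrite !mxE poly_coord_xi poly_coord_yi !hornerE.
under eq_integral do rewrite hE.
have mI : measurable `[0 : R, 1] by exact: measurable_itv.
apply: (@le_trans _ _ (\int[lebesgue_measure]_(s in `[0%R, 1%R]) (cst (2 * n%:R * M)%:E s)))%E; last first.
  by rewrite integral_cst//= lebesgue_measure_itv/= lte_fin ltr01 sube0 mule1.
apply: ge0_le_integral => //.
- apply/measurable_EFinP; apply: measurable_funTS => /=.
  apply: continuous_measurable_fun => x.
  by apply: continuous_comp; [exact: continuous_horner|exact: sqrt_continuous].
- move=> s /= /[!in_itv]/= s01; rewrite lee_fin.
  have nM0 : 0 <= 2 * n%:R * M by rewrite !mulr_ge0.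
  rewrite -[leRHS]ger0_norm// -sqrtr_sqr ler_wsqrtr// /Q horner_sum.
  apply: (@le_trans _ _ (\sum_(j < n) (M ^+ 2 + M ^+ 2))).
    apply: ler_sum => j _; rewrite !hornerE.
    have [? ?] := bnd j s s01.
    by rewrite lerD// -real_normK ?num_real// ler_pXn2r// nnegrE.
  rewrite sumr_const card_ord -mulr_natr.
  rewrite [leRHS](_ : _ = (M ^+ 2 + M ^+ 2) * (2 * n%:R ^+ 2)); last by rewrite /=; ring.
  rewrite -[leLHS]mulr_natr ler_wpM2l ?addr_ge0 ?sqr_ge0//.
  by rewrite -natrX -natrM ler_nat; nia.
Qed.

End polynomial_curve.

Section dcc_upper_bound.
Variables (R : realType) (n : nat) (hn : (0 < n)%N).

Let phi : {poly R} := 'X - 3%:R * 'X^2 + 2%:R * 'X^3.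
Let psi : {poly R} := 'X - 'X^2.
(** [Phi], [Psi] and [Xi] are the primitives vanishing at 0 of 2 phi, 6 psi and 15 (phi psi' - psi
    phi'). Their values 0, 1, 1 at 1 record that phi has mean 0, that psi has mean 1/6, and that phi
    dpsi - psi dphi integrates to 1/15; the integer factors clear denominators. *)
Let Phi : {poly R} := 'X^2 - 2%:R * 'X^3 + 'X^4.
Let Psi : {poly R} := 3%:R * 'X^2 - 2%:R * 'X^3.
Let Xi : {poly R} := 10%:R * 'X^3 - 15%:R * 'X^4 + 6%:R * 'X^5.

Let horner_nat (m : nat) (x : R) : (m%:R : {poly R}).[x] = m%:R.
Proof. by rewrite hornerMn hornerC. Qed.

Let horner_1 (x : R) : (1 : {poly R}).[x] = 1.
Proof. by rewrite -polyC1 hornerC. Qed.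

Let hornE := (horner_nat, horner_1, horner0, hornerC, hornerX, hornerXn,
  hornerN, hornerD, hornerM).

Let dphiE : phi^`() = 1 - 6%:R * 'X + 6%:R * 'X^2.
Proof. by rewrite /phi !poly.derivE; ring. Qed.

Let dpsiE : psi^`() = 1 - 2%:R * 'X.
Proof. by rewrite /psi !poly.derivE; ring. Qed.

Let dPhiE : Phi^`() = 2%:R * phi.
Proof. by rewrite /Phi /phi !poly.derivE; ring. Qed.

Let dPsiE : Psi^`() = 6%:R * psi.
Proof. by rewrite /Psi /psi !poly.derivE; ring. Qed.

Let dXiE : Xi^`() = 15%:R * (phi * psi^`() - psi * phi^`()).
Proof. by rewrite dphiE dpsiE /Xi /phi /psi !poly.derivE; ring. Qed.

Let j0 : 'I_n := Ordinal hn.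

(* Besides the straight motion of all coordinates, the first complex coordinate
   performs a loop along [(A * phi, B * psi)], whose area makes up for the
   missing vertical displacement. As [phi] has mean zero and [psi] has not, the
   interaction of the loop with the straight motion is [- dx * B / 3], which the
   choice of [A] compensates. *)
Lemma dcc_heis_near : exists2 C : R, 0 <= C & forall (p q : heis R n) (a : R),
  heis_near p q a -> (dcc p q <= (C * a)%:E)%E.
Proof.
exists (2 * n%:R * (1 + (n%:R + n%:R) * (20 * 13))) => [|p q a pqa].
  by rewrite mulr_ge0// addr_ge0// mulr_ge0// addr_ge0.
rewrite -mulrA.
have a0 : 0 <= a by have [/(_ j0)[+ _] _] := pqa; apply: le_trans.
have [xy t] := pqa.
pose T := contact_form p (q - p).
pose s := Num.sqrt `|T|.
pose dx j := q 0 (xi j) - p 0 (xi j).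
pose dy j := q 0 (yi j) - p 0 (yi j).
(* The loop and its interaction with the straight motion contribute B (A - dx j0 / 3) = B s. As s^2
   = |T|, the sign and the factor 1/2 in B make this - T / 2. *)
pose A := dx j0 / 3 + s.
pose B := - (1 / 2) * Num.sg T * s.
have na0 : 0 <= (n%:R + n%:R) * a by rewrite mulr_ge0// addr_ge0.
have AB : B * (A - dx j0 / 3) = - (1 / 2) * T.
  have TT : Num.sg T * (s * s) = T by rewrite -expr2 sqr_sqrtr// -numEsg.
  by rewrite -[in RHS]TT /A /B; field.
have sa : s <= (n%:R + n%:R) * a.
  rewrite -[leRHS]ger0_norm// -sqrtr_sqr /s ler_wsqrtr//.
  rewrite (le_trans t)// exprMn ler_wpM2r ?sqr_ge0//.
  by rewrite -natrD -natrX -natrM ler_nat; nia.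
have s0 : 0 <= s by exact: sqrtr_ge0.
have ana : a <= (n%:R + n%:R) * a.
  by rewrite ler_peMl// -natrD ler1n; lia.
have Ba : `|B| <= (n%:R + n%:R) * a.
  have s1 : `|Num.sg T| <= 1 by rewrite normr_sg; case: (T != 0).
  rewrite (le_trans _ sa)// /B !normrM (ger0_norm s0) ler_piMl//.
  by apply: mulr_ile1 => //; rewrite normrN ger0_norm ?divr_ge0//; lra.
(* |15 A| is at most 5 a + 15 s, and both a and s are at most 2 n a. *)
have Aa : `|15 * A| <= 20 * ((n%:R + n%:R) * a).
  have [+ _] := xy j0; rewrite -/(dx j0) !ler_norml => /andP[? ?].
  by apply/andP; split; rewrite /A; lra.
pose A' j := A *+ (j == j0).
pose B' j := B *+ (j == j0).
pose gx j : {poly R} := (p 0 (xi j))%:P + (dx j)%:P * 'X + (15 * A' j)%:P * phi.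
pose gy j : {poly R} := (p 0 (yi j))%:P + (dy j)%:P * 'X + (B' j)%:P * psi.
(* The vertical coordinate is forced by the contact equation. Integrating by parts, X dpsi - psi dX
   has primitive X psi - Psi / 3, and phi dX - X dphi has primitive Phi - X phi. The factor 15 in
   [gx] makes the loop term exactly A B Xi. *)
pose gt : {poly R} := (p 0 (ti n))%:P - 2%:R * \sum_(j < n) (
  (p 0 (xi j))%:P * ((dy j)%:P * 'X + (B' j)%:P * psi)
  - (p 0 (yi j))%:P * ((dx j)%:P * 'X + (15 * A' j)%:P * phi)
  + (dx j)%:P * (B' j)%:P * ('X * psi) - (dx j / 3)%:P * (B' j)%:P * Psi
  + (dy j)%:P * (15 * A' j)%:P * (Phi - 'X * phi)
  + (A' j)%:P * (B' j)%:P * Xi).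
apply: (@dcc_poly_curve _ _ gx gy gt).
- by rewrite mulr_ge0// addr_ge0// mulr_ge0// addr_ge0.
- have dsum (F : 'I_n -> {poly R}) : (\sum_j F j)^`() = \sum_j (F j)^`().
    exact: raddf_sum.
  rewrite /gt derivB derivC sub0r poly.derivM dsum.
  rewrite (_ : (2%:R)^`() = 0) ?mul0r ?add0r; last by rewrite -polyC_natr derivC.
  rewrite addrC -mulrBr; apply/eqP; rewrite mulf_eq0; apply/orP; right.
  rewrite -sumrB big1// => j _; clearbody phi psi Phi Psi Xi.
  rewrite /gx /gy !(derivN, derivD, derivC, poly.derivM, derivX).
  rewrite dPhiE dPsiE dXiE.
  have -> : (15 * A' j)%:P = 15%:R * (A' j)%:P :> {poly R}.
    by rewrite polyCM -polyC_natr.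
  have -> : (dx j)%:P = 3%:R * (dx j / 3)%:P :> {poly R}.
    by rewrite -polyC_natr -polyCM mulrC mulfVK.
  by ring.
- move=> j r /andP[r0 r1].
  have r2 : r ^+ 2 <= 1 by rewrite expr_le1.
  have r20 : 0 <= r ^+ 2 by rewrite sqr_ge0.
  (* 13 = 1 + 6 + 6 bounds phi' term by term on [0, 1]; psi' is smaller. *)
  have nrm x y z : `|x| <= a -> `|y| <= 20 * ((n%:R + n%:R) * a) -> `|z| <= 13 ->
      `|x + y * z| <= (1 + (n%:R + n%:R) * (20 * 13)) * a.
    move=> xa ya z1; rewrite (le_trans (ler_normD _ _))// normrM [leRHS]mulrDl mul1r lerD//.
    rewrite (_ : _ * _ * a = (20 * ((n%:R + n%:R) * a)) * 13); last by ring.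
    by rewrite ler_pM.
  have [? ?] := xy j.
  clearbody phi psi.
  rewrite /gx /gy !(derivD, derivC, poly.derivM, derivX) dphiE dpsiE; split.
  + rewrite (_ : _.[r] = dx j + (15 * A' j) * (1 - 6%:R * r + 6%:R * r ^+ 2)); last first.
      by rewrite !hornE; ring.
    apply: nrm => //.
      rewrite /A'; case: eqP => _ //; rewrite mulr0n mulr0 normr0; lra.
    by rewrite ler_norml; apply/andP; split; lra.
  + rewrite (_ : _.[r] = dy j + B' j * (1 - 2%:R * r)); last first.
      by rewrite !hornE; ring.
    apply: nrm => //.
      by rewrite /B'; case: eqP => _; rewrite ?mulr1n ?mulr0n ?normr0; lra.
    by rewrite ler_norml; apply/andP; split; lra.
- apply/rowP => l; rewrite mxE; have [[j ->]|[j ->]| ->] := heis_indexP l.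
  + by rewrite poly_coord_xi /gx /phi !hornE !expr0n/=; ring.
  + by rewrite poly_coord_yi /gy /psi !hornE !expr0n/=; ring.
  + rewrite poly_coord_ti /gt hornerD hornerN hornerM horner_sum big1 => [|j _].
      by rewrite !hornE mulr0 subr0.
    by rewrite /phi /psi /Phi /Psi /Xi !hornE !expr0n/=; ring.
- apply/rowP => l; rewrite mxE; have [[j ->]|[j ->]| ->] := heis_indexP l.
  + by rewrite poly_coord_xi /gx /phi !hornE !expr1n/= /dx; ring.
  + by rewrite poly_coord_yi /gy /psi !hornE !expr1n/= /dy; ring.
  + rewrite poly_coord_ti /gt hornerD hornerN hornerM horner_sum hornerC.
    (* At time 1 the polynomials phi, psi and Phi vanish while Psi and Xi equal 1, so only the
       straight-line area and B (A - dx / 3) survive. *)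
    rewrite (eq_bigr (fun j => (p 0 (xi j) * (q - p) 0 (yi j)
      - p 0 (yi j) * (q - p) 0 (xi j)) + B' j * (A' j - dx j / 3))) => [|j _]; last first.
      by rewrite /phi /psi /Phi /Psi /Xi !hornE !expr1n/= /dx /dy !mxE; field.
    rewrite big_split/= horner_nat.
    have -> : \sum_(i < n) B' i * (A' i - dx i / 3) = - (1 / 2) * T.
      rewrite (bigD1 j0)//= big1 ?addr0 => [|j /negPf jj]; last by rewrite /B' jj mul0r.
      by rewrite /A' /B' eqxx !mulr1n AB.
    have : T = (q - p) 0 (ti n) + 2 * \sum_(j < n) (p 0 (xi j) * (q - p) 0 (yi j)
      - p 0 (yi j) * (q - p) 0 (xi j)) by [].
    set S := \sum_(j < n) _; rewrite mxE => TE.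
    rewrite TE !mxE; lra.
Qed.

End dcc_upper_bound.

(** * Borel sets and integration along coordinate lines *)

(** Subadditivity over a countable set of indices, as needed for covers by sets of boxes. The fibres
    of an injection into the natural numbers have at most one element, which reduces it to
    sequences. *)
Lemma esum_outer_measure (R : realType) (T : choiceType) (U : Type)
    (mu : {outer_measure set U -> \bar R}) (C : set T) (F : T -> set U) :
  countable C -> (mu (\bigcup_(c in C) F c) <= \esum_(c in C) mu (F c))%E.
Proof.
move=> /countable_injP[f finj].
pose G (m : nat) := \bigcup_(c in C `&` f @^-1` [set m]) F c.
have -> : \bigcup_(c in C) F c = \bigcup_m G m.
  apply/seteqP; split => x.
    by move=> [c Cc Fx]; exists (f c) => //; exists c.
  by move=> [m _ [c [Cc _] Fx]]; exists c.
apply: le_trans (outer_measure_sigma_subadditive mu G) _.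
rewrite nneseries_esumT; last by move=> m; exact: outer_measure_ge0.
have -> : \esum_(m in [set: nat]) mu (G m) = \esum_(m in f @` C) mu (G m).
  rewrite [RHS]esum_mkcond; apply: eq_esum => m _; case: ifPn => // mC.
  rewrite (_ : G m = set0) ?outer_measure0//; apply/seteqP; split => // x [c [Cc fc] _].
  by move/negP: mC; apply; rewrite inE; exists c.
rewrite (@reindex_esum _ _ _ C (f @` C) f); last first.
  by split => // c d Cc Cd; exact: finj.
apply: le_esum => c Cc; rewrite (_ : G (f c) = F c)//.
apply/seteqP; split => x; last by move=> Fx; exists c.
by move=> [d [Cd /finj ->//]]; rewrite inE.
Qed.

Section box_measure.
Variables (R : realType) (k : nat).
Implicit Types (c : 'rV[R]_k * 'rV[R]_k) (A X : set 'rV[R]_k) (i : 'I_k) (a : R).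

Lemma box_volume_ge0 c : (forall i, c.1 0 i <= c.2 0 i) -> 0 <= box_volume c.
Proof. by move=> c0; apply: prodr_ge0 => i _; rewrite subr_ge0. Qed.

Lemma lebesgue_outer_box c : (forall i, c.1 0 i <= c.2 0 i) ->
  (lebesgue_outer (box c) <= (box_volume c)%:E)%E.
Proof.
move=> c0; apply: ereal_inf_lbound; exists [set c].
  split; first exact: countable1.
  - by move=> _ ->.
  - by move=> x cx; exists c.
by rewrite esum_set1// lee_fin box_volume_ge0.
Qed.

Definition upd (x : 'rV[R]_k) i a : 'rV[R]_k := \row_j (if j == i then a else x 0 j).

Lemma updii x i a : upd x i a 0 i = a.
Proof. by rewrite mxE eqxx. Qed.

Lemma updij x i j a : j != i -> upd x i a 0 j = x 0 j.
Proof. by rewrite mxE => /negPf ->. Qed.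

(** The hyperplane x_i = a cuts each box of a cover into two boxes whose volumes add up to the
    original volume. *)
Lemma half_space_caratheodory i a :
  (@lebesgue_outer_measure R k).-caratheodory [set x | x 0 i < a].
Proof.
apply: le_caratheodory_measurable => X.
apply: le_ereal_inf_tmp => _ [C [cC C0 XC] <-].
set H := [set x : 'rV[R]_k | x 0 i < a].
pose mu := @lebesgue_outer_measure R k.
have le1 Y : (mu (X `&` Y) <= \esum_(c in C) mu (box c `&` Y))%E.
  apply: le_trans (esum_outer_measure mu _ cC).
  apply: le_outer_measure => x [/XC[c Cc cx] Yx].
  by exists c.
apply: le_trans (leeD (le1 H) (le1 (~` H))) _.
rewrite -esumD; last 2 first.
- by move=> c _; exact: outer_measure_ge0.
- by move=> c _; exact: outer_measure_ge0.
apply: le_esum => c /C0 c0.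
(* This is a clamped to the i-th side of the box: both pieces are honest boxes, one of them
   degenerate when the hyperplane misses c. *)
pose m := Num.max (c.1 0 i) (Num.min (c.2 0 i) a).
have c1m : c.1 0 i <= m by rewrite le_max lexx.
have mc2 : m <= c.2 0 i by rewrite ge_max c0 ge_min lexx.
have volE : (box_volume c)%:E =
    ((box_volume (c.1, upd c.2 i m))%:E + (box_volume (upd c.1 i m, c.2))%:E)%E.
  rewrite -EFinD /box_volume !(bigD1 (P := xpredT) i)//= !updii.
  have -> : \prod_(j < k | j != i) (upd c.2 i m 0 j - c.1 0 j) =
      \prod_(j < k | j != i) (c.2 0 j - c.1 0 j).
    by apply: eq_bigr => j ji; rewrite updij.
  have -> : \prod_(j < k | j != i) (c.2 0 j - upd c.1 i m 0 j) =
      \prod_(j < k | j != i) (c.2 0 j - c.1 0 j).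
    by apply: eq_bigr => j ji; rewrite updij.
  by congr (_%:E); ring.
rewrite volE; apply: leeD.
  apply: le_trans (lebesgue_outer_box (c := (c.1, upd c.2 i m)) _) => /=.
    apply: le_outer_measure => x [cx Hx] j /=; rewrite !mxE.
    have /andP[-> xc] := cx j; case: eqP => [ji|//] /=.
    by rewrite le_max le_min -{2}ji xc ji (ltW Hx) orbT.
  by move=> j; rewrite mxE; case: eqP => [->|].
apply: le_trans (lebesgue_outer_box (c := (upd c.1 i m, c.2)) _) => /=.
  apply: le_outer_measure => x [cx /negP]; rewrite -leNgt => Hx j /=; rewrite !mxE.
  have /andP[xc ->] := cx j; case: eqP => [ji|]; rewrite ?xc//= andbT.
  by rewrite ge_max -{1}ji xc ge_min ji Hx orbT.
by move=> j; rewrite mxE; case: eqP => [->|].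
Qed.

End box_measure.

Definition half_spaces (R : realType) (k : nat) : set (set 'rV[R]_k) :=
  [set A | exists (i : 'I_k) (a : R), A = [set x : 'rV[R]_k | x 0 i < a]].

(* Unlike the Caratheodory sigma-algebra of [Rn R k], the Borel one makes
   [(x, s) |-> x + s *: e] jointly measurable. *)
Notation borelRn R k := (g_sigma_algebraType (@half_spaces R k)).

Section borel.
Variables (R : realType) (k : nat).
Local Notation B := (borelRn R k).

Lemma measurable_coord (i : 'I_k) : measurable_fun setT (fun x : B => (x : 'rV[R]_k) 0 i).
Proof.
apply: (measurability _ (RGenInftyO.measurableE R)).
move=> _ [_ [a ->] <-]; rewrite setTI; apply: sub_sigma_algebra.
by exists i, a; apply/seteqP; split => x /=; rewrite in_itv.
Qed.

Lemma measurable_fun_borel d (T : measurableType d) (h : T -> B) :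
  (forall i, measurable_fun setT (fun x => (h x : 'rV[R]_k) 0 i)) ->
  measurable_fun setT h.
Proof.
move=> mh; apply: (@measurability _ _ _ B _ _ (@half_spaces R k)) => //.
move=> _ [_ [i [a ->]] <-]; rewrite setTI.
rewrite (_ : _ @^-1` _ = (fun x => (h x : 'rV[R]_k) 0 i) @^-1` `]-oo, a[%classic).
  by rewrite -[X in measurable X]setTI; apply: mh => //; exact: measurable_itv.
by apply/seteqP; split => x /=; rewrite in_itv.
Qed.

Lemma borel_caratheodory (A : set B) : measurable A ->
  measurable (A : set (Rn R k)).
Proof.
move=> mA.
have : @measurable _ (Rn R k) `<=` @measurable _ (Rn R k) by [].
suff sub : <<s @half_spaces R k >> `<=` @measurable _ (Rn R k) by move=> _; exact: sub.
apply: smallest_sub; first by apply: sigma_algebra_measurable.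
by move=> _ [i [a ->]]; exact: half_space_caratheodory.
Qed.

Lemma measurable_id_borel : measurable_fun setT (id : Rn R k -> B).
Proof. by move=> _ A mA; rewrite setTI; exact: borel_caratheodory. Qed.

Lemma measurable_box (c : 'rV[R]_k * 'rV[R]_k) : measurable (box c : set B).
Proof.
rewrite (_ : box c = \bigcap_(i in [set: 'I_k])
    ((fun x : B => (x : 'rV[R]_k) 0 i) @^-1` `[c.1 0 i, c.2 0 i])).
  apply: fin_bigcap_measurable; first exact: finite_finset.
  move=> i _; rewrite -[X in measurable X]setTI.
  by apply: measurable_coord => //; exact: measurable_itv.
apply/seteqP; split => x /=; first by move=> cx i _ /=; rewrite in_itv; exact: cx.
by move=> cx i; have := cx i Logic.I; rewrite /= in_itv.
Qed.

Definition borel_lebesgue (A : set B) : \bar R := lebesgue_outer A.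

Let bl0 : borel_lebesgue set0 = 0%E. Proof. exact: lebesgue_outer0. Qed.

Let bl_ge0 A : (0 <= borel_lebesgue A)%E. Proof. exact: lebesgue_outer_ge0. Qed.

Let bl_sigma : semi_sigma_additive borel_lebesgue.
Proof.
move=> F mF tF mUF.
apply: (@measure_semi_sigma_additive _ _ _ (lebesgueRn R k) F) => //.
  by move=> i; exact: borel_caratheodory.
exact: borel_caratheodory.
Qed.

HB.instance Definition _ := isMeasure.Build _ _ _ borel_lebesgue bl0 bl_ge0 bl_sigma.

Lemma borel_lebesgue_box_lty c : (borel_lebesgue (box c) < +oo)%E.
Proof.
have [c0|] := pselect (forall i, c.1 0 i <= c.2 0 i).
  by apply: le_lt_trans (lebesgue_outer_box c0) _; rewrite ltry.
rewrite -existsNE => -[i /negP ci]; rewrite (_ : box c = set0) ?measure0//.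
by apply/seteqP; split => // x /(_ i)/andP[/le_trans h /h]; apply/negP.
Qed.

Definition cube (a : R) : 'rV[R]_k * 'rV[R]_k := (const_mx (- a), const_mx a).

Lemma cubeP a (x : 'rV[R]_k) : box (cube a) x <-> forall i, `|x 0 i| <= a.
Proof.
by split => h i; have := h i; rewrite /cube/= !mxE ler_norml.
Qed.

Lemma bigcup_cube : \bigcup_m box (cube m%:R) = setT.
Proof.
apply/seteqP; split => // x _.
have S0 i : `|x 0 i| <= \sum_j `|x 0 j| by rewrite (bigD1 i)//= lerDl sumr_ge0.
have [m _ mx] : exists2 m : nat, True & \sum_j `|x 0 j| <= m%:R.
  exists (Num.truncn (\sum_j `|x 0 j|)).+1 => //.
  by apply/ltW; rewrite truncnS_gt.
by exists m => //; apply/cubeP => i; apply: le_trans mx.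
Qed.

Let bl_sigma_finite : sigma_finite setT borel_lebesgue.
Proof.
exists (fun m => box (cube m%:R)); first by rewrite bigcup_cube.
by move=> m; split; [exact: measurable_box|exact: borel_lebesgue_box_lty].
Qed.

HB.instance Definition _ :=
  @Measure_isSigmaFinite.Build _ _ _ borel_lebesgue bl_sigma_finite.

(** A countable union of boxes is Borel; intersecting covers of excess 1 / (m + 1) attains the outer
    measure. *)
Lemma borel_hull (A : set 'rV[R]_k) : exists2 H : set B, measurable H &
  A `<=` H /\ lebesgue_outer H = lebesgue_outer A.
Proof.
have [Aoo|Aoo] := eqVneq (lebesgue_outer A) +oo%E.
  exists setT => //; split => //; rewrite Aoo; apply/eqP.
  by rewrite -leye_eq -Aoo; exact: le_lebesgue_outer.
have Afin : lebesgue_outer A \is a fin_num.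
  by rewrite ge0_fin_numE ?lebesgue_outer_ge0// ltey.
have /choice[H HP] : forall m : nat, exists H : set B, [/\ measurable H, A `<=` H &
    (lebesgue_outer H <= lebesgue_outer A + (m.+1%:R^-1)%:E)%E].
  move=> m; have m0 : (0 : R) < m.+1%:R^-1 by rewrite invr_gt0.
  have [_ [C [cC C0 AC] <-] Clt] := lb_ereal_inf_adherent m0 Afin.
  exists (\bigcup_(c in C) box c); split => //.
    rewrite bigcup_set_type; apply: countable_bigcupT_measurable => [|c].
      by rewrite (eq_countable (card_setT _)).
    exact: measurable_box.
  apply: le_trans (ltW Clt).
  apply: le_trans (esum_outer_measure (@lebesgue_outer_measure R k) _ cC) _.
  by apply: le_esum => c /C0; exact: lebesgue_outer_box.
exists (\bigcap_m H m); first by apply: bigcapT_measurable => m; have [] := HP m.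
split; first by move=> x Ax m _; have [_ + _] := HP m; exact.
apply/eqP; rewrite eq_le; apply/andP; split; last first.
  by apply: le_lebesgue_outer => x Ax m _; have [_ + _] := HP m; exact.
apply/lee_addgt0Pr => e e0.
have [m me] : exists m : nat, m.+1%:R^-1 < e :> R.
  exists (Num.truncn e^-1); rewrite invf_plt ?posrE//.
  by rewrite truncnS_gt.
apply: (@le_trans _ _ (lebesgue_outer (H m))).
  by apply: le_lebesgue_outer; exact: bigcap_inf.
have [_ _ /le_trans] := HP m; apply.
by rewrite leeD2l// lee_fin ltW.
Qed.

Lemma lebesgue_outer_translate_le (v : 'rV[R]_k) (A : set 'rV[R]_k) :
  (lebesgue_outer [set x | A (x + v)%R] <= lebesgue_outer A)%E.
Proof.
apply: le_ereal_inf_tmp => _ [C [cC C0 AC] <-].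
pose F (c : 'rV[R]_k * 'rV[R]_k) := (c.1 - v, c.2 - v).
apply: (@le_trans _ _ (lebesgue_outer (\bigcup_(c in C) box (F c)))).
  apply: le_lebesgue_outer => x /AC[c Cc cx]; exists c => // i.
  by have := cx i; rewrite /= !mxE lerBlDr lerBrDr.
apply: le_trans (esum_outer_measure (@lebesgue_outer_measure R k) _ cC) _.
apply: le_esum => c /C0 c0.
apply: le_trans (lebesgue_outer_box _) _ => [i|]; first by rewrite !mxE lerD2r.
rewrite lee_fin le_eqVlt; apply/orP; left; apply/eqP.
by apply: eq_bigr => i _; rewrite !mxE; ring.
Qed.

Lemma lebesgue_outer_translate (v : 'rV[R]_k) (A : set 'rV[R]_k) :
  lebesgue_outer [set x | A (x + v)] = lebesgue_outer A.
Proof.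
apply/eqP; rewrite eq_le lebesgue_outer_translate_le/=.
have := lebesgue_outer_translate_le (- v) [set x | A (x + v)].
have -> // : [set x | [set y | A (y + v)] (x - v)] = A.
by apply/seteqP; split => x /=; rewrite subrK.
Qed.

End borel.

Lemma ae_imply d (T : measurableType d) (R : realType)
    (mu : {measure set T -> \bar R}) (P Q : T -> Prop) :
  (forall x, P x -> Q x) -> {ae mu, forall x, P x} -> {ae mu, forall x, Q x}.
Proof.
move=> PQ [N [mN N0 PN]]; exists N; split => //.
by apply: subset_trans PN => x /=; apply: contra_not; exact: PQ.
Qed.

Lemma ae_imply2 d (T : measurableType d) (R : realType)
    (mu : {measure set T -> \bar R}) (P1 P2 Q : T -> Prop) :
  (forall x, P1 x -> P2 x -> Q x) ->
  {ae mu, forall x, P1 x} -> {ae mu, forall x, P2 x} -> {ae mu, forall x, Q x}.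
Proof.
move=> PQ P1x P2x; apply: negligibleS (negligibleU P1x P2x) => x /= nQ.
have [P1'|] := pselect (P1 x); last by left.
have [P2'|] := pselect (P2 x); last by right.
by exfalso; apply: nQ; exact: PQ.
Qed.

Lemma ge0_integral_preserving d (T : measurableType d) (R : realType)
    (mu : {measure set T -> \bar R}) (phi : T -> T) (D : set T) (f : T -> \bar R) :
  measurable_fun setT phi ->
  (forall A, measurable A -> mu (phi @^-1` A) = mu A) ->
  measurable D -> measurable_fun D f -> (forall x, (0 <= f x)%E) ->
  (\int[mu]_(x in D) f x = \int[mu]_(x in phi @^-1` D) f (phi x))%E.
Proof.
move=> mphi muphi mD mf f0.
rewrite -(ge0_integral_pushforward mphi mu mD mf)//.
by apply: eq_measure_integral => A mA _; rewrite /pushforward -muphi.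
Qed.

Lemma lebesgue_measure_translate (R : realType) (a : R)
    (A : set (measurableTypeR R)) : measurable A ->
  lebesgue_measure ((fun x : measurableTypeR R => a + x : measurableTypeR R) @^-1` A) =
  lebesgue_measure A.
Proof.
move=> mA.
have mphi : measurable_fun setT (fun x : measurableTypeR R => (a + x)%R : measurableTypeR R).
  by apply: measurable_funD; [exact: measurable_cst|exact: measurable_id].
have E : pushforward (@lebesgue_measure R)
    (fun x : measurableTypeR R => (a + x)%R : measurableTypeR R) A = lebesgue_measure A.
  apply/esym/lebesgue_measure_unique => //= _ [[b c]] _ <-.
  rewrite /pushforward (_ : _ @^-1` _ = `]b - a, c - a]%classic).
    rewrite !lebesgue_measure_itv/= !lte_fin ltrD2r.
    by case: ifP => // _; rewrite -!EFinD; congr (_%:E); ring.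
  by apply/seteqP; split => x /=; rewrite !in_itv/= ltrBlDl lerBrDl.
exact: E.
Qed.

Lemma ge0_integral_translate (R : realType) (a : R) (D : set (measurableTypeR R))
    (f : measurableTypeR R -> \bar R) :
  measurable D -> measurable_fun D f -> (forall x, (0 <= f x)%E) ->
  (\int[lebesgue_measure]_(x in D) f x =
   \int[lebesgue_measure]_(x in [set x | D (a + x)%R]) f (a + x)%R)%E.
Proof.
move=> mD mf f0.
apply: (@ge0_integral_preserving _ _ _ _ (fun x : measurableTypeR R => (a + x)%R : measurableTypeR R)) => //.
  by apply: measurable_funD; [exact: measurable_cst|exact: measurable_id].
by move=> A mA; exact: lebesgue_measure_translate.
Qed.

Section line_fubini.
Variables (R : realType) (k : nat) (i : 'I_k).
Local Notation B := (borelRn R k).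
Local Notation RR := (measurableTypeR R).
Local Notation lam := (@borel_lebesgue R k).
Local Notation leb := (@lebesgue_measure R).

(** Lines are parametrised redundantly, by an arbitrary base point of R^k and a shift. Fubini on R^k
    x R together with translation invariance then replaces a splitting of R^k into a line and its
    complement. *)
Definition line (x : 'rV[R]_k) (s : R) : 'rV[R]_k := x + s *: delta_mx 0 i.

Lemma line0 x : line x 0 = x.
Proof. by rewrite /line scale0r addr0. Qed.

Lemma lineD x s t : line (line x s) t = line x (s + t).
Proof. by rewrite /line scalerDl addrA. Qed.

Lemma line_coord x s : line x s 0 i = x 0 i + s.
Proof. by rewrite /line !mxE !eqxx mulr1. Qed.

Lemma line_coord_neq x s j : j != i -> line x s 0 j = x 0 j.
Proof. by move=> ji; rewrite /line !mxE (negPf ji) andbF mulr0 addr0. Qed.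

Lemma measurable_line_pair :
  measurable_fun setT (fun z : B * RR => line z.1 z.2 : B).
Proof.
apply: measurable_fun_borel => j; rewrite /line.
under eq_fun do rewrite !mxE.
apply: measurable_funD.
  exact: (measurableT_comp (measurable_coord j) measurable_fst).
by apply: measurable_funM; [exact: measurable_snd|exact: measurable_cst].
Qed.

Lemma measurable_line_l s : measurable_fun setT (fun x : B => line x s : B).
Proof.
exact: (measurableT_comp measurable_line_pair
  (measurable_fun_pair (@measurable_id _ B setT) (measurable_cst (s : RR)))).
Qed.

Lemma measurable_line_r x : measurable_fun setT (fun s : RR => line x s : B).
Proof.
exact: (measurableT_comp measurable_line_pair
  (measurable_fun_pair (measurable_cst (x : B)) (@measurable_id _ RR setT))).
Qed.

Lemma borel_lebesgue_line s (A : set B) :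
  lam ((fun x : B => line x s) @^-1` A) = lam A.
Proof. exact: lebesgue_outer_translate. Qed.

Lemma ge0_integral_line s (f : B -> \bar R) :
  measurable_fun setT f -> (forall x, (0 <= f x)%E) ->
  (\int[lam]_x f (line x s) = \int[lam]_x f x)%E.
Proof.
move=> mf f0.
rewrite [RHS](@ge0_integral_preserving _ _ _ _ (fun x : B => line x s : B))//.
  exact: measurable_line_l.
by move=> A _; exact: borel_lebesgue_line.
Qed.

(** For each fixed s the map x -> line x s preserves [lam], so after Tonelli the inner integral no
    longer depends on s. *)
Lemma integral_line_fubini (D : set RR) (f : B -> \bar R) : measurable D ->
  measurable_fun setT f -> (forall x, (0 <= f x)%E) ->
  (\int[lam]_x \int[leb]_(s in D) f (line x s) = leb D * \int[lam]_x f x)%E.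
Proof.
move=> mD mf f0.
pose F (z : B * RR) : \bar R := ((fun z => f (line z.1 z.2)) \_ (setT `*` D)) z.
have mF : measurable_fun setT F.
  apply/(measurable_restrictT _ _).1; first exact: measurableX.
  by apply: measurable_funTS; apply: measurableT_comp mf measurable_line_pair.
have F0 z : (0 <= F z)%E by apply: erestrict_ge0 => ? _.
have FE x s : F (x, s) = ((fun s => f (line x s)) \_ D) s.
  by rewrite /F !patchE in_setX in_setT.
transitivity (\int[lam]_x \int[leb]_s F (x, s))%E.
  by apply: eq_integral => x _; rewrite integral_mkcond; apply: eq_integral => s _; rewrite FE.
rewrite (fubini_tonelli (m1 := lam) (m2 := leb) F mF F0).
transitivity (\int[leb]_(s in D) (cst (\int[lam]_x f x) s))%E.
  rewrite [RHS]integral_mkcond; apply: eq_integral => s _; rewrite patchE.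
  case: ifPn => sD.
    rewrite -(ge0_integral_line s mf f0); apply: eq_integral => x _.
    by rewrite FE patchE sD.
  by apply: integral0_eq => x _; rewrite FE patchE (negPf sD).
by rewrite integral_cst// muleC.
Qed.

(** Apply [integral_line_fubini] to the indicator of N over the shifts in [0, 1], a set of measure
    1: the double integral vanishes. *)
Lemma line_negligible_measure0 (N : set B) : measurable N ->
  {ae lam, forall x, leb [set s | N (line x s)] = 0%E} -> lam N = 0%E.
Proof.
move=> mN aeN.
have mS (x : B) : measurable [set s : RR | N (line x s)].
  by rewrite -[X in measurable X]setTI; exact: measurable_line_r.
have := integral_line_fubini (D := `[0%R, 1%R]) (measurable_itv _) (f := fun x => (\1_N x)%:E).
rewrite integral_indic// setIT lebesgue_measure_itv/= lte_fin ltr01 sube0 mul1e => <- //.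
- have mF : measurable_fun setT (fun x : B => leb ([set s | N (line x s)] `&` `[0%R, 1%R])).
    have mS2 : measurable [set z : B * RR | N (line z.1 z.2) /\ `[0%R, 1%R]%classic z.2].
      apply: measurableI.
        by rewrite -[X in measurable X]setTI; exact: measurable_line_pair.
      rewrite -[X in measurable X]setTI; exact: measurable_snd.
    have := measurable_fun_xsection leb mS2.
    by apply: eq_measurable_fun => x _; rewrite /= /xsection/=; congr lebesgue_measure;
      apply/seteqP; split => s /=; rewrite inE.
  transitivity (\int[lam]_x (cst 0 x))%E; last by rewrite integral_cst// mul0e.
  transitivity (\int[lam]_x leb ([set s | N (line x s)] `&` `[0%R, 1%R]))%E.
    apply: eq_integral => x _.
    by rewrite -integral_indic.
  apply: ge0_ae_eq_integral => //.
  apply: ae_imply aeN => x Nx _; apply/eqP; rewrite eq_le measure_ge0 andbT -[leRHS]Nx.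
  by apply: le_measure; rewrite ?inE//; exact: measurableI.
- exact/measurable_EFinP/measurable_indic.
Qed.

Lemma measurable_section_integral (D : set RR) (F : B * RR -> \bar R) :
  measurable D -> measurable_fun setT F -> (forall z, (0 <= F z)%E) ->
  measurable_fun setT (fun x : B => \int[leb]_(s in D) F (x, s))%E.
Proof.
move=> mD mF F0.
pose G (z : B * RR) : \bar R := (F \_ (setT `*` D)) z.
have mG : measurable_fun setT G.
  apply/(measurable_restrictT _ _).1; first exact: measurableX.
  exact: measurable_funTS.
have G0 z : (0 <= G z)%E by apply: erestrict_ge0 => ? _.
have := measurable_fun_fubini_tonelli_F (m2 := leb) G mG G0.
apply: eq_measurable_fun => x _; rewrite /fubini_F [RHS]integral_mkcond.
by apply: eq_integral => s _; rewrite /G !patchE in_setX in_setT.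
Qed.

(** Exchanges quantifiers: what is proved for each fixed shift at almost every point becomes, at
    almost every point, true for almost every shift. *)
Lemma ae_section_negligible (S : set (B * RR)) : measurable S ->
  (forall s, lam [set x | S (x, s)] = 0%E) ->
  {ae lam, forall x, leb [set s | S (x, s)] = 0%E}.
Proof.
move=> mS S0.
have F0 z : (0 <= (\1_S z)%:E :> \bar R)%E by rewrite lee_fin.
have mF : measurable_fun setT (fun z : B * RR => (\1_S z)%:E : \bar R).
  exact/measurable_EFinP/measurable_indic.
have := fubini_tonelli (m1 := lam) (m2 := leb) _ mF F0.
have -> : (\int[leb]_y \int[lam]_x (\1_S (x, y))%:E = 0)%E.
  apply: integral0_eq => s _; rewrite -[RHS](S0 s).
  rewrite (_ : (fun x => _) = (fun x => (\1_[set x | S (x, s)] x)%:E))//.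
  rewrite integral_indic ?setIT//.
  have := measurable_ysection s mS; congr measurable.
  by apply/seteqP; split => x; rewrite /ysection/= inE.
move=> H.
have mG : measurable_fun setT (fun x : B => leb [set s | S (x, s)]).
  have := measurable_fun_xsection leb mS.
  by apply: eq_measurable_fun => x _; rewrite /= /xsection/=; congr lebesgue_measure;
    apply/seteqP; split => s /=; rewrite inE.
have : ae_eq lam setT (fun x : B => leb [set s | S (x, s)]) (cst 0%E).
  apply/ae_eq_integral_abs => //.
  rewrite -[RHS]H; apply: eq_integral => x _; rewrite gee0_abs//.
  rewrite [in RHS](_ : (fun y => _) = (fun y => (\1_[set s | S (x, s)] y)%:E))//.
  rewrite integral_indic ?setIT//.
  have := measurable_xsection x mS; congr measurable.
  by apply/seteqP; split => s; rewrite /xsection/= inE.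
by apply: ae_imply => x; apply.
Qed.

End line_fubini.

(** * Lebesgue points, maximal bounds and density points along lines *)

Lemma lebesgue_pt_right (R : realType) (h : R -> R) (s : R) :
  measurable_fun setT h -> lebesgue_pt h s ->
  forall e : R, 0 < e -> exists2 r0 : R, 0 < r0 & forall r, 0 < r < r0 ->
  (\int[lebesgue_measure]_(t in `[s, (s + r)%R]) `|h t - h s|%R%:E <= (e * r)%:E)%E.
Proof.
move=> mh hs e e0.
(* [s, s + r] lies in the ball of radius 2 r, whose length 4 r turns a mean below e / 4 into an
   integral below e r. *)
have e4 : (0%E < (e / 4)%:E :> \bar R)%E by rewrite lte_fin divr_gt0.
have [r0 /= r00 H] := hs _ (open_ereal_lt' e4).
exists (r0 / 2) => [|r /andP[rpos rr0]]; first by rewrite divr_gt0.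
have r20 : 0 < 2 * r by rewrite mulr_gt0.
have rr : 2 * r < r0 by rewrite mulrC -ltr_pdivlMr.
have : (davg h s (2 * r) < (e / 4)%:E)%E.
  by apply: H => //=; rewrite sub0r normrN gtr0_norm.
rewrite /davg /iavg (lebesgue_measure_ball _ (ltW r20)).
have cne : (2 * r *+ 2) != 0 by rewrite mulrn_eq0/= gt_eqF.
rewrite inver (negPf cne) => Hd.
apply: (@le_trans _ _ (\int[lebesgue_measure]_(t in ball s (2 * r)%R) `|h t - h s|%R%:E)%E).
  apply: ge0_subset_integral => //.
  - exact: measurable_ball.
  - apply/measurable_EFinP; apply: measurable_funTS; apply: measurableT_comp => //.
    exact: measurable_funB.
  - rewrite ball_itv => t /=; rewrite !in_itv/= => /andP[st tr]; apply/andP; split; lra.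
have I0 : (0 <= \int[lebesgue_measure]_(t in ball s (2 * r)%R) `|h t - h s|%R%:E)%E.
  by apply: integral_ge0 => t _; rewrite lee_fin.
move: Hd I0; set I := integral _ _ _; case: I => [j||]//=.
  rewrite -EFinM !lte_fin !lee_fin => Hd j0.
  have c0 : 0 < 2 * r *+ 2 by rewrite pmulrn_lgt0.
  move: Hd; rewrite mulrC ltr_pdivrMr// mulr2n; lra.
by rewrite gt0_muley ?lte_fin ?invr_gt0 ?pmulrn_lgt0.
Qed.

Section line_lebesgue.
Variables (R : realType) (k : nat) (i : 'I_k).
Local Notation B := (borelRn R k).
Local Notation RR := (measurableTypeR R).
Local Notation lam := (@borel_lebesgue R k).
Local Notation leb := (@lebesgue_measure R).
Local Notation line := (line i).

(** Tolerances and radii run through reciprocals of integers only, so that the set of good points is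
    obtained from Borel sets by countable operations. *)
Let good (g : B -> R) (p l : nat) : set B := [set x |
  (\int[leb]_(t in `[0%R, l.+1%:R^-1%R]) `|g (line x t) - g x|%R%:E <=
    (p.+1%:R^-1 * l.+1%:R^-1)%R%:E)%E].

(** On almost every line g is locally integrable, and one-dimensional Lebesgue differentiation
    leaves a null set of bad shifts; [line_negligible_measure0] turns this into a null set of
    R^k. *)
Lemma ae_line_lebesgue_pt (g : B -> R) : measurable_fun setT g ->
  {ae lam, forall x, forall m : nat,
    (\int[leb]_(t in `[(- m%:R)%R, m%:R%R]) `|g (line x t)|%R%:E < +oo)%E} ->
  {ae lam, forall x, forall p : nat, exists L : nat, forall l, (L <= l)%N ->
    (\int[leb]_(t in `[0%R, l.+1%:R^-1%R]) `|g (line x t) - g x|%R%:E <=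
    (p.+1%:R^-1 * l.+1%:R^-1)%R%:E)%E}.
Proof.
move=> mg gfin.
have mgood p l : measurable (good g p l).
  rewrite -[X in measurable X]setTI; apply: emeasurable_fun_le => //.
  have mF : measurable_fun setT
      (fun z : B * RR => `|g (line z.1 z.2) - g z.1|%R%:E : \bar R).
    apply/measurable_EFinP; apply: measurableT_comp => //.
    apply: measurable_funB; first exact: (measurableT_comp mg (measurable_line_pair i)).
    exact: (measurableT_comp mg measurable_fst).
  apply: (measurable_section_integral (F := fun z => `|g (line z.1 z.2) - g z.1|%R%:E)) => //.
pose Good := \bigcap_p \bigcup_L \bigcap_(l in [set l | (L <= l)%N]) good g p l.
have mGood : measurable Good.
  apply: bigcapT_measurable => p; apply: bigcupT_measurable => L.
  by apply: bigcap_measurable => //; exists L => /=.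
have Bad0 : lam (~` Good) = 0%E.
  apply: (@line_negligible_measure0 _ _ i); first exact: measurableC.
  apply: ae_imply gfin => x xfin.
  pose h (s : RR) : R := g (line x s).
  have mh : measurable_fun setT h by exact: (measurableT_comp mg (measurable_line_r i x)).
  have lh : locally_integrable setT h.
    split => //; first exact: openT.
    move=> K _ cK.
    have [M [_ /(_ (`|M| + 1))]] := compact_bounded cK.
    move=> /(_ _)/= KM.
    have {}KM y : K y -> `|y| <= `|M| + 1.
      by move=> Ky; apply: KM => //; rewrite (le_lt_trans (ler_norm _))// ltrDl.
    pose m := (Num.truncn (`|M| + 1)).+1.
    apply: le_lt_trans (xfin m).
    apply: ge0_subset_integral => //.
    - exact: compact_measurable.
    - by apply/measurable_EFinP; apply: measurable_funTS; apply: measurableT_comp.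
    - move=> y /KM yM /=; rewrite in_itv/= -ler_norml (le_trans yM)//.
      by rewrite ltW// truncnS_gt.
  have mS : measurable [set s : RR | ~ Good (line x s)].
    by have := measurable_line_r i x measurableT (measurableC mGood); rewrite setTI.
  have [N [mN N0 NP]] := lebesgue_differentiation lh.
  apply/eqP; rewrite eq_le measure_ge0 andbT -[leRHS]N0.
  apply: le_measure; rewrite ?inE//; apply: subset_trans NP => s /= nG hs; apply: nG.
  move=> p _.
  have p0 : (0 : R) < p.+1%:R^-1 by rewrite invr_gt0.
  have [r0 r00 Hr] := lebesgue_pt_right mh hs p0.
  exists (Num.truncn r0^-1) => // l /= Ll; rewrite /good/=.
  have l0 : (0 : R) < l.+1%:R^-1 < r0.
    rewrite invr_gt0 ltr0n/= invf_plt ?posrE//.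
    by apply: lt_le_trans (truncnS_gt _) _; rewrite ler_nat.
  have := Hr _ l0; rewrite (ge0_integral_translate s)//; last first.
    apply/measurable_EFinP; apply: measurable_funTS; apply: measurableT_comp => //.
    exact: measurable_funB.
  rewrite (_ : [set t | _] = `[0%R, l.+1%:R^-1]%classic); last first.
    by apply/seteqP; split => t /=; rewrite !in_itv/= lerDl lerD2l.
  apply: le_trans; rewrite le_eqVlt; apply/orP; left; apply/eqP.
  by apply: eq_integral => t _; rewrite lineD.
exists (~` Good); split => //; first exact: measurableC.
move=> x /= H Gx; apply: H => p.
by have [L _ HL] := Gx p Logic.I; exists L => l Ll; exact: HL.
Qed.

End line_lebesgue.

Lemma le_measure_sub d (T : measurableType d) (R : realType)
    (mu : {measure set T -> \bar R}) (A B : set T) :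
  measurable A -> measurable B -> A `<=` B -> (mu A <= mu B)%E.
Proof. by move=> mA mB AB; apply: le_measure; rewrite ?inE. Qed.

Lemma nondecreasing_measure_approx d (T : measurableType d) (R : realType)
    (mu : {measure set T -> \bar R}) (A : set T) (F : nat -> set T) (e : R) :
  measurable A -> (forall n, measurable (F n)) -> (mu A < +oo)%E ->
  {homo F : m n / (m <= n)%N >-> m `<=` n} ->
  mu (A `\` \bigcup_n F n) = 0%E -> 0 < e -> exists n, (mu (A `\` F n) < e%:E)%E.
Proof.
move=> mA mF Aoo ndF A0 e0.
have cv : mu \o (fun n => A `\` F n) @ \oo --> mu (\bigcap_n (A `\` F n)).
  apply: nonincreasing_cvg_mu => //.
  - apply: le_lt_trans Aoo; apply: le_measure_sub => //; exact: measurableD.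
  - by move=> n; exact: measurableD.
  - by apply: bigcapT_measurable => n; exact: measurableD.
  - by move=> m n mn; apply/subsetPset; apply: setDS; exact: ndF.
have E : \bigcap_n (A `\` F n) = A `\` \bigcup_n F n.
  apply/seteqP; split => x /=.
    by move=> H; split; [have [] := H 0%N Logic.I|move=> [n _ Fx]; have [] := H n Logic.I].
  by move=> [Ax nF] n _; split => // Fx; apply: nF; exists n.
rewrite E A0 in cv.
have e0' : (0%E < e%:E :> \bar R)%E by rewrite lte_fin.
have [n _ Hn] := cv _ (open_ereal_lt' e0').
by exists n; exact: Hn n (leqnn n).
Qed.

(** Passes from the radii 1 / (l + 1) to arbitrary ones at the cost of a factor 2, taking for l + 1
    the integer part of 1 / r. *)
Lemma invS_bracket (R : realType) (r : R) : 0 < r <= 1 ->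
  exists l : nat, [/\ l.+2%:R^-1 < r, r <= l.+1%:R^-1 & l.+1%:R^-1 <= 2 * r].
Proof.
move=> /andP[r0 r1].
have t1 : (0 < Num.truncn r^-1)%N by rewrite truncn_ge_nat ?invr_ge0 ?(ltW r0)// invf_ge1.
exists (Num.truncn r^-1).-1.
have lt1 : (Num.truncn r^-1).-1.+2%:R^-1 < r.
  by rewrite invf_plt ?posrE// prednK// truncnS_gt.
have le1 : r <= (Num.truncn r^-1).-1.+1%:R^-1.
  by rewrite invf_pge ?posrE// prednK// truncn_le// invr_ge0 ltW.
split => //; apply: le_trans (_ : 2 * (Num.truncn r^-1).-1.+2%:R^-1 <= _).
  rewrite -[leLHS]mul1r ler_pdivlMr// mulrAC ler_pdivrMr// mul1r.
  by rewrite -natrM ler_nat; lia.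
by rewrite ler_pM2l// ltW.
Qed.

Section line_maximal.
Variables (R : realType) (k : nat) (i : 'I_k).
Local Notation B := (borelRn R k).
Local Notation RR := (measurableTypeR R).
Local Notation lam := (@borel_lebesgue R k).
Local Notation leb := (@lebesgue_measure R).
Local Notation line := (line i).

Lemma ae_line_integrable (g : B -> R) : measurable_fun setT g ->
  (\int[lam]_x `|g x|%R%:E < +oo)%E ->
  {ae lam, forall x, forall m : nat,
    (\int[leb]_(t in `[(- m%:R)%R, m%:R%R]) `|g (line x t)|%R%:E < +oo)%E}.
Proof.
move=> mg gfin; apply/ae_foralln => m.
have mF : measurable_fun setT (fun z : B * RR => `|g (line z.1 z.2)|%R%:E : \bar R).
  apply/measurable_EFinP; apply: measurableT_comp => //.
  exact: (measurableT_comp mg (measurable_line_pair i)).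
have mI := measurable_section_integral (F := fun z => `|g (line z.1 z.2)|%R%:E)
  (measurable_itv `[(- m%:R)%R, m%:R%R]) mF (fun z => normr_ge0 _).
have I0 x : (0 <= \int[leb]_(t in `[(- m%:R)%R, m%:R%R]) `|g (line x t)|%R%:E)%E.
  by apply: integral_ge0 => t _; rewrite lee_fin.
have : lam.-integrable setT
    (fun x => \int[leb]_(t in `[(- m%:R)%R, m%:R%R]) `|g (line x t)|%R%:E)%E.
  apply/integrableP; split => //.
  under eq_integral do rewrite gee0_abs//.
  rewrite (integral_line_fubini i (f := fun x => `|g x|%R%:E))//.
    by apply: lte_mul_pinfty => //; rewrite lebesgue_measure_itv/=; case: ifP => // _; rewrite -EFinD.
  by apply/measurable_EFinP; apply: measurableT_comp.
move/integrable_ae => /(_ measurableT); apply: ae_imply => x /(_ Logic.I).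
by rewrite ge0_fin_numE.
Qed.

(** The one-sided maximal function is finite at Lebesgue points: short averages are close to g x,
    and long ones are controlled by the integral over [-1, 1]. *)
Lemma ae_line_maximal (g : B -> R) : measurable_fun setT g -> (forall x, 0 <= g x) ->
  (\int[lam]_x (g x)%:E < +oo)%E ->
  {ae lam, forall x, exists m : nat, forall s, 0 < s <= 1 ->
    (\int[leb]_(t in `[0%R, s]) (g (line x t))%:E <= (m%:R * s)%:E)%E}.
Proof.
move=> mg g0 gfin.
have gfin' : (\int[lam]_x `|g x|%R%:E < +oo)%E.
  by under eq_integral do rewrite ger0_norm//.
have ae1 := ae_line_integrable mg gfin'.
apply: ae_imply2 ae1 (ae_line_lebesgue_pt mg ae1) => x xfin /(_ 0%N)[L HL].
have mh : measurable_fun setT (fun s : RR => g (line x s)).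
  exact: (measurableT_comp mg (measurable_line_r i x)).
pose I := fine (\int[leb]_(t in `[(- 1%:R)%R, 1%:R%R]) `|g (line x t)|%R%:E)%E.
have IE : (I%:E = \int[leb]_(t in `[(- 1%:R)%R, 1%:R%R]) `|g (line x t)|%R%:E)%E.
  rewrite /I fineK// ge0_fin_numE; first exact: (xfin 1%N).
  by apply: integral_ge0 => t _; rewrite lee_fin.
have I0 : 0 <= I by rewrite -lee_fin IE; apply: integral_ge0 => t _; rewrite lee_fin.
(* The first term serves l >= L, where the average at radius 1 / (l + 1) is at most 1 + g x and the
   radius at most 2 s. The second serves l < L, where s > 1 / (L + 2). *)
pose M := 2 * (1 + g x) + I * L.+2%:R.
exists (Num.truncn M).+1 => s s01; have /andP[s0 s1] := s01.
have M0 : 0 <= 2 * (1 + g x) by rewrite mulr_ge0// addr_ge0.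
suff : (\int[leb]_(t in `[0%R, s]) (g (line x t))%:E <= (M * s)%:E)%E.
  by move/le_trans; apply; rewrite lee_fin ler_wpM2r// ltW// truncnS_gt.
have [l [ls sl sl2]] := invS_bracket s01.
have sub (a b c d : R) : c <= a -> b <= d ->
   (\int[leb]_(t in `[a, b]) (g (line x t))%:E <=
    \int[leb]_(t in `[c, d]) (g (line x t))%:E)%E.
  move=> ca bd; apply: ge0_subset_integral => //.
  - by apply/measurable_EFinP; exact: measurable_funTS.
  - by move=> t _; rewrite lee_fin.
  - by move=> t /=; rewrite !in_itv/= => /andP[? ?]; apply/andP; split; lra.
have [Ll|lL] := leqP L l.
  apply: le_trans (sub _ _ 0 l.+1%:R^-1 (lexx _) sl) _.
  have l0 : (0 : R) <= l.+1%:R^-1 by rewrite invr_ge0.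
  apply: (@le_trans _ _ (\int[leb]_(t in `[0%R, l.+1%:R^-1%R])
    (`|g (line x t) - g x|%R%:E + (g x)%:E))%E).
    apply: ge0_le_integral => //.
    - by move=> t _; rewrite lee_fin.
    - by apply/measurable_EFinP; exact: measurable_funTS.
    - apply/measurable_EFinP; apply: measurable_funTS; apply: measurable_funD => //.
      by apply: measurableT_comp => //; exact: measurable_funB.
    - move=> t _; rewrite -EFinD lee_fin.
      have := ler_norm (g (line x t) - g x); lra.
  rewrite ge0_integralD//; last 2 first.
  - apply/measurable_EFinP; apply: measurable_funTS.
    by apply: measurableT_comp => //; exact: measurable_funB.
  - by move=> t _; rewrite lee_fin.
  rewrite integral_cst//= lebesgue_measure_itv/= lte_fin invr_gt0 ltr0n/= sube0.
  apply: le_trans (leeD (HL _ Ll) (lexx _)) _.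
  rewrite invr1 mul1r -EFinM -EFinD lee_fin /M.
  rewrite -[X in X + _ <= _]mul1r -mulrDl.
  apply: (@le_trans _ _ ((1 + g x) * (2 * s))); first by rewrite ler_wpM2l// addr_ge0.
  by rewrite mulrA [(1 + g x) * 2]mulrC [leRHS]mulrDl lerDl !mulr_ge0// ltW.
have s1' : (- 1%:R : R) <= 0 by rewrite oppr_le0.
apply: le_trans (sub _ _ _ 1%:R s1' s1) _.
have -> : (\int[leb]_(t in `[(- 1%:R)%R, 1%:R%R]) (g (line x t))%:E = I%:E)%E.
  by rewrite IE; apply: eq_integral => t _; rewrite ger0_norm.
rewrite lee_fin /M.
have Ls : 1 <= L.+2%:R * s.
  rewrite -ler_pdivrMl// mulr1; apply/ltW; apply: le_lt_trans ls.
  by rewrite lef_pV2 ?posrE// ler_nat; lia.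
apply: (@le_trans _ _ (I * (L.+2%:R * s))); first by rewrite -[leLHS]mulr1 ler_wpM2l.
by rewrite [leRHS]mulrDl mulrA lerDr mulr_ge0// ltW.
Qed.

(** At a point of A, being a Lebesgue point of the indicator of the complement means that short
    forward segments leave A in small proportion. Asking this for all l >= L gives sets that
    increase with L and exhaust A up to measure 0, so one scale serves the whole of A'. The
    tolerance 1/16 at the radii 1 / (l + 1) doubles to 1/8 at arbitrary ones. *)
Lemma line_density_subset (A : set B) (e : R) : measurable A -> (lam A < +oo)%E ->
  0 < e -> exists A' : set B, [/\ measurable A', A' `<=` A, (lam (A `\` A') < e%:E)%E &
  exists2 r0 : R, 0 < r0 & forall x, A' x -> forall r, 0 < r < r0 ->
    (leb [set t | `[0%R, r]%classic t /\ ~ A (line x t)] <= (r / 8)%:E)%E].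
Proof.
move=> mA Aoo e0.
pose g (x : B) : R := \1_(~` A) x.
have mnA : measurable (~` A) by exact: measurableC.
have mg : measurable_fun setT g by exact: measurable_indic.
have gE x D : A x -> measurable D ->
  (\int[leb]_(t in D) `|g (line x t) - g x|%R%:E =
   leb [set t | D t /\ ~ A (line x t)])%E.
  move=> Ax mD.
  have mS : measurable [set t : RR | ~ A (line x t)].
    by have := measurable_line_r i x measurableT mnA; rewrite setTI.
  rewrite (_ : [set t | _] = [set t | ~ A (line x t)] `&` D); last by rewrite setIC.
  rewrite -integral_indic//; apply: eq_integral => t _.
  rewrite /g [\1__ x]indicE memNset//=.
  by rewrite subr0 ger0_norm.
have gfin : {ae lam, forall x, forall m : nat,
    (\int[leb]_(t in `[(- m%:R)%R, m%:R%R]) `|g (line x t)|%R%:E < +oo)%E}.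
  apply: aeW => x m.
  apply: (@le_lt_trans _ _ (\int[leb]_(t in `[(- m%:R)%R, m%:R%R]) (cst 1%:E t))%E).
    apply: ge0_le_integral => //.
    - apply/measurable_EFinP; apply: measurable_funTS; apply: measurableT_comp => //.
      exact: (measurableT_comp mg (measurable_line_r i x)).
    - by move=> t _; rewrite lee_fin /g indicE; case: (_ \in _); rewrite ?normr1 ?normr0.
  rewrite integral_cst//= mul1e lebesgue_measure_itv/=; case: ifP => // _.
  by rewrite -EFinD ltry.
pose G l : set B := [set x | (leb [set t | `[0%R, l.+1%:R^-1%R]%classic t /\ ~ A (line x t)]
  <= (16%:R^-1 * l.+1%:R^-1)%R%:E)%E].
have mG l : measurable (G l).
  rewrite -[X in measurable X]setTI; apply: emeasurable_fun_le => //.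
  have mF : measurable_fun setT (fun z : B * RR => (g (line z.1 z.2))%:E : \bar R).
    by apply/measurable_EFinP; exact: (measurableT_comp mg (measurable_line_pair i)).
  have F0 z : (0 <= (g (line z.1 z.2))%:E :> \bar R)%E by rewrite lee_fin /g indicE.
  have := measurable_section_integral (measurable_itv `[0%R, l.+1%:R^-1%R]) mF F0.
  apply: eq_measurable_fun => x _.
  have mS : measurable [set t : RR | ~ A (line x t)].
    by have := measurable_line_r i x measurableT mnA; rewrite setTI.
  rewrite (_ : [set t | _ /\ _] = [set t | ~ A (line x t)] `&` `[0%R, l.+1%:R^-1%R]).
    by rewrite -integral_indic.
  by rewrite setIC.
pose F L := A `&` \bigcap_(l in [set l | (L <= l)%N]) G l.
have mF L : measurable (F L).
  by apply: measurableI => //; apply: bigcap_measurable => //; exists L => /=.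
have [L HL] : exists L, (lam (A `\` F L) < e%:E)%E.
  apply: nondecreasing_measure_approx => //.
    by move=> m n mn x [Ax H]; split => // l /= nl; apply: H => /=; exact: leq_trans nl.
  have [N [mN N0 NP]] := ae_line_lebesgue_pt mg gfin.
  apply: (subset_measure0 _ _ _ N0) => //.
    by apply: measurableD => //; exact: bigcupT_measurable.
  move=> x [Ax nF]; apply: NP => /= /(_ 15%N)[L HL]; apply: nF; exists L => //.
  by split => // l /= Ll; have := HL _ Ll; rewrite gE.
exists (F L); split => //; first exact: subIsetl.
exists L.+1%:R^-1 => [|x [Ax HG] r /andP[r0 rL]]; first by rewrite invr_gt0.
have r01 : 0 < r <= 1.
  by rewrite r0/= (le_trans (ltW rL))// invf_le1 ?ler1n.
have [l [lr rl rl2]] := invS_bracket r01.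
have Ll : (L <= l)%N.
  have := lt_trans lr rL; rewrite ltf_pV2 ?posrE// ltr_nat; lia.
apply: (@le_trans _ _ (leb [set t | `[0%R, l.+1%:R^-1%R]%classic t /\ ~ A (line x t)])).
  have mS a : measurable [set t | `[0%R, a]%classic t /\ ~ A (line x t)].
    apply: measurableI => //.
    by have := measurable_line_r i x measurableT mnA; rewrite setTI.
  apply: le_measure; rewrite ?inE//; first exact: mS.
    exact: mS.
  move=> t /= [+ nA]; rewrite !in_itv/= => /andP[t0 tr]; split => //; rewrite t0/=.
  exact: le_trans rl.
apply: le_trans (HG _ Ll) _; rewrite lee_fin.
by rewrite (_ : r / 8 = 16%:R^-1 * (2 * r)); [rewrite ler_wpM2l|field].
Qed.

End line_maximal.

(** * Test functions *)

Section smooth_functions_of_one_variable.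
Variable R : realType.
Implicit Types (f g : R -> R) (P : {poly R}).

(* [f] belongs to a class of functions that is closed under differentiation. *)
Definition smooth1 f := exists2 S : set (R -> R), S f &
  forall g, S g -> exists2 g', S g' & forall x : R, is_derive x (1 : R) g (g' x).

Lemma smooth1_derive f : smooth1 f -> smooth1 (derive1 f) /\
  forall x : R, is_derive x (1 : R) f (derive1 f x).
Proof.
move=> [S Sf SD]; have [g Sg fg] := SD f Sf.
have -> : derive1 f = g by apply/funext => x; rewrite derive1E; exact: derive_val.
by split => //; exists S.
Qed.

Lemma smooth1_continuous f : smooth1 f -> continuous f.
Proof.
move=> /smooth1_derive[_ fd] x.
by apply/differentiable_continuous/derivable1_diffP; have [] := fd x.
Qed.

(** Products of members of the two classes are not closed under differentiation, but by the Leibniz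
    rule their finite sums are; [gen] is this additive closure, and its derivatives are found by
    induction on generation. *)
Lemma smooth1M f g : smooth1 f -> smooth1 g -> smooth1 (fun x => f x * g x).
Proof.
move=> [S Sf SD] [T Tg TD].
pose gen : set (R -> R) := smallest (fun Q : set (R -> R) =>
  forall a b, Q a -> Q b -> Q (fun x => a x + b x))
  [set a | exists s t, [/\ S s, T t & a = fun x => s x * t x]].
have genP s t : S s -> T t -> gen (fun x => s x * t x).
  by move=> Ss Tt Q [_]; apply; exists s, t.
have genD a b : gen a -> gen b -> gen (fun x => a x + b x).
  by move=> ga gb Q QP; apply: QP.1; [exact: (ga _ QP)|exact: (gb _ QP)].
exists gen; first exact: genP.
move=> h /(_ [set h | gen h /\ exists2 h', gen h' & forall x : R, is_derive x (1 : R) h (h' x)]).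
move=> /(_ _)[]//; split.
- move=> a b [ga [a' ga' aa']] [gb [b' gb' bb']]; split; first exact: genD.
  exists (fun x => a' x + b' x); first exact: genD.
  by move=> x; have := aa' x; have := bb' x => ? ?; exact: is_deriveD.
- move=> _ [s [t [Ss Tt ->]]]; split; first exact: genP.
  have [s' Ss' ss'] := SD _ Ss; have [t' Tt' tt'] := TD _ Tt.
  exists (fun x => s x * t' x + s' x * t x); first by apply: genD; exact: genP.
  move=> x; have := ss' x; have := tt' x => ? ?.
  by apply: is_derive_eq; rewrite /GRing.scale/=; ring.
Qed.

Lemma smooth1B f g : smooth1 f -> smooth1 g -> smooth1 (fun x => f x - g x).
Proof.
move=> [S Sf SD] [T Tg TD].
exists [set a | exists s t, [/\ S s, T t & a = fun x => s x - t x]].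
  by exists f, g.
move=> _ [s [t [Ss Tt ->]]].
have [s' Ss' ss'] := SD _ Ss; have [t' Tt' tt'] := TD _ Tt.
exists (fun x => s' x - t' x); first by exists s', t'.
by move=> x; have := ss' x; have := tt' x => ? ?; exact: is_deriveB.
Qed.

Lemma smooth1_affine f (c d : R) : smooth1 f -> smooth1 (fun x => f (c * x + d)).
Proof.
move=> [S Sf SD].
(* The factor r collects the powers of c that the chain rule produces. *)
exists [set a | exists s r, S s /\ a = fun x => r * s (c * x + d)].
  by exists f, 1; split => //; apply/funext => x; rewrite mul1r.
move=> _ [s [r [Ss ->]]]; have [s' Ss' ss'] := SD _ Ss.
exists (fun x => (r * c) * s' (c * x + d)); first by exists s', (r * c).
move=> x.
have dl : is_derive x (1 : R) (fun y : R => c * y + d) c.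
  by apply: is_derive_eq; rewrite /GRing.scale/= ; ring.
have := ss' (c * x + d) => sd.
have dc : is_derive x (1 : R) (s \o (fun y : R => c * y + d)) (s' (c * x + d) * c).
  split; first by apply: ex_derive.
  rewrite -derive1E derive1_comp; last 2 first.
  - exact: ex_derive.
  - exact: ex_derive.
  by rewrite !derive1E !derive_val.
rewrite (_ : (fun y => r * s (c * y + d)) = (fun y => r * (s \o (fun y : R => c * y + d)) y))//.
by apply: is_derive_eq; rewrite /GRing.scale/=; ring.
Qed.

Lemma smooth1_primitive f g : smooth1 f -> (forall x : R, is_derive x (1 : R) g (f x)) -> smooth1 g.
Proof.
move=> [S Sf SD] gf; exists (S `|` [set g]); first by right.
move=> h [/SD[h' Sh' hh']|->]; first by exists h' => //; left.
by exists f => //; left.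
Qed.

(** With y = 1 / x this makes P(1 / x) exp(- 1 / x) bounded near 0 for every P. *)
Lemma horner_le_expR P : exists2 C : R, 0 <= C & forall y, 0 <= y -> `|P.[y]| <= C * expR y.
Proof.
have [C [N [C0 PC]]] : exists C N, 0 <= C /\ forall y, 0 <= y -> `|P.[y]| <= C * (1 + y) ^+ N.
  elim/poly_ind: P => [|P c [C [N [C0 PC]]]].
    by exists 0, 0%N; split => // y y0; rewrite horner0 normr0 mul0r.
  exists (C + `|c|), N.+1; split => [|y y0]; first by rewrite addr_ge0.
  rewrite hornerMXaddC (le_trans (ler_normD _ _))// mulrDl lerD//.
    rewrite normrM (ger0_norm y0) exprSr mulrA ler_pM//; first exact: PC.
    by rewrite lerDr.
  by rewrite ler_peMr// exprn_ege1// lerDl.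
exists (C * (expR 1 * N.+1`!%:R)) => [|y y0].
  by rewrite !mulr_ge0// expR_ge0.
apply: le_trans (PC _ y0) _; rewrite -mulrA ler_wpM2l//.
have y10 : 0 <= 1 + y by rewrite addr_ge0.
apply: (@le_trans _ _ ((1 + y) ^+ N.+1)).
  by rewrite exprSr ler_peMr ?exprn_ge0// lerDl.
have := expR_ge1Dxn N y10; rewrite expRD => H.
have f0 : 0 < N.+1`!%:R :> R by rewrite ltr0n fact_gt0.
have : (1 + y) ^+ N.+1 / N.+1`!%:R <= expR 1 * expR y.
  by apply: le_trans H; rewrite lerDr.
by rewrite ler_pdivrMr// mulrAC.
Qed.

(** Letting P vary makes the family closed under differentiation, with P replaced by X^2 (P - P');
    smoothness of exp(- 1 / x) extended by 0 is then immediate. *)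
Definition flat P (x : R) : R := if 0 < x then P.[x^-1] * expR (- x^-1) else 0.

Lemma is_derive_flat P (x : R) : is_derive x (1 : R) (flat P) (flat ('X^2 * (P - P^`())) x).
Proof.
have [x0|x0|->] := ltgtP x 0.
- rewrite /flat ltNge (ltW x0)/=.
  apply: (near_eq_is_derive (f := cst 0)); rewrite ?oner_neq0//.
  by near=> y; rewrite ltNge ltW//=; near: y; exact: lt_nbhsl.
- have -> : flat ('X^2 * (P - P^`())) x =
      (P^`().[x^-1] * (- x ^- 2)) * expR (- x^-1) +
      P.[x^-1] * (expR (- x^-1) * (x ^- 2)).
    rewrite /flat x0 hornerM hornerXn hornerD hornerN exprVn; ring.
  have xn0 : x != 0 by rewrite gt_eqF.
  have dV : is_derive x (1 : R) (fun y : R => y^-1) (- x ^- 2).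
    split; first by apply: derivableV => //; exact: derivable_id.
    by rewrite deriveV// derive_id /GRing.scale/= mulr1.
  have dP : is_derive x (1 : R) (horner P \o (fun y : R => y^-1)) (P^`().[x^-1] * (- x ^- 2)).
    split; first by apply: ex_derive.
    rewrite -derive1E derive1_comp ?derive1E; [|exact: ex_derive..].
    by rewrite !derive_val.
  have dE : is_derive x (1 : R) (expR \o (fun y : R => - y^-1)) (expR (- x^-1) * (x ^- 2)).
    have dN : is_derive x (1 : R) (fun y : R => - y^-1) (x ^- 2).
      by apply: is_derive_eq; rewrite opprK.
    split; first by apply: ex_derive.
    rewrite -derive1E derive1_comp ?derive1E; [|exact: ex_derive..].
    by rewrite !derive_val.
  apply: (near_eq_is_derive (f := (horner P \o (fun y : R => y^-1)) * (expR \o (fun y : R => - y^-1)))).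
  + near=> y; rewrite /flat ifT//; near: y; exact: lt_nbhsr.
  + by apply: is_derive_eq; rewrite /GRing.scale/=; ring.
- rewrite {2}/flat ltxx.
  (* The extra factor X^2 gives |flat P y| <= C y^2, hence the derivative 0 at the origin. *)
  have [C C0 PC] := horner_le_expR (P * 'X^2).
  have bnd y : `|flat P y| <= C * y ^+ 2.
    rewrite /flat; case: ifPn => y0; last by rewrite normr0 mulr_ge0// sqr_ge0.
    have := PC y^-1; rewrite invr_ge0 (ltW y0) => /(_ isT).
    rewrite hornerM hornerXn !normrM (ger0_norm (expR_ge0 _)) => H.
    rewrite expRN ler_pdivrMr ?expR_gt0//.
    have y2 : 0 < y ^+ 2 by rewrite exprn_gt0.
    rewrite mulrAC -ler_pdivrMr//.
    have yi0 : 0 < y^-1 by rewrite invr_gt0.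
    by rewrite expr2 invfM; rewrite (gtr0_norm yi0) in H.
  have f0 : flat P 0 = 0 by rewrite /flat ltxx.
  have cv : h^-1 *: ((flat P \o shift 0) (h *: 1) - flat P 0) @[h --> 0^'] --> (0 : R).
    apply/cvgr0Pnorm_le => e e0.
    near=> h; rewrite f0 subr0 /= addr0 [_ *: 1]mulr1 normrZ normfV.
    have h0 : 0 < `|h| by rewrite normr_gt0; near: h; exact: nbhs_dnbhs_neq.
    rewrite ler_pdivrMl// (le_trans (bnd _))// -real_normK ?num_real// expr2 mulrA.
    rewrite mulrC ler_wpM2l//.
    apply: (@le_trans _ _ ((C + 1) * `|h|)); first by rewrite ler_wpM2r// lerDl.
    rewrite -ler_pdivlMl ?ltr_wpDl// mulrC; near: h; apply: dnbhs0_le.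
    by rewrite divr_gt0// ltr_wpDl.
  by split; [apply/cvg_ex; exists 0|apply/cvg_lim].
Unshelve. all: by end_near. Qed.

Lemma smooth1_flat P : smooth1 (flat P).
Proof.
exists [set f | exists Q, f = flat Q]; first by exists P.
move=> _ [Q ->]; exists (flat ('X^2 * (Q - Q^`()))); first by eexists.
exact: is_derive_flat.
Qed.

(* Smooth, supported in [[a, b]], and increasing to the indicator of [`]a, b[]
   as [m] tends to infinity. *)
Definition bump (a b : R) (m : nat) (u : R) : R :=
  flat 1 (m.+1%:R * u + - (m.+1%:R * a)) * flat 1 (- m.+1%:R * u + m.+1%:R * b).

Lemma smooth1_bump a b m : smooth1 (bump a b m).
Proof. by apply: smooth1M; apply: smooth1_affine; exact: smooth1_flat. Qed.

Lemma flat1_ge0 x : 0 <= flat 1 x.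
Proof. by rewrite /flat; case: ifP => // _; rewrite hornerC mul1r expR_ge0. Qed.

Lemma flat1_le1 x : flat 1 x <= 1.
Proof.
rewrite /flat; case: ifPn => // x0.
by rewrite hornerC mul1r -expR0 ler_expR oppr_le0 invr_ge0 ltW.
Qed.

Lemma bump_ge0 a b m u : 0 <= bump a b m u.
Proof. by rewrite mulr_ge0// flat1_ge0. Qed.

Lemma bump_le1 a b m u : bump a b m u <= 1.
Proof. by rewrite mulr_ile1// ?flat1_ge0// flat1_le1. Qed.

Lemma bumpE a b m u :
  bump a b m u = flat 1 (m.+1%:R * (u - a)) * flat 1 (m.+1%:R * (b - u)).
Proof. by rewrite /bump; congr (flat _ _ * flat _ _); ring. Qed.

Lemma bump_out a b m u : ~~ (a < u < b) -> bump a b m u = 0.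
Proof.
have m0 : 0 < m.+1%:R :> R by rewrite ltr0n.
rewrite negb_and -!leNgt bumpE /flat => /orP[ua|bu].
  by rewrite pmulr_rgt0// subr_gt0 ltNge ua mul0r.
by rewrite [X in _ * X]ifF ?mulr0// pmulr_rgt0// subr_gt0 ltNge bu.
Qed.

Lemma bump_cvg a b u : bump a b m u @[m --> \oo] --> (\1_(`]a, b[%classic) u : R).
Proof.
rewrite indicE; have [uab|nuab] := boolP (u \in `]a, b[%classic); last first.
  rewrite (_ : (fun m => _) = cst 0); first exact: cvg_cst.
  apply/funext => m; apply: bump_out; apply: contra nuab => uab.
  by rewrite inE/= in_itv.
move: uab; rewrite inE/= in_itv/= => /andP[au ub].
have flat_cvg (c : R) : 0 < c -> flat 1 (m.+1%:R * c) @[m --> \oo] --> (1 : R).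
  move=> c0; rewrite (_ : (fun m => _) = (fun m => expR (- (c^-1 * m.+1%:R^-1)))); last first.
    apply/funext => m; rewrite /flat mulr_gt0 ?ltr0n// hornerC mul1r.
    by rewrite invfM mulrC.
  have hc : - (c^-1 * m.+1%:R^-1) @[m --> \oo] --> (0 : R).
    rewrite -[X in _ --> X]oppr0; apply: cvgN; rewrite -[X in _ --> X](mulr0 c^-1).
    by apply: cvgM; [exact: cvg_cst|exact: cvg_harmonic].
  by rewrite -[X in _ --> X]expR0; apply: continuous_cvg; [exact: continuous_expR|exact: hc].
under eq_fun do rewrite bumpE.
by rewrite -[1%:R](mulr1 1); apply: cvgM; apply: flat_cvg; rewrite subr_gt0.
Qed.

Definition bump_primitive (a b : R) (m : nat) (u : R) : R :=
  \int[lebesgue_measure]_(t in `]-oo, u]) bump a b m t.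

Lemma integrable_bump a b m (D : set (measurableTypeR R)) : measurable D ->
  lebesgue_measure.-integrable D (EFin \o bump a b m).
Proof.
move=> mD; apply: (@integrableS _ _ _ _ setT) => //.
have -> : EFin \o bump a b m = (EFin \o bump a b m) \_ `[a, b].
  apply/funext => u; rewrite patchE; case: ifPn => // ub /=.
  rewrite bump_out//; apply: contra ub => /andP[au ub].
  by rewrite inE/= in_itv/= !ltW.
apply/(integrable_mkcond _ _).1 => //.
apply: continuous_compact_integrable; first exact: segment_compact.
by apply: continuous_subspaceT; exact/smooth1_continuous/smooth1_bump.
Qed.

Lemma is_derive_bump_primitive a b m u :
  is_derive u (1 : R) (bump_primitive a b m) (bump a b m u).
Proof.
have u1 : u < u + 1 by rewrite ltrDl.
have iu := integrable_bump a b m (measurable_itv `]-oo, u + 1]).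
have [d dE] := continuous_FTC1 u1 iu (ltNyr _) (smooth1_continuous (smooth1_bump a b m) (x := u)).
apply: DeriveDef; first exact: d.
by rewrite -derive1E; exact: dE.
Qed.

End smooth_functions_of_one_variable.

Section product_test_functions.
Variables (R : realType) (k : nat).
Implicit Types (F : 'I_k -> R -> R) (i : 'I_k).

Definition prod_fun F (x : 'rV[R]_k) : R := \prod_(j < k) F j (x 0 j).

Lemma differentiable_prod_fun F x : (forall j (y : R), derivable (F j) y 1) ->
  differentiable (prod_fun F) x.
Proof.
move=> dF; rewrite /prod_fun; elim: (index_enum _) => [|j r ih].
  under eq_fun do rewrite big_nil; exact: differentiable_cst.
under eq_fun do rewrite big_cons; apply: differentiableM => //.
apply: (@differentiable_comp _ _ _ _ (fun x : 'rV[R]_k => x 0 j) (F j)).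
  exact: differentiable_coord.
exact/derivable1_diffP.
Qed.

Definition deriv_at i F : 'I_k -> R -> R := fun j => if j == i then derive1 (F j) else F j.

Lemma partial_prod_fun i F : (forall y : R, derivable (F i) y 1) ->
  partial i (prod_fun F) = prod_fun (deriv_at i F).
Proof.
move=> dF; apply/funext => x; rewrite /partial /derive.
pose c := \prod_(j < k | j != i) F j (x 0 j).
apply/cvg_lim => //.
have -> : prod_fun (deriv_at i F) x = c * derive1 (F i) (x 0 i).
  rewrite /prod_fun (bigD1 i)//= mulrC /deriv_at eqxx; congr (_ * _).
  by apply: eq_bigr => j /negPf ->.
have := dF (x 0 i); rewrite derive1E => dFi.
have cF : h^-1 *: ((F i \o shift (x 0 i)) (h *: 1) - F i (x 0 i)) @[h --> 0^'] -->
  'D_1 (F i) (x 0 i) by exact: dFi.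
have E h : prod_fun F (h *: delta_mx 0 i + x) = F i (h + x 0 i) * c.
  rewrite /prod_fun (bigD1 i)//= !mxE !eqxx mulr1; congr (_ * _).
  by apply: eq_bigr => j /negPf ji; rewrite !mxE ji andbF mulr0 add0r.
have E0 : prod_fun F x = F i (x 0 i) * c by rewrite /prod_fun (bigD1 i).
apply: cvg_trans (cvgM (cvg_cst c) cF); apply: near_eq_cvg; near=> h.
by rewrite /= E E0 /GRing.scale/= mulr1; ring.
Unshelve. all: by end_near. Qed.

(** A partial derivative of a product of one-variable functions is again such a product, with one
    factor differentiated, so all iterated partials stay in one family of differentiable
    functions. *)
Lemma smooth_prod_fun F : (forall j, smooth1 (F j)) -> smooth (prod_fun F).
Proof.
have der1 G : (forall j, smooth1 (G j)) -> forall j (y : R), derivable (G j) y 1.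
  by move=> sG j y; have [_ /(_ y)[]] := smooth1_derive (sG j).
move=> sF s x.
have [G sG ->] : exists2 G, (forall j, smooth1 (G j)) &
    foldr (@partial R k) (prod_fun F) s = prod_fun G.
  elim: s => [|i s [G sG ih]]; first by exists F.
  exists (deriv_at i G); last by rewrite /= ih partial_prod_fun//; exact: der1.
  move=> j; rewrite /deriv_at; case: eqP => // _.
  by have [] := smooth1_derive (sG j).
by apply: differentiable_prod_fun; exact: der1.
Qed.

Lemma compact_box (c : 'rV[R]_k * 'rV[R]_k) : compact (box c).
Proof.
rewrite (_ : box c = [set x : 'rV[R]_k | forall i, `[c.1 0 i, c.2 0 i]%classic (x 0 i)]).
  have H := @rV_compact R k (fun i => `[c.1 0 i, c.2 0 i]%classic).
  by refine (H _) => i; exact: segment_compact.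
by apply/seteqP; split => x cx i; have := cx i; rewrite /= in_itv.
Qed.

Lemma test_function_prod_fun F (c : 'rV[R]_k * 'rV[R]_k) (Omega : set 'rV[R]_k) :
  (forall j, smooth1 (F j)) ->
  (forall j u, ~~ (c.1 0 j <= u <= c.2 0 j) -> F j u = 0) ->
  box c `<=` Omega -> test_function Omega (prod_fun F).
Proof.
move=> sF F0 cO.
have cb : closed (box c) by apply: compact_closed; [exact: norm_hausdorff|exact: compact_box].
have supp : closure [set x | prod_fun F x != 0] `<=` box c.
  rewrite (closure_id (box c)).1//; apply: closure_subset => x /= Fx i.
  apply: contraNT Fx => nx; rewrite /prod_fun (bigD1 i)//= F0 ?mul0r//.
split; first exact: smooth_prod_fun.
- by apply: subclosed_compact supp; [exact: closed_closure|exact: compact_box].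
- exact: subset_trans cO.
Qed.

End product_test_functions.

Lemma integral_bump_primitive (R : realType) (a b : R) (m : nat) (u s : R) : 0 < s ->
  (\int[lebesgue_measure]_(t in `[0%R, s]) (bump a b m (u - t)%R)%:E =
   (bump_primitive a b m u - bump_primitive a b m (u - s))%:E)%E.
Proof.
move=> s0.
have aff (t : R) : is_derive t (1 : R) (fun t : R => u - t) (-1).
  by apply: is_derive_eq; rewrite add0r mul1r.
have dG (t : R) : is_derive t (1 : R) (fun t => - bump_primitive a b m (u - t)) (bump a b m (u - t)).
  have := is_derive_bump_primitive a b m (u - t) => dP.
  have dc : is_derive t (1 : R) (bump_primitive a b m \o (fun t : R => u - t)) (bump a b m (u - t) * -1).
    split; first by apply: ex_derive.
    rewrite -derive1E derive1_comp ?derive1E; [|exact: ex_derive..].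
    by rewrite !derive_val.
  have := is_deriveN dc; rewrite mulrN1 opprK; exact.
have cG : continuous (fun t : R => - bump_primitive a b m (u - t)).
  by move=> t; apply/differentiable_continuous/derivable1_diffP; have [] := dG t.
have ct : continuous (fun t : R => bump a b m (u - t)).
  move=> t; apply: (@continuous_comp _ _ _ (fun t : R => u - t) (bump a b m)).
    by apply: continuousB; [exact: cst_continuous|exact: cvg_id].
  exact/smooth1_continuous/smooth1_bump.
rewrite (@continuous_FTC2 _ _ (fun t => - bump_primitive a b m (u - t)))//.
- by rewrite subr0 -EFinB; congr (_%:E); ring.
- exact: continuous_subspaceT.
- split.
  + by move=> t _; have [] := dG t.
  + exact: (cvg_at_right_filter (cG 0)).
  + exact: (cvg_at_left_filter (cG s)).
- by move=> t _; rewrite derive1E; have [_ ->] := dG t.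
Qed.

(** * Integration tools and the vanishing of functions with zero integral over boxes *)

Section integral_tools.
Context d (T : measurableType d) (R : realType) (mu : {measure set T -> \bar R}).

Lemma integrable_mul_bounded (f g : T -> R) :
  measurable_fun setT g -> (forall x, `|g x| <= 1) ->
  mu.-integrable setT (EFin \o f) -> mu.-integrable setT (EFin \o (fun x => f x * g x)).
Proof.
move=> mg g1 intf; have /integrableP[mf _] := intf.
apply: (le_integrable measurableT _ _ intf).
  by apply/measurable_EFinP; apply: measurable_funM => //; exact/measurable_EFinP.
move=> x _; rewrite /= lee_fin normrM -[leRHS]mulr1.
by apply: ler_pM.
Qed.

Lemma integrable_le1 (D : set T) (f : T -> R) : measurable D -> (mu D < +oo)%E ->
  measurable_fun D f -> (forall x, `|f x| <= 1) -> mu.-integrable D (EFin \o f).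
Proof.
move=> mD Doo mf f1; apply/integrableP; split; first exact/measurable_EFinP.
apply: (@le_lt_trans _ _ (\int[mu]_(x in D) (cst 1 x))%E).
  apply: ge0_le_integral => //.
  - by apply/measurable_EFinP; exact: measurableT_comp.
  - by move=> x _; rewrite lee_fin.
by rewrite integral_cst// mul1e.
Qed.

Lemma integrable_of_lty (f : T -> R) : measurable_fun setT f ->
  (\int[mu]_x `|f x|%R%:E < +oo)%E -> mu.-integrable setT (EFin \o f).
Proof. by move=> mf foo; apply/integrableP; split => //; exact/measurable_EFinP. Qed.

Lemma integrable_norm_lty (f : T -> R) : mu.-integrable setT (EFin \o f) ->
  (\int[mu]_x `|f x|%R%:E < +oo)%E.
Proof. by move=> /integrableP[]. Qed.

Lemma le_Rintegral_norm (D : set T) (f : T -> R) : measurable D -> measurable_fun D f ->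
  (`|\int[mu]_(x in D) f x|%R%:E <= \int[mu]_(x in D) `|f x|%R%:E)%E.
Proof.
move=> mD mf.
have mf' : measurable_fun D (EFin \o f) by exact/measurable_EFinP.
have H := le_abse_integral mu mD mf'.
apply: le_trans _ H; rewrite /Rintegral /comp.
case: (\int[mu]_(x in D) (f x)%:E)%E => [r||] /=; last 2 first.
- exact: leey.
- exact: leey.
exact: lexx.
Qed.

Variables (f : T -> \bar R) (mf : measurable_fun setT f) (f0 : forall x, (0 <= f x)%E).

(** The proofs are arguments so that the term itself carries the data from which its measure
    structure is inferred. *)
Definition weighted_measure (mf : measurable_fun setT f) (f0 : forall x, (0 <= f x)%E)
  (A : set T) : \bar R := (\int[mu]_(x in A) f x)%E.

Let wm0 : weighted_measure mf f0 set0 = 0%E.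
Proof. exact: integral_set0. Qed.

Let wm_ge0 A : (0 <= weighted_measure mf f0 A)%E.
Proof. by apply: integral_ge0 => x _. Qed.

Let wm_sigma : semi_sigma_additive (weighted_measure mf f0).
Proof. exact: semi_sigma_additive_nng_induced. Qed.

HB.instance Definition _ :=
  isMeasure.Build _ _ _ (weighted_measure mf f0) wm0 wm_ge0 wm_sigma.

End integral_tools.

Section open_boxes.
Variables (R : realType) (k : nat).
Local Notation B := (borelRn R k).
Local Notation lam := (@borel_lebesgue R k).
Implicit Types a b c d : 'rV[R]_k.

Definition obox a b : set 'rV[R]_k := [set x | forall j, a 0 j < x 0 j < b 0 j].

Lemma measurable_obox a b : measurable (obox a b : set B).
Proof.
rewrite (_ : obox a b = \bigcap_(j in [set: 'I_k])
    ((fun x : B => (x : 'rV[R]_k) 0 j) @^-1` `]a 0 j, b 0 j[)).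
  apply: fin_bigcap_measurable; first exact: finite_finset.
  move=> j _; rewrite -[X in measurable X]setTI.
  by apply: measurable_coord => //; exact: measurable_itv.
apply/seteqP; split => x /=; first by move=> cx j _ /=; rewrite in_itv; exact: cx.
by move=> cx j; have := cx j Logic.I; rewrite /= in_itv.
Qed.

Lemma oboxI a b c d : obox a b `&` obox c d =
  obox (\row_j Num.max (a 0 j) (c 0 j)) (\row_j Num.min (b 0 j) (d 0 j)).
Proof.
apply/seteqP; split => x.
  move=> [xab xcd] j; have /andP[? ?] := xab j; have /andP[? ?] := xcd j.
  by rewrite !mxE gt_max lt_min; apply/and3P; split => //; apply/andP.
by move=> H; split => j; have := H j; rewrite !mxE gt_max lt_min => /and3P[/andP[? ?] ? ?];
  apply/andP.
Qed.

(** Unlike half-spaces, open boxes are stable under intersection, as the uniqueness theorem for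
    measures requires of a generating class. *)
Lemma borel_generated_obox :
  @measurable _ B = <<s [set A | exists a b, A = obox a b] >>.
Proof.
rewrite eqEsubset; split => A.
  move: A; apply: smallest_sub; first exact: smallest_sigma_algebra.
  move=> _ [i [a ->]].
  rewrite (_ : [set x | _] = \bigcup_m obox (const_mx (- m%:R))
      (\row_j if j == i then a else m%:R)).
    apply: sigma_algebra_bigcup => m; apply: sub_sigma_algebra.
    by eexists; eexists.
  apply/seteqP; split => x /=.
    move=> xa; have : [set: 'rV[R]_k] x by [].
    rewrite -bigcup_cube => -[m _ /cubeP xm]; exists m.+1 => // j.
    have := xm j; rewrite !mxE ler_norml => /andP[? ?].
    rewrite -!natr1; apply/andP; split; first lra.
    by case: eqP => [->//|_]; lra.
  by move=> [m _ xm]; have := xm i; rewrite !mxE eqxx => /andP[].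
move: A; apply: smallest_sub; first exact: sigma_algebra_measurable.
by move=> _ [a [b ->]]; exact: measurable_obox.
Qed.

(* du Bois-Reymond lemma *)
Lemma integral_obox_eq0 (w : B -> R) c d : measurable_fun setT w ->
  lam.-integrable setT (EFin \o w) ->
  (forall a b, (forall j, c 0 j <= a 0 j) -> (forall j, b 0 j <= d 0 j) ->
    (\int[lam]_(x in obox a b) (w x)%:E = 0)%E) ->
  {ae lam, forall x, obox c d x -> w x = 0}.
Proof.
move=> mw iw w0.
have mQ := measurable_obox c d.
(* After cutting off, the integral over every box vanishes, since its intersection with [obox c d]
   is a box covered by [w0]. *)
pose wQ : B -> \bar R := (EFin \o w) \_ (obox c d).
have iwQ : lam.-integrable setT wQ.
  by apply/(integrable_mkcond _ _).1 => //; exact: integrableS iw.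
have mwQ : measurable_fun setT wQ by have /integrableP[] := iwQ.
have mp : measurable_fun setT wQ^\+%E by exact: measurable_funepos.
have mn : measurable_fun setT wQ^\-%E by exact: measurable_funeneg.
have wQ0 a b : (\int[lam]_(x in obox a b) wQ x = 0)%E.
  by rewrite -integral_mkcondr oboxI w0// => j; rewrite mxE ?le_max ?ge_min lexx orbT.
have fin_p A : measurable A -> (\int[lam]_(x in A) wQ^\+ x \is a fin_num)%E.
  by move=> mA; apply: integrable_pos_fin_num => //; exact: integrableS iwQ.
have fin_n A : measurable A -> (\int[lam]_(x in A) wQ^\- x \is a fin_num)%E.
  by move=> mA; apply: integrable_neg_fin_num => //; exact: integrableS iwQ.
have eq_pn A : measurable A -> (\int[lam]_(x in A) wQ^\+ x = \int[lam]_(x in A) wQ^\- x)%E.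
  have p0 x : (0 <= wQ^\+ x)%E by exact: funepos_ge0.
  have n0 x : (0 <= wQ^\- x)%E by exact: funeneg_ge0.
  move=> mA.
  (* The positive and negative parts are densities of two measures that agree on open boxes, hence
     on all Borel sets. *)
  change (weighted_measure lam mp p0 A = weighted_measure lam mn n0 A).
  have U := @measure_unique _ R B [set A | exists a b, A = obox a b]
    (fun m => obox (const_mx (- m%:R)) (const_mx m%:R)) borel_generated_obox _ _ _
    (weighted_measure lam mp p0) (weighted_measure lam mn n0).
  apply: U => //.
  - by move=> _ _ [a [b ->]] [a' [b' ->]]; rewrite oboxI; eexists; eexists.
  - by move=> m; eexists; eexists.
  - apply/seteqP; split => // x _; have : [set: 'rV[R]_k] x by [].
    rewrite -bigcup_cube => -[m _ /cubeP xm]; exists m.+1 => // j.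
    by have := xm j; rewrite !mxE ler_norml -!natr1 => /andP[? ?]; apply/andP; split; lra.
  - move=> _ [a [b ->]]; rewrite /weighted_measure.
    have mab := measurable_obox a b.
    have := wQ0 a b; rewrite integralE -(fineK (fin_p _ mab)) -(fineK (fin_n _ mab)).
    rewrite -EFinB => -[] /eqP; rewrite subr_eq0 => /eqP H.
    have : (\int[lam]_(x in obox a b) wQ^\+ x = \int[lam]_(x in obox a b) wQ^\- x)%E.
      by rewrite -(fineK (fin_p _ mab)) -(fineK (fin_n _ mab)) H.
    exact.
  - by move=> m; rewrite ltey_eq fin_p//; exact: measurable_obox.
have ae0 : ae_eq lam setT wQ (cst 0%E).
  apply: integral_ae_eq => // E _ mE.
  by rewrite integral0 integralE eq_pn// subee// fin_n.
apply: ae_imply ae0 => x /(_ Logic.I) + Qx.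
by rewrite /wQ patchE mem_set//= => -[].
Qed.

End open_boxes.

(** * Weak derivatives along coordinate lines *)

Section weak_derivative_on_lines.
Variables (R : realType) (k : nat) (i : 'I_k).
Local Notation B := (borelRn R k).
Local Notation RR := (measurableTypeR R).
Local Notation lam := (@borel_lebesgue R k).
Local Notation leb := (@lebesgue_measure R).
Local Notation line := (line i).

Lemma integral_line s (f : B -> \bar R) : measurable_fun setT f ->
  (\int[lam]_x f (line x s) = \int[lam]_x f x)%E.
Proof.
move=> mf; rewrite integralE [RHS]integralE.
have mp := measurable_funepos mf; have mn := measurable_funeneg mf.
congr (_ - _)%E.
  rewrite -(ge0_integral_line i s mp (fun x => funepos_ge0 f x)).
  by apply: eq_integral => x _; rewrite !funeposE.
rewrite -(ge0_integral_line i s mn (fun x => funeneg_ge0 f x)).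
by apply: eq_integral => x _; rewrite !funenegE.
Qed.

Lemma fubini_lines (D : set RR) (F : B * RR -> R) : measurable D ->
  measurable_fun setT F ->
  (\int[lam]_x \int[leb]_(t in D) `|F (x, t)|%R%:E < +oo)%E ->
  (\int[lam]_x \int[leb]_(t in D) (F (x, t))%:E =
   \int[leb]_(t in D) \int[lam]_x (F (x, t))%:E)%E.
Proof.
move=> mD mF Foo.
pose G (z : B * RR) : \bar R := ((EFin \o F) \_ (setT `*` D)) z.
have mG : measurable_fun setT G.
  apply/(measurable_restrictT _ _).1; first exact: measurableX.
  by apply: measurable_funTS; exact/measurable_EFinP.
have GE x t : G (x, t) = ((fun t => (F (x, t))%:E) \_ D) t.
  by rewrite /G !patchE in_setX in_setT.
have G1 x : (\int[leb]_(t in D) (F (x, t))%:E = \int[leb]_t G (x, t))%E.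
  by rewrite integral_mkcond; apply: eq_integral => t _; rewrite GE.
have iG : (lam \x leb)%E.-integrable setT G.
  apply/integrable12ltyP => //; apply: le_lt_trans Foo.
  rewrite le_eqVlt; apply/orP; left; apply/eqP; apply: eq_integral => x _.
  rewrite [RHS]integral_mkcond; apply: eq_integral => t _; rewrite GE !patchE.
  by case: ifP => // _; rewrite abse0.
transitivity (\int[lam]_x \int[leb]_t G (x, t))%E; first exact: eq_integral.
rewrite (Fubini iG) [RHS]integral_mkcond; apply: eq_integral => t _.
rewrite patchE; case: ifPn => tD.
  by apply: eq_integral => x _; rewrite GE patchE tD.
by apply: integral0_eq => x _; rewrite GE patchE (negPf tD).
Qed.

Variables (U V : B -> R).
Hypothesis mU : measurable_fun setT U.
Hypothesis mV : measurable_fun setT V.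
Hypothesis iU : lam.-integrable setT (EFin \o U).
Hypothesis iV : lam.-integrable setT (EFin \o V).

Definition line_integral (x : 'rV[R]_k) (s : R) : R :=
  \int[leb]_(t in `[0, s]) V (line x t).

(** The interval of integration varies with s; it is encoded as the Borel set 0 <= t <= s of triples
    ((x, s), t), so that Tonelli applies to the positive and negative parts of V. *)
Lemma measurable_line_integral :
  measurable_fun setT (fun z : B * RR => line_integral z.1 z.2).
Proof.
have key (g : B -> R) : measurable_fun setT g -> (forall x, 0 <= g x) ->
    measurable_fun setT (fun z : B * RR => (\int[leb]_(t in `[0%R, z.2]) (g (line z.1 t))%:E)%E).
  move=> mg g0.
  pose D : set ((B * RR) * RR) := [set z | 0 <= z.2 /\ z.2 <= z.1.2].
  have m2 : measurable_fun setT (fun z : (B * RR) * RR => z.2 : R) by exact: measurable_snd.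
  have m12 : measurable_fun setT (fun z : (B * RR) * RR => z.1.2 : R).
    by apply: measurableT_comp; [exact: measurable_snd|exact: measurable_fst].
  have m11 : measurable_fun setT (fun z : (B * RR) * RR => z.1.1 : B).
    by apply: measurableT_comp; [exact: measurable_fst|exact: measurable_fst].
  have mD : measurable D.
    apply: measurableI; rewrite -[X in measurable X]setTI.
      by apply: measurable_fun_le => //; exact: measurable_cst.
    exact: measurable_fun_le.
  pose F (z : (B * RR) * RR) : \bar R := ((fun z => (g (line z.1.1 z.2))%:E) \_ D) z.
  have mF : measurable_fun setT F.
    apply/(measurable_restrictT _ _).1 => //; apply: measurable_funTS.
    apply/measurable_EFinP; apply: (measurableT_comp mg).
    exact: (measurableT_comp (measurable_line_pair i) (measurable_fun_pair m11 m2)).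
  have F0 z : (0 <= F z)%E by apply: erestrict_ge0 => ? _; rewrite lee_fin.
  have := measurable_fun_fubini_tonelli_F (m2 := leb) F mF F0.
  apply: eq_measurable_fun => z _; rewrite /fubini_F [RHS]integral_mkcond.
  apply: eq_integral => t _; rewrite /F !patchE; congr (if _ then _ else _).
  by apply/idP/idP; rewrite !inE /D/= in_itv/= => /andP.
rewrite /line_integral /Rintegral.
apply: measurableT_comp; first exact: fine_measurable.
have := emeasurable_funB
  (key _ (measurable_funrpos mV) (fun x => funrpos_ge0 V x))
  (key _ (measurable_funrneg mV) (fun x => funrneg_ge0 V x)).
apply: eq_measurable_fun => z _; rewrite [RHS]integralE.
by congr (_ - _)%E; apply: eq_integral => t _; rewrite ?funrposE ?funrnegE
  ?funeposE ?funenegE /= EFin_max.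
Qed.

Lemma lines_norm_lty s (g : B -> R) : measurable_fun setT g -> (forall x, `|g x| <= 1) ->
  (\int[lam]_x \int[leb]_(t in `[0%R, s]) `|V (line x t) * g x|%R%:E < +oo)%E.
Proof.
move=> mg g1.
apply: (@le_lt_trans _ _ (\int[lam]_x \int[leb]_(t in `[0%R, s]) `|V (line x t)|%R%:E)%E).
  have mL : measurable_fun setT (fun z : B * RR => V (line z.1 z.2)).
    exact: (measurableT_comp mV (measurable_line_pair i)).
  have mG : measurable_fun setT (fun z : B * RR => g z.1).
    exact: (measurableT_comp mg measurable_fst).
  apply: ge0_le_integral => //.
  - by move=> x _; apply: integral_ge0 => t _; rewrite lee_fin.
  - apply: (measurable_section_integral (F := fun z => `|V (line z.1 z.2) * g z.1|%R%:E)) => //.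
    by apply/measurable_EFinP; apply: measurableT_comp => //; exact: measurable_funM.
  - apply: (measurable_section_integral (F := fun z => `|V (line z.1 z.2)|%R%:E)) => //.
    by apply/measurable_EFinP; apply: measurableT_comp.
  - move=> x _; have mVx := measurableT_comp mV (measurable_line_r i x).
    apply: ge0_le_integral => //.
    + apply/measurable_EFinP; apply: measurable_funTS; apply: measurableT_comp => //.
      by apply: measurable_funM => //; exact: measurable_cst.
    + by apply/measurable_EFinP; apply: measurable_funTS; apply: measurableT_comp.
    + by move=> t _; rewrite lee_fin normrM ler_piMr.
rewrite (integral_line_fubini i (f := fun x => `|V x|%R%:E))//.
  apply: lte_mul_pinfty => //; last exact: integrable_norm_lty.
  by rewrite lebesgue_measure_itv/=; case: ifP => // _; rewrite -EFinD.
by apply/measurable_EFinP; apply: measurableT_comp.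
Qed.

Lemma ae_line_integrableV s :
  {ae lam, forall x, leb.-integrable `[0, s] (fun t => (V (line x t))%:E)}.
Proof.
have c1 (x : B) : `|(cst 1 : B -> R) x| <= 1 by rewrite /= normr1.
have H := lines_norm_lty s (measurable_cst (1 : R)) c1.
have mL : measurable_fun setT (fun z : B * RR => V (line z.1 z.2) * (cst 1 : B -> R) z.1).
  apply: measurable_funM; last exact: measurable_cst.
  exact: (measurableT_comp mV (measurable_line_pair i)).
have mI : measurable_fun setT (fun x : B =>
    \int[leb]_(t in `[0%R, s]) `|V (line x t) * (cst 1 : B -> R) x|%R%:E)%E.
  apply: (measurable_section_integral
    (F := fun z => `|V (line z.1 z.2) * (cst 1 : B -> R) z.1|%R%:E)) => //.
  by apply/measurable_EFinP; apply: measurableT_comp.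
have I0 x : (0 <= \int[leb]_(t in `[0%R, s]) `|V (line x t) * (cst 1 : B -> R) x|%R%:E)%E.
  by apply: integral_ge0 => t _; rewrite lee_fin.
have : lam.-integrable setT (fun x : B =>
    \int[leb]_(t in `[0%R, s]) `|V (line x t) * (cst 1 : B -> R) x|%R%:E)%E.
  apply/integrableP; split => //; apply: le_lt_trans H.
  by rewrite le_eqVlt; apply/orP; left; apply/eqP; apply: eq_integral => x _; rewrite gee0_abs.
move/integrable_ae => /(_ measurableT); apply: ae_imply => x /(_ Logic.I).
rewrite ge0_fin_numE// => Hx; apply/integrableP; split.
  apply/measurable_EFinP; apply: measurable_funTS.
  exact: (measurableT_comp mV (measurable_line_r i x)).
by apply: le_lt_trans Hx; rewrite le_eqVlt; apply/orP; left; apply/eqP;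
  apply: eq_integral => t _; rewrite /= mulr1.
Qed.

Lemma measurable_prod_fun (F : 'I_k -> R -> R) :
  (forall j, measurable_fun setT (F j)) ->
  measurable_fun setT (prod_fun F : B -> R).
Proof.
move=> mF; rewrite /prod_fun; elim: (index_enum _) => [|j r ih].
  by under eq_fun do rewrite big_nil; exact: measurable_cst.
under eq_fun do rewrite big_cons; apply: measurable_funM => //.
exact: (measurableT_comp (mF j) (measurable_coord j)).
Qed.

Definition box_bump (a b : 'rV[R]_k) (m : nat) : 'rV[R]_k -> R :=
  prod_fun (fun j => bump (a 0 j) (b 0 j) m).

Lemma measurable_box_bump a b m : measurable_fun setT (box_bump a b m : B -> R).
Proof.
apply: measurable_prod_fun => j; apply: continuous_measurable_fun.
exact/smooth1_continuous/smooth1_bump.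
Qed.

Lemma box_bump_ge0 a b m x : 0 <= box_bump a b m x.
Proof. by apply: prodr_ge0 => j _; exact: bump_ge0. Qed.

Lemma box_bump_norm_le1 a b m x : `|box_bump a b m x| <= 1.
Proof.
rewrite ger0_norm ?box_bump_ge0//; apply: prodr_ile1 => j _.
by rewrite bump_ge0 bump_le1.
Qed.

(* [box_bump a b m] averaged over the segment from [x - s *: e_i] to [x]: its
   [i]-th partial derivative is a difference of two translates of the bump. *)
Definition swept_bump (a b : 'rV[R]_k) (m : nat) (s : R) : 'rV[R]_k -> R :=
  prod_fun (fun j => if j == i then
    fun u => bump_primitive (a 0 j) (b 0 j) m u - bump_primitive (a 0 j) (b 0 j) m (u - s)
    else bump (a 0 j) (b 0 j) m).

Let cofactor (a b : 'rV[R]_k) m (x : 'rV[R]_k) : R :=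
  \prod_(j < k | j != i) bump (a 0 j) (b 0 j) m (x 0 j).

Let box_bump_line a b m x t : box_bump a b m (line x t) =
  bump (a 0 i) (b 0 i) m (x 0 i + t) * cofactor a b m x.
Proof.
rewrite /box_bump /prod_fun (bigD1 i)//= line_coord; congr (_ * _).
by apply: eq_bigr => j ji; rewrite line_coord_neq.
Qed.

Lemma swept_bumpE a b m s x : 0 < s ->
  (\int[leb]_(t in `[0%R, s]) (box_bump a b m (line x (- t)))%:E =
   (swept_bump a b m s x)%:E)%E.
Proof.
move=> s0.
have c0 : 0 <= cofactor a b m x by apply: prodr_ge0 => j _; exact: bump_ge0.
rewrite /swept_bump /prod_fun (bigD1 i)//= eqxx.
rewrite (eq_bigr (fun j => bump (a 0 j) (b 0 j) m (x 0 j))) => [|j /negPf ->//].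
rewrite -/(cofactor a b m x) EFinM -integral_bump_primitive//.
have mb : measurable_fun `[0, s] (fun t : RR => (bump (a 0 i) (b 0 i) m (x 0 i - t))%:E).
  apply/measurable_EFinP; apply: measurable_funTS; apply: continuous_measurable_fun => t.
  apply: (@continuous_comp _ _ _ (fun t : R => x 0 i - t) (bump (a 0 i) (b 0 i) m)).
    by apply: continuousB; [exact: cst_continuous|exact: cvg_id].
  exact/smooth1_continuous/smooth1_bump.
transitivity (\int[leb]_(t in `[0%R, s])
    ((bump (a 0 i) (b 0 i) m (x 0 i - t))%:E * (cofactor a b m x)%:E))%E; last first.
  by apply: ge0_integralZr => // t _; rewrite lee_fin bump_ge0.
by apply: eq_integral => t _; rewrite box_bump_line EFinM.
Qed.

Lemma partial_swept_bump a b m s x :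
  partial i (swept_bump a b m s) x = box_bump a b m x - box_bump a b m (line x (- s)).
Proof.
have dP (u : R) := is_derive_bump_primitive (a 0 i) (b 0 i) m u.
have dF (u : R) : is_derive u (1 : R) (fun u => bump_primitive (a 0 i) (b 0 i) m u -
    bump_primitive (a 0 i) (b 0 i) m (u - s))
    (bump (a 0 i) (b 0 i) m u - bump (a 0 i) (b 0 i) m (u - s)).
  have ds : is_derive u (1 : R) (bump_primitive (a 0 i) (b 0 i) m \o (fun u : R => u - s))
      (bump (a 0 i) (b 0 i) m (u - s)).
    have := dP (u - s) => dPs.
    split; first by apply: ex_derive.
    rewrite -derive1E derive1_comp ?derive1E; [|exact: ex_derive..].
    have [_ ->] := dPs.
    have [_ ->] : is_derive u (1 : R) (fun v : R => v - s) 1.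
      by apply: is_derive_eq; rewrite ?subr0 ?addr0.
    by rewrite mulr1.
  exact: is_deriveB.
rewrite /swept_bump partial_prod_fun => [|u]; last by rewrite eqxx; have [] := dF u.
rewrite -[X in _ = _ X - _](line0 i x) !box_bump_line addr0 -mulrBl.
rewrite /prod_fun (bigD1 i)//= /deriv_at !eqxx derive1E; congr (_ * _).
  by have [_ ->] := dF (x 0 i).
by apply: eq_bigr => j /negPf ->.
Qed.

(** Averaging over shifts up to s enlarges the support by s in the i-th direction, whence the corner
    [line b s]. *)
Lemma test_function_swept_bump (Omega : set 'rV[R]_k) a b m s : 0 < s ->
  box (a, line b s) `<=` Omega -> test_function Omega (swept_bump a b m s).
Proof.
move=> s0; apply: test_function_prod_fun => /= j.
  case: eqP => [->|_]; last exact: smooth1_bump.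
  have sP : smooth1 (bump_primitive (a 0 i) (b 0 i) m).
    exact: smooth1_primitive (smooth1_bump _ _ _) (is_derive_bump_primitive _ _ _).
  apply: smooth1B => //.
  have := smooth1_affine 1 (- s) sP; congr smooth1.
  by apply/funext => u; rewrite mul1r.
move=> u; case: (eqVneq j i) => [->|ji] ju; last first.
  apply: bump_out; apply: contra ju; rewrite line_coord_neq// => /andP[? ?].
  by rewrite !ltW.
move: ju; rewrite line_coord => ju.
have := integral_bump_primitive (a 0 i) (b 0 i) m u s0.
rewrite (eq_integral (cst 0%E)) ?integral0 => [[<-//]|t].
rewrite inE/= in_itv/= => /andP[t0 ts]; rewrite bump_out//.
apply: contra ju => /andP[? ?]; apply/andP; split; lra.
Qed.

End weak_derivative_on_lines.

Lemma integrable_integral_real d (T : measurableType d) (R : realType)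
    (mu : {measure set T -> \bar R}) (f : T -> R) :
  mu.-integrable setT (EFin \o f) -> exists p : R, (\int[mu]_x (f x)%:E = p%:E)%E.
Proof.
by move=> /(integrable_fin_num measurableT) fE; exists (fine (\int[mu]_x (f x)%:E)); rewrite fineK.
Qed.

Section weak_derivative_lines.
Variables (R : realType) (k : nat) (i : 'I_k).
Local Notation B := (borelRn R k).
Local Notation RR := (measurableTypeR R).
Local Notation lam := (@borel_lebesgue R k).
Local Notation leb := (@lebesgue_measure R).
Local Notation line := (line i).

Variables (U V : B -> R).
Hypothesis mU : measurable_fun setT U.
Hypothesis mV : measurable_fun setT V.
Hypothesis iU : lam.-integrable setT (EFin \o U).
Hypothesis iV : lam.-integrable setT (EFin \o V).

Definition line_defect (s : R) (x : B) : R :=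
  U (line x s) - U x - line_integral i V x s.

Lemma measurable_line_defect :
  measurable_fun setT (fun z : B * RR => line_defect z.2 z.1).
Proof.
apply: measurable_funB; last exact: measurable_line_integral.
apply: measurable_funB; first exact: (measurableT_comp mU (measurable_line_pair i)).
exact: (measurableT_comp mU measurable_fst).
Qed.

Lemma measurable_line_defect1 s : measurable_fun setT (line_defect s).
Proof.
exact: (measurableT_comp measurable_line_defect
  (measurable_fun_pair (@measurable_id _ B setT) (measurable_cst (s : RR)))).
Qed.

Lemma measurable_line_integral1 s :
  measurable_fun setT (fun x : B => line_integral i V x s).
Proof.
exact: (measurableT_comp (measurable_line_integral i mV)
  (measurable_fun_pair (@measurable_id _ B setT) (measurable_cst (s : RR)))).
Qed.

Lemma integrable_line s : lam.-integrable setT (fun x => (U (line x s))%:E).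
Proof.
apply: integrable_of_lty; first exact: (measurableT_comp mU (measurable_line_l i s)).
rewrite (integral_line i s (f := fun x => `|U x|%R%:E)); last first.
  by apply/measurable_EFinP; apply: measurableT_comp.
exact: integrable_norm_lty.
Qed.

Lemma integrable_line_integral s :
  lam.-integrable setT (fun x => (line_integral i V x s)%:E).
Proof.
apply: integrable_of_lty; first exact: measurable_line_integral1.
have c1 (x : B) : `|(cst 1 : B -> R) x| <= 1 by rewrite /= normr1.
apply: le_lt_trans (lines_norm_lty i mV iV s (measurable_cst (1 : R)) c1).
have mL : measurable_fun setT (fun z : B * RR => V (line z.1 z.2) * (cst 1 : B -> R) z.1).
  apply: measurable_funM; last exact: measurable_cst.
  exact: (measurableT_comp mV (measurable_line_pair i)).
apply: ge0_le_integral => //.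
- by apply/measurable_EFinP; apply: measurableT_comp => //; exact: measurable_line_integral1.
- apply: (measurable_section_integral
    (F := fun z => `|V (line z.1 z.2) * (cst 1 : B -> R) z.1|%R%:E)) => //.
  by apply/measurable_EFinP; apply: measurableT_comp.
- move=> x _; under eq_integral do rewrite /= mulr1.
  apply: le_Rintegral_norm => //; apply: measurable_funTS.
  exact: (measurableT_comp mV (measurable_line_r i x)).
Qed.

Lemma integrable_line_defect s : lam.-integrable setT (EFin \o line_defect s).
Proof.
have := integrableB measurableT (integrableB measurableT (integrable_line s) iU)
  (integrable_line_integral s).
by apply: eq_integrable => // x _; rewrite /= -!EFinB.
Qed.

Lemma measurable_section_signed_integral (D : set RR) (F : B * RR -> \bar R) :
  measurable D -> measurable_fun setT F ->
  measurable_fun setT (fun x : B => \int[leb]_(t in D) F (x, t))%E.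
Proof.
move=> mD mF.
have := emeasurable_funB
  (measurable_section_integral mD (measurable_funepos mF) (funepos_ge0 F))
  (measurable_section_integral mD (measurable_funeneg mF) (funeneg_ge0 F)).
apply: eq_measurable_fun => x _; rewrite [RHS]integralE.
by congr (_ - _)%E; apply: eq_integral => t _; rewrite ?funeposE ?funenegE.
Qed.

(** Averaging the bump backwards is adjoint to integrating V forwards: expand [swept_bump] as an
    integral over t, exchange, translate x by t, and exchange back. *)
Lemma integral_line_integral_bump a b m s : 0 < s ->
  (\int[lam]_x (V x * swept_bump i a b m s x)%:E =
   \int[lam]_x (line_integral i V x s * box_bump a b m x)%:E)%E.
Proof.
move=> s0; set phi := box_bump a b m.
have mphi : measurable_fun setT (phi : B -> R) := measurable_box_bump a b m.
have phi1 x : `|phi x| <= 1 := box_bump_norm_le1 a b m x.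
have lebs : leb `[0, s] = s%:E by rewrite lebesgue_measure_itv/= lte_fin s0 -EFinB subr0.
have mN : measurable_fun setT (fun z : B * RR => phi (line z.1 (- z.2))).
  have m2 : measurable_fun setT (fun z : B * RR => (z.1, - z.2) : B * RR).
    apply: measurable_fun_pair; first exact: measurable_fst.
    by apply: measurableT_comp => //; exact: measurable_snd.
  exact: (measurableT_comp (measurableT_comp mphi (measurable_line_pair i)) m2).
have mVphi : measurable_fun setT (fun z : B * RR => V z.1 * phi (line z.1 (- z.2))).
  by apply: measurable_funM => //; exact: (measurableT_comp mV measurable_fst).
transitivity (\int[lam]_x \int[leb]_(t in `[0%R, s]) (V x * phi (line x (- t)))%:E)%E.
  apply: eq_integral => x _; rewrite EFinM -swept_bumpE//.
  rewrite -integralZl//; apply: integrable_le1 => //.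
    by move: (ltry s); rewrite -lebs.
  apply: measurable_funTS.
  exact: (measurableT_comp mN (measurable_fun_pair (measurable_cst x) (@measurable_id _ RR setT))).
rewrite (fubini_lines (F := fun z => V z.1 * phi (line z.1 (- z.2))))//; last first.
  apply: (@le_lt_trans _ _ (\int[lam]_x (s%:E * `|V x|%R%:E))%E).
    apply: ge0_le_integral => //.
    - by move=> x _; apply: integral_ge0 => t _; rewrite lee_fin.
    - apply: (measurable_section_integral (F := fun z => `|V z.1 * phi (line z.1 (- z.2))|%R%:E)) => //.
      by apply/measurable_EFinP; apply: measurableT_comp.
    - apply: measurable_funeM; apply/measurable_EFinP; exact: measurableT_comp.
    - move=> x _; apply: (@le_trans _ _ (\int[leb]_(t in `[0%R, s]) (cst `|V x|%R%:E) t)%E).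
        apply: ge0_le_integral => //.
        + apply/measurable_EFinP; apply: measurable_funTS; apply: measurableT_comp => //.
          exact: (measurableT_comp mVphi (measurable_fun_pair (measurable_cst x)
            (@measurable_id _ RR setT))).
        + by move=> t _; rewrite lee_fin normrM ler_piMr.
      by rewrite integral_cst//= lebs muleC.
  have s0' := ltW s0.
  rewrite ge0_integralZl_EFin//; last by apply/measurable_EFinP; apply: measurableT_comp.
  by apply: lte_mul_pinfty; rewrite ?lee_fin ?ltW//; exact: integrable_norm_lty.
transitivity (\int[leb]_(t in `[0%R, s]) \int[lam]_x (V (line x t) * phi x)%:E)%E.
  apply: eq_integral => t _.
  rewrite -(integral_line i t (f := fun x => (V x * phi (line x (- t)))%:E)).
    by apply: eq_integral => x _; rewrite lineD addrN line0.
  apply/measurable_EFinP; apply: measurable_funM => //.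
  exact: (measurableT_comp mphi (measurable_line_l i (- t))).
rewrite -(fubini_lines (F := fun z => V (line z.1 z.2) * phi z.1))//; last 2 first.
- apply: measurable_funM; first exact: (measurableT_comp mV (measurable_line_pair i)).
  exact: (measurableT_comp mphi measurable_fst).
- exact: lines_norm_lty.
apply: ae_eq_integral => //.
- apply: (measurable_section_signed_integral (F := fun z => (V (line z.1 z.2) * phi z.1)%:E)) => //.
  apply/measurable_EFinP; apply: measurable_funM; last exact: (measurableT_comp mphi measurable_fst).
  exact: (measurableT_comp mV (measurable_line_pair i)).
- apply/measurable_EFinP; apply: measurable_funM => //; exact: measurable_line_integral1.
(* Real-valued integrals fall back on a default where V is not integrable on the segment; this
   concerns only a null set of x. *)
apply: ae_imply (ae_line_integrableV i mV iV s) => x iVx _.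
rewrite /line_integral /Rintegral EFinM fineK ?integrable_fin_num//.
by rewrite muleC -integralZl//; apply: eq_integral => t _; rewrite mulrC.
Qed.

Lemma box_bump_cvg a b (x : 'rV[R]_k) :
  box_bump a b m x @[m --> \oo] --> (\1_(obox a b) x : R).
Proof.
have -> : \1_(obox a b) x = \prod_(j < k) (\1_(`]a 0 j, b 0 j[%classic) (x 0 j)) :> R.
  rewrite indicE; case: (boolP (x \in _)) => [/set_mem xab|/negP xab].
    by rewrite big1// => j _; rewrite indicE mem_set//= in_itv/= xab.
  have [j xj] : exists j, ~ (a 0 j < x 0 j < b 0 j).
    by apply/existsNP => H; apply: xab; exact/mem_set.
  by rewrite (bigD1 j)//= indicE memNset ?mul0r//= in_itv/=.
rewrite /box_bump /prod_fun; elim: (index_enum _) => [|j r ih].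
  by rewrite big_nil; under eq_cvg do rewrite big_nil; exact: cvg_cst.
rewrite big_cons; under eq_cvg do rewrite big_cons.
by apply: cvgM => //; exact: bump_cvg.
Qed.

Variable Omega : set 'rV[R]_k.
Hypothesis weak : forall phi, test_function Omega phi ->
  \int[lam]_x (U x * partial i phi x) = - \int[lam]_x (V x * phi x).

(** Test the weak derivative with [swept_bump]. Its partial derivative is phi minus the translate of
    phi, and moving the translation onto U produces the difference U (line x s) - U x; the other
    side is [integral_line_integral_bump]. *)
Lemma integral_bump_line_defect a b m s : 0 < s -> box (a, line b s) `<=` Omega ->
  (\int[lam]_x (line_defect s x * box_bump a b m x)%:E = 0)%E.
Proof.
move=> s0 abO; set phi := box_bump a b m.
have mphi : measurable_fun setT (phi : B -> R) := measurable_box_bump a b m.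
have phi1 x : `|phi x| <= 1 := box_bump_norm_le1 a b m x.
have mphis : measurable_fun setT (fun x : B => phi (line x (- s))).
  exact: (measurableT_comp mphi (measurable_line_l i (- s))).
have i1 := integrable_mul_bounded mphi phi1 (integrable_line s).
have i2 := integrable_mul_bounded mphi phi1 iU.
have i3 := integrable_mul_bounded mphi phi1 (integrable_line_integral s).
have i4 := integrable_mul_bounded mphis (fun x => phi1 (line x (- s))) iU.
have := weak (test_function_swept_bump m s0 abO).
rewrite (eq_Rintegral _ (g := fun x => U x * phi x - U x * phi (line x (- s)))); last first.
  by move=> x _; rewrite partial_swept_bump mulrBr.
rewrite (RintegralB measurableT i2 i4) /Rintegral integral_line_integral_bump//.
have [p Ep] : exists p, (\int[lam]_x (U x * phi x)%:E = p%:E)%E.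
  exact: integrable_integral_real i2.
have [q Eq] : exists q, (\int[lam]_x (line_integral i V x s * phi x)%:E = q%:E)%E.
  exact: integrable_integral_real i3.
have [r Er] : exists r, (\int[lam]_x (U x * phi (line x (- s)))%:E = r%:E)%E.
  exact: integrable_integral_real i4.
rewrite Ep Eq Er /= => H.
transitivity (\int[lam]_x ((U (line x s) * phi x - U x * phi x)%:E -
    (line_integral i V x s * phi x)%:E))%E.
  by apply: eq_integral => x _; rewrite -EFinB; congr EFin; rewrite /line_defect; ring.
rewrite integralB_EFin//; last first.
  have := integrableB measurableT i1 i2.
  by apply: eq_integrable => // x _; rewrite /= -EFinB.
under eq_integral do rewrite EFinB.
rewrite integralB_EFin//.
have -> : (\int[lam]_x (U (line x s) * phi x)%:E =
    \int[lam]_x (U x * phi (line x (- s)))%:E)%E.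
  rewrite -(integral_line i s (f := fun x => (U x * phi (line x (- s)))%:E)).
    by apply: eq_integral => x _; rewrite lineD addrN line0.
  by apply/measurable_EFinP; exact: measurable_funM.
rewrite Ep Eq Er -!EFinB; congr EFin.
by rewrite -(opprB p r) H opprK subrr.
Qed.

Lemma integral_obox_line_defect a b s : 0 < s -> box (a, line b s) `<=` Omega ->
  (\int[lam]_(x in obox a b) (line_defect s x)%:E = 0)%E.
Proof.
move=> s0 abO.
have ms := measurable_line_defect1 s.
have mf m : measurable_fun setT (fun x : B => (line_defect s x * box_bump a b m x)%:E).
  by apply/measurable_EFinP; apply: measurable_funM => //; exact: measurable_box_bump.
have mo : measurable_fun setT (fun x : B => (line_defect s x * \1_(obox a b) x)%:E).
  apply/measurable_EFinP; apply: measurable_funM => //.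
  exact: (measurable_indic (measurable_obox a b)).
have ig : lam.-integrable setT (fun x => `|line_defect s x|%R%:E).
  exact: (integrable_norm (integrable_line_defect s)).
have cv : {ae lam, forall x : B, setT x ->
    (line_defect s x * box_bump a b m x)%:E @[m --> \oo] -->
    (line_defect s x * \1_(obox a b) x)%:E}.
  apply: aeW => x _; apply: cvg_EFin; first exact: nearW.
  apply: cvgM; first exact: cvg_cst.
  exact: box_bump_cvg.
have dm : {ae lam, forall (x : B) (m : nat), setT x ->
    (`|(line_defect s x * box_bump a b m x)%:E| <= `|line_defect s x|%R%:E)%E}.
  apply: aeW => x m _; rewrite /= lee_fin normrM ler_piMr//.
  exact: box_bump_norm_le1.
have [_ _] := dominated_convergence measurableT mf mo cv ig dm.
rewrite (_ : (fun m => _) = cst 0%E); last first.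
  by apply/funext => m; rewrite integral_bump_line_defect.
move=> H; transitivity (\int[lam]_x (line_defect s x * \1_(obox a b) x)%:E)%E.
  rewrite integral_mkcond; apply: eq_integral => x _; rewrite patchE indicE.
  by case: ifP => _; rewrite ?mulr1 ?mulr0.
by rewrite -(cvg_lim (@ereal_hausdorff R) H) lim_cst.
Qed.

(** For s < rho, a box in the cube of radius rho stays in the cube of radius 2 rho when lengthened
    by s. So for each such s the defect vanishes almost everywhere on the small cube, and
    [ae_section_negligible] exchanges the quantifiers. *)
Lemma ae_line_defect0 (c : 'rV[R]_k) (rho : R) : 0 < rho ->
  box (c - const_mx (2 * rho), c + const_mx (2 * rho)) `<=` Omega ->
  {ae lam, forall x, obox (c - const_mx rho) (c + const_mx rho) x ->
    leb [set s | 0 < s < rho /\ line_defect s x != 0] = 0%E}.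
Proof.
move=> rho0 cO; pose Q := obox (c - const_mx rho) (c + const_mx rho).
pose S : set (B * RR) := [set z | [/\ Q z.1, 0 < z.2 < rho & line_defect z.2 z.1 != 0]].
have mS : measurable S.
  rewrite (_ : S = (Q `*` `]0, rho[) `&`
      ((fun z : B * RR => line_defect z.2 z.1) @^-1` (~` [set 0]))); last first.
    apply/seteqP; split => -[x s] /=.
      by case=> Qx sr /eqP d0; rewrite in_itv.
    by rewrite in_itv/= => -[[Qx sr] /eqP d0].
  apply: measurableI; first by apply: measurableX => //; exact: measurable_obox.
  rewrite -[X in measurable X]setTI; apply: measurable_line_defect => //.
  exact: measurableC.
have S0 s : lam [set x | S (x, s)] = 0%E.
  have mSs : measurable ([set x | S (x, s)] : set B).
    rewrite (_ : [set x | _] = ysection S s); first exact: measurable_ysection.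
    by apply/seteqP; split => x; rewrite /ysection /= inE.
  apply: measure_negligible => //.
  have [/andP[s0 sr]|/negP ns] := boolP (0 < s < rho); last first.
    by apply: negligibleS (negligible_set0 _) => x [].
  have := integral_obox_eq0 (c := c - const_mx rho) (d := c + const_mx rho)
    (measurable_line_defect1 s) (integrable_line_defect s) _.
  case=> [a b ca bd|N [mN N0 QN]].
    apply: integral_obox_line_defect => // x abx; apply: cO => j.
    have bj : line b s 0 j <= b 0 j + s.
      by case: (eqVneq j i) => [->|ji]; rewrite ?line_coord ?line_coord_neq// lerDl ltW.
    have /andP[ax] := abx j => /le_trans /(_ bj) xb.
    have := ca j; have := bd j; rewrite /= !mxE => ? ?; apply/andP; split; lra.
  exists N; split => // x [Qx _ dx]; apply: QN => /(_ Qx) /eqP.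
  by rewrite (negPf dx).
move: (ae_section_negligible mS S0); apply: ae_imply => x S0x Qx.
rewrite -[RHS]S0x; congr (leb _); apply/seteqP; split => s /=; first by move=> [].
by case.
Qed.

End weak_derivative_lines.

(** * Integrating the contact equation along a segment *)

Section heis_near_primitive.
Variables (R : realType) (n : nat).
Local Notation RR := (measurableTypeR R).
Local Notation leb := (@lebesgue_measure R).

(** With the base point fixed the form is linear; its coordinate expression lets it be integrated
    component by component. *)
Lemma contact_form_delta (p w : heis R n) :
  contact_form p w = \sum_l contact_form p (delta_mx 0 l) * w 0 l.
Proof.
have cD (q : heis R n) v1 v2 : contact_form q (v1 + v2) = contact_form q v1 + contact_form q v2 :> R.
  rewrite /contact_form mxE addrACA -mulrDr -big_split/=; congr (_ + 2 * _).
  by apply: eq_bigr => j _; rewrite !mxE; ring.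
have cZ (q : heis R n) a v : contact_form q (a *: v) = contact_form q v * a :> R.
  rewrite /contact_form mxE [RHS]mulrDl; congr (_ + _); first exact: mulrC.
  rewrite -mulrA; congr (_ * _).
  by rewrite mulr_suml; apply: eq_bigr => j _; rewrite !mxE; ring.
have c0 (q : heis R n) : contact_form q 0 = 0 :> R by rewrite -(scale0r (0 : heis R n)) cZ mulr0.
rewrite {1}(row_sum_delta w) (big_morph _ (cD p) (c0 p)).
by apply: eq_bigr => l _; rewrite cZ.
Qed.

(** The forms at p and q have the same vertical part, so where the form at q vanishes only the
    difference of their horizontal coefficients, bounded by 2 a, remains. *)
Lemma contact_form_base (p q w : heis R n) (a : R) :
  (forall j : 'I_n, `|q 0 (xi j) - p 0 (xi j)| <= a /\
                    `|q 0 (yi j) - p 0 (yi j)| <= a) ->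
  contact_form q w = 0 -> `|contact_form p w| <=
    2 * a * \sum_(j < n) (`|w 0 (xi j)| + `|w 0 (yi j)|).
Proof.
move=> pq qw.
have -> : contact_form p w = 2 * \sum_(j < n) ((p 0 (xi j) - q 0 (xi j)) * w 0 (yi j)
    - (p 0 (yi j) - q 0 (yi j)) * w 0 (xi j)).
  rewrite -[LHS]subr0 -[X in _ - X]qw /contact_form.
  rewrite (_ : forall x y z : R, x + y - (x + z) = y - z); last by move=> *; ring.
  by rewrite -mulrBr -sumrB; congr (_ * _); apply: eq_bigr => j _; ring.
rewrite normrM ger0_norm// -mulrA ler_wpM2l// mulr_sumr.
apply: le_trans (ler_norm_sum _ _ _) _; apply: ler_sum => j _.
have [x1 y1] := pq j; apply: le_trans (ler_normB _ _) _.
rewrite !normrM mulrDr addrC.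
by apply: lerD; apply: ler_wpM2r => //; rewrite distrC.
Qed.

Definition hnorm1 (w : heis R n) : R := \sum_(j < n) (`|w 0 (xi j)| + `|w 0 (yi j)|).

Lemma hnorm1_ge0 w : 0 <= hnorm1 w.
Proof. by apply: sumr_ge0 => j _; exact: addr_ge0. Qed.

Lemma le_hnorm1 (w : heis R n) (j : 'I_n) : `|w 0 (xi j)| <= hnorm1 w /\ `|w 0 (yi j)| <= hnorm1 w.
Proof.
have s0 : 0 <= \sum_(i < n | i != j) (`|w 0 (xi i)| + `|w 0 (yi i)|).
  by apply: sumr_ge0 => i _; exact: addr_ge0.
rewrite /hnorm1 (bigD1 j)//=; split; first by rewrite -addrA lerDl addr_ge0.
by rewrite addrAC lerDr addr_ge0.
Qed.

(** Write a for the integral of [hnorm1 (v t)]. Each u t is within a of u 0 horizontally, so the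
    form at u 0 applied to v t is at most 2 a times [hnorm1 (v t)], which integrates to 2 a^2. The
    integral identity is asked at s itself but only at almost every earlier t, since Fubini supplies
    no more. *)
Lemma heis_near_primitive (hn : (0 < n)%N) (u v : R -> heis R n) (s : R) : 0 < s ->
  (forall l, leb.-integrable `[0, s] (fun t => (v t 0 l)%:E)) ->
  (forall t, contact_form (u t) (v t) = 0) ->
  (forall l, u s 0 l - u 0 0 l = \int[leb]_(t in `[0, s]) (v t 0 l)) ->
  {ae leb, forall t, 0 < t < s -> forall l,
    u t 0 l - u 0 0 l = \int[leb]_(r in `[0, t]) (v r 0 l)} ->
  heis_near (u 0) (u s) (\int[leb]_(t in `[0, s]) hnorm1 (v t)).
Proof.
move=> s0 iv uv us ut.
have ms : measurable (`[0, s] : set RR) by [].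
set a := (X in heis_near _ _ X).
have ig : leb.-integrable `[0, s] (fun t => (hnorm1 (v t))%:E).
  have : leb.-integrable `[0, s] (fun t => (\sum_(j < n)
      (`|(v t 0 (xi j))%:E| + `|(v t 0 (yi j))%:E|))%E).
    by apply: integrable_sum => // j _; apply: integrableD => //; exact: (integrable_norm (iv _)).
  by apply: eq_integrable => // t _; rewrite -sumEFin; apply: eq_bigr.
have aE : (\int[leb]_(t in `[0%R, s]) (hnorm1 (v t))%:E = a%:E)%E.
  by rewrite fineK// (integrable_fin_num _ ig).
have bound l t : (forall w : heis R n, `|w 0 l| <= hnorm1 w) -> t <= s ->
    `|\int[leb]_(r in `[0, t]) (v r 0 l)| <= a.
  move=> wl ts.
  have sub : `[0, t] `<=` `[0, s].
    by move=> r /=; rewrite !in_itv/= => /andP[-> rt]; exact: le_trans ts.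
  have ivt : leb.-integrable `[0, t] (fun r => (v r 0 l)%:E).
    by apply: integrableS (iv l).
  have igt : leb.-integrable `[0, t] (fun r => (hnorm1 (v r))%:E).
    by apply: integrableS ig.
  rewrite -lee_fin -aE; apply: (@le_trans _ _ (\int[leb]_(r in `[0%R, t]) `|v r 0 l|%R%:E)%E).
    apply: le_Rintegral_norm => //; apply/measurable_EFinP.
    exact: measurable_int ivt.
  apply: (@le_trans _ _ (\int[leb]_(r in `[0%R, t]) (hnorm1 (v r))%:E)%E).
    apply: ge0_le_integral => //.
    - exact: (measurable_int _ (integrable_norm ivt)).
    - exact: measurable_int igt.
    - by move=> r _; rewrite lee_fin.
  apply: ge0_subset_integral => //; first exact: measurable_int ig.
  by move=> r _; rewrite lee_fin hnorm1_ge0.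
have near t : t <= s -> (forall l, u t 0 l - u 0 0 l = \int[leb]_(r in `[0, t]) (v r 0 l)) ->
    forall j : 'I_n, `|u t 0 (xi j) - u 0 0 (xi j)| <= a /\
                    `|u t 0 (yi j) - u 0 0 (yi j)| <= a.
  move=> ts utl j; rewrite !utl; split; apply: bound => // w.
    by have [] := le_hnorm1 w j.
  by have [] := le_hnorm1 w j.
split; first exact: near.
pose h t := contact_form (u 0) (v t).
have ic l : leb.-integrable `[0, s] (fun t => (contact_form (u 0) (delta_mx 0 l) * v t 0 l)%:E).
  have := integrableZl ms (contact_form (u 0) (delta_mx 0 l)) (iv l).
  by apply: eq_integrable => // t _; rewrite EFinM.
have ih : leb.-integrable `[0, s] (fun t => (h t)%:E).
  have := integrable_sum ms (index_enum _) (P := predT) (fun l _ => ic l).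
  by apply: eq_integrable => // t _; rewrite /h contact_form_delta -sumEFin.
have hE : (\int[leb]_(t in `[0%R, s]) (h t)%:E = (contact_form (u 0) (u s - u 0))%:E)%E.
  under eq_integral do rewrite /h contact_form_delta -sumEFin.
  rewrite integral_sum// contact_form_delta -sumEFin; apply: eq_bigr => l _.
  rewrite !mxE us EFinM fineK ?(integrable_fin_num _ (iv l))//.
  exact: (integralZl ms (iv l)).
rewrite -lee_fin -abse_EFin -hE.
apply: le_trans (le_abse_integral _ _ (measurable_int _ ih)) _ => //.
apply: (@le_trans _ _ (\int[leb]_(t in `[0%R, s]) ((2 * a)%:E * (hnorm1 (v t))%:E))%E).
  have a0 : 0 <= a by apply: Rintegral_ge0 => // t _; exact: hnorm1_ge0.
  apply: ae_ge0_le_integral => //.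
  - exact: (measurable_int _ (integrable_norm ih)).
  - by move=> t _; rewrite -EFinM lee_fin !mulr_ge0// hnorm1_ge0.
  - by apply: measurable_funeM; exact: measurable_int ig.
  apply: ae_imply ut => t utl; rewrite /= in_itv/= => /andP[t0 ts].
  rewrite lee_fin; apply: contact_form_base (uv t).
  (* [ut] concerns the open interval; t = 0 is trivial and t = s is [us]. *)
  move: t0; rewrite le_eqVlt => /predU1P[<-|t0] j; first by rewrite !subrr normr0.
  move: ts; rewrite le_eqVlt => /predU1P[->|ts]; first exact: near.
  by apply: near; [exact: ltW|apply: utl; rewrite t0].
rewrite integralZl// aE -EFinM lee_fin (_ : 2 * a * a = 2 * a ^+ 2); last by rewrite -mulrA.
apply: ler_wpM2r; first exact: sqr_ge0.
by rewrite ler_peMr// ler1n.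
Qed.

End heis_near_primitive.

(** * Borel representatives and Lusin approximation *)

Lemma null_bigcup_countable d (T : measurableType d) (R : realType)
    (mu : {measure set T -> \bar R}) (I : countType) (N : I -> set T) :
  (forall i, measurable (N i)) -> (forall i, mu (N i) = 0%E) ->
  measurable (\bigcup_i N i) /\ mu (\bigcup_i N i) = 0%E.
Proof.
move=> mN N0; pose F (m : nat) := if unpickle m is Some i then N i else set0.
have FE : \bigcup_i N i = \bigcup_m F m.
  apply/seteqP; split => x.
    by move=> [i _ Nx]; refine (ex_intro2 _ _ (pickle i) Logic.I _); rewrite /F pickleK.
  by move=> [m _]; rewrite /F; case: unpickle => // i Nx; exists i.
have mF m : measurable (F m) by rewrite /F; case: unpickle.
rewrite FE; split; first exact: bigcupT_measurable.
apply: measure_negligible; first exact: bigcupT_measurable.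
apply: negligible_bigcup => m; rewrite /F; case: unpickle => [i|]; last exact: negligible_set0.
by apply/negligibleP; [exact: mN|exact: N0].
Qed.

Section borel_representative.
Variables (R : realType) (k : nat).
Local Notation B := (borelRn R k).
Local Notation lam := (@borel_lebesgue R k).
Local Notation lamC := (lebesgueRn R k).

(** An inner approximation is the complement in O of a Borel hull H of O \ A. What is lost, A inside
    H, has measure 0 by finiteness of the measure of O, and is itself enclosed in a Borel null
    set. *)
Lemma caratheodory_borel_approx (O A : set B) : measurable O -> (lam O < +oo)%E ->
  A `<=` O -> measurable (A : set (Rn R k)) ->
  exists D N : set B, [/\ measurable D, measurable N, lam N = 0%E, D `<=` A & A `\` D `<=` N].
Proof.
move=> mO Ooo AO mA; have mOC := borel_caratheodory mO.
have [H mH [OAH HE]] := borel_hull (O `\` A).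
have mHC := borel_caratheodory mH.
have mX : measurable ((O `&` H) `\` (O `\` A) : set (Rn R k)).
  by apply: measurableD; [exact: measurableI|exact: measurableD].
have X0 : lamC ((O `&` H) `\` (O `\` A)) = 0%E.
  have sub : O `\` A `<=` O `&` H by move=> x OAx; split; [exact: OAx.1|exact: OAH].
  have le1 : (lamC (O `&` H) <= lamC (O `\` A))%E.
    rewrite (_ : lamC (O `\` A) = lamC H); last exact: esym HE.
    by apply: le_lebesgue_outer => x [].
  have OHoo : (lamC (O `&` H) < +oo)%E.
    by apply: le_lt_trans Ooo; apply: le_lebesgue_outer => x [].
  rewrite measureD//; [|exact: measurableI|exact: measurableD].
  have -> : (O `&` H) `&` (O `\` A) = O `\` A by exact: setIidr.
  apply/eqP; rewrite eq_le; apply/andP; split.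
    rewrite leeBlDr ?add0e// ge0_fin_numE//; apply: le_lt_trans OHoo.
    exact: le_lebesgue_outer.
  by rewrite leeBrDr ?add0e; [exact: le_lebesgue_outer|rewrite ge0_fin_numE//;
    apply: le_lt_trans OHoo; exact: le_lebesgue_outer].
have [N mN [XN NE]] := borel_hull ((O `&` H) `\` (O `\` A)).
exists (O `\` H), N; split => //.
- exact: measurableD.
- exact: etrans NE X0.
- by move=> x [Ox nHx]; apply: contrapT => nAx; apply: nHx; apply: OAH.
- move=> x [Ax nOHx]; apply: XN; split; last by case.
  split; first exact: AO.
  by apply: contrapT => nHx; apply: nOHx; split => //; exact: AO.
Qed.

Lemma ae_borel (P : 'rV[R]_k -> Prop) : {ae lamC, forall x, P x} ->
  exists N : set B, [/\ measurable N, lam N = 0%E & forall x, ~ N x -> P x].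
Proof.
move=> [N0 [mN0 N00 PN0]]; have [N mN [N0N NE]] := borel_hull N0.
exists N; split => //; first exact: etrans NE N00.
by move=> x nNx; apply: contrapT => nPx; apply/nNx/N0N/PN0.
Qed.

(** It suffices to correct the sublevel sets at rational heights, each by a null set. The
    quantification over N' allows several functions to share one exceptional set. *)
Lemma borel_representative (O : set B) (g : 'rV[R]_k -> R) : measurable O ->
  (lam O < +oo)%E -> measurable_fun (O : set (Rn R k)) g ->
  exists N : set B, [/\ measurable N, lam N = 0%E &
    forall N', measurable N' -> N `<=` N' -> measurable_fun (O `\` N') (g : B -> R)].
Proof.
move=> mO Ooo mg; pose A (q : rat) : set B := O `&` [set x | g x < ratr q].
have mA q : measurable (A q : set (Rn R k)).
  have := mg (borel_caratheodory mO) _ (measurable_itv `]-oo, (ratr q : R)[).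
  by congr measurable; apply/seteqP; split => x [Ox] /=; rewrite in_itv.
have AO q : A q `<=` O by move=> x [].
have /choice[D] : forall q, exists D, exists N, [/\ measurable D, measurable N,
    lam N = 0%E, D `<=` A q & A q `\` D `<=` N].
  by move=> q; exact: (caratheodory_borel_approx mO Ooo (AO q) (mA q)).
move=> /choice[N DN].
have mN q : measurable (N q) by have [] := DN q.
have N0 q : lam (N q) = 0%E by have [] := DN q.
have [mNN NN0] := null_bigcup_countable mN N0.
exists (\bigcup_q N q); split => //.
move=> N' mN' FN'; apply: (measurability _ (RGenInftyO.measurableE R)).
  move=> _ [_ [y ->] <-].
  have -> : (O `\` N') `&` g @^-1` `]-oo, y[%classic =
      (O `\` N') `&` \bigcup_q (if ratr q < y then D q else set0).
    apply/seteqP; split => x [[Ox nN'x]] /=.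
      rewrite in_itv/= => /rat_in_itvoo[q]; rewrite in_itv/= => /andP[gq qy].
      split => //; exists q => //; rewrite qy; apply: contrapT => nDx.
      apply/nN'x/FN'; exists q => //.
      by have [_ _ _ _] := DN q; apply.
    move=> [q _]; case: ifP => // qy Dx; split => //.
    have [_ _ _ /(_ _ Dx)[_ gq] _] := DN q.
    by rewrite /= in_itv/=; apply: lt_trans qy.
  apply: measurableI; first exact: measurableD.
  apply: bigcupT_measurable_rat => q; case: ifP => // _.
  by have [] := DN q.
Qed.

Lemma ge0_integral_borel_lebesgue (f : B -> \bar R) : measurable_fun setT f ->
  (forall x, (0 <= f x)%E) -> (\int[lamC]_x f x = \int[lam]_x f x)%E.
Proof.
move=> mf f0.
have := ge0_integral_pushforward (@measurable_id_borel R k) lamC measurableT mf (fun x _ => f0 x).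
rewrite preimage_setT => H; apply: etrans (esym H) _.
rewrite (eq_measure_integral lam)//.
exact: measurable_id_borel.
Qed.

Lemma integral_borel_lebesgue (f : B -> \bar R) : measurable_fun setT f ->
  (\int[lamC]_x f x = \int[lam]_x f x)%E.
Proof.
move=> mf; rewrite integralE [RHS]integralE; congr (_ - _)%E.
  by apply: ge0_integral_borel_lebesgue; [exact: measurable_funepos|exact: funepos_ge0].
by apply: ge0_integral_borel_lebesgue; [exact: measurable_funeneg|exact: funeneg_ge0].
Qed.

(** The tripled cubes leave room for shifts along lines inside O, and radii at most 1 keep these
    shifts in the range of [ae_line_maximal]. *)
Lemma rational_cubes (O : set 'rV[R]_k) : open O -> O !=set0 ->
  exists (c : nat -> 'rV[R]_k) (rho : nat -> R), [/\ forall m, 0 < rho m <= 1,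
    forall m, box (c m - const_mx (3 * rho m), c m + const_mx (3 * rho m)) `<=` O
    & O = \bigcup_m obox (c m - const_mx (rho m)) (c m + const_mx (rho m))].
Proof.
move=> oO [x0 Ox0].
pose C (z : 'rV[rat]_k * rat) : 'rV[R]_k := map_mx ratr z.1.
pose r (z : 'rV[rat]_k * rat) : R := ratr z.2.
pose V z := 0 < r z <= 1 /\ box (C z - const_mx (3 * r z), C z + const_mx (3 * r z)) `<=` O.
pose Q z := obox (C z - const_mx (r z)) (C z + const_mx (r z)).
have cov x : O x -> exists2 z, V z & Q z x.
  move=> Ox; have /nbhs_ballP[e /= e0 xeO] := open_nbhs_nbhs (conj oO Ox).
  (* The centre is within q of x, so the tripled cube is within 4 q < e of x. *)
  have m0 : 0 < Num.min (e / 4) 1 by rewrite lt_min; apply/andP; split; [lra|].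
  have [q] := rat_in_itvoo m0; rewrite in_itv/= lt_min => /and3P[q0 qe q1].
  have /choice[p xp] (j : 'I_k) : exists p : rat, `|ratr p - x 0 j| < ratr q.
    have /rat_in_itvoo[p] : x 0 j - ratr q < x 0 j + ratr q by lra.
    by rewrite in_itv/= => /andP[? ?]; exists p; rewrite ltr_norml; apply/andP; split; lra.
  exists (\row_j p j, q).
    split; first by rewrite /r/= q0 ltW.
    move=> y yz; apply: xeO; split => // i j; rewrite ord1 /ball/=.
    have := yz j; have := xp j; rewrite /C /r /= !mxE ltr_norml ltr_norml => /andP[? ?] /andP[? ?].
    by apply/andP; split; lra.
  move=> j; have := xp j; rewrite /C /r /= !mxE ltr_norml => /andP[? ?].
  by apply/andP; split; lra.
have [z0 Vz0 _] := cov _ Ox0.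
(* Codes of inadmissible cubes are sent to one fixed admissible cube, so that the enumeration is
   total. *)
pose g m := if unpickle m is Some z then if pselect (V z) then z else z0 else z0.
have Vg m : V (g m) by rewrite /g; case: unpickle => // z; case: pselect.
exists (C \o g), (r \o g); split.
- by move=> m; have [] := Vg m.
- by move=> m; have [] := Vg m.
- apply/seteqP; split => x.
    move=> /cov[z Vz Qzx]; exists (pickle z) => //=.
    by rewrite /g pickleK; case: pselect.
  move=> [m _ Qx]; have [/andP[r0 _]] := Vg m; apply => j.
  have := Qx j; rewrite /= !mxE => /andP[? ?].
  by move: r0; rewrite /= => ?; apply/andP; split; lra.
Qed.

Lemma open_borel (O : set 'rV[R]_k) : open O -> measurable (O : set B).
Proof.
move=> oO; have [->|/set0P O0] := eqVneq O set0; first exact: measurable0.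
have [c [rho [_ _ ->]]] := rational_cubes oO O0.
by apply: bigcupT_measurable => m; exact: measurable_obox.
Qed.

Lemma continuous_borel (g : 'rV[R]_k -> R) : continuous g -> measurable_fun setT (g : B -> R).
Proof.
move=> /continuousP cg; apply: (measurability _ (RGenOpens.measurableE R)).
move=> _ [_ [a [b ->] <-]]; rewrite setTI; apply: open_borel; apply: cg.
exact: itv_open.
Qed.

End borel_representative.

Section borel_sobolev.
Variables (R : realType) (k : nat).
Local Notation B := (borelRn R k).
Local Notation lam := (@borel_lebesgue R k).
Local Notation lamC := (lebesgueRn R k).

Lemma Rintegral_borel_restrict (O N : set B) (g psi : 'rV[R]_k -> R) :
  measurable O -> measurable N -> lam N = 0%E ->
  measurable_fun (O : set (Rn R k)) g -> measurable_fun (O `\` N) (g : B -> R) ->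
  measurable_fun setT (psi : B -> R) ->
  \int[lamC]_(x in O) (g x * psi x) = \int[lam]_x ((g \_ (O `\` N)) x * psi x).
Proof.
move=> mO mN N0 mg mgN mpsi; congr fine.
have mOC := borel_caratheodory mO.
have mh : measurable_fun setT (g \_ (O `\` N) : B -> R).
  by apply/(measurable_restrictT _ _).1 => //; exact: measurableD.
have mhp : measurable_fun setT (fun x : B => ((g \_ (O `\` N)) x * psi x)%:E).
  by apply/measurable_EFinP; exact: measurable_funM.
rewrite -integral_borel_lebesgue//.
transitivity (\int[lamC]_(x in O) ((g \_ (O `\` N)) x * psi x)%:E)%E; last first.
  rewrite [LHS]integral_mkcond; apply: eq_integral => x _; rewrite !patchE.
  case: ifPn => // /negP xO; rewrite memNset ?mul0r// => -[Ox _].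
  by apply: xO; exact/mem_set.
apply: ae_eq_integral => //.
- apply/measurable_EFinP; apply: measurable_funM => //; apply: measurable_funTS.
  exact: (measurableT_comp mpsi (@measurable_id_borel R k)).
- by apply: measurable_funTS; exact: (measurableT_comp mhp (@measurable_id_borel R k)).
- exists N; split => //; first exact: borel_caratheodory.
  move=> x nx; apply: contrapT => nNx; apply: nx => Ox.
  by rewrite patchE mem_set.
Qed.

Lemma integrable_borel_restrict (O N : set B) (g : 'rV[R]_k -> R) :
  measurable O -> measurable N -> integrable_on O g ->
  measurable_fun (O `\` N) (g : B -> R) ->
  lam.-integrable setT (EFin \o (g \_ (O `\` N))).
Proof.
move=> mO mN /integrableP[mg goo] mgN.
have mON : measurable (O `\` N) by exact: measurableD.
have mh : measurable_fun setT (g \_ (O `\` N) : B -> R).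
  by apply/(measurable_restrictT _ _).1.
apply: integrable_of_lty => //; apply: le_lt_trans goo.
rewrite -ge0_integral_borel_lebesgue//; last first.
  by apply/measurable_EFinP; exact: measurableT_comp.
have mOC := borel_caratheodory mO; have mONC := borel_caratheodory mON.
apply: (@le_trans _ _ (\int[lamC]_(x in O `\` N) `|(EFin \o g) x|)%E).
  rewrite le_eqVlt; apply/orP; left; apply/eqP; rewrite [RHS]integral_mkcond.
  by apply: eq_integral => x _; rewrite !patchE; case: ifP => _ //=; rewrite normr0.
apply: ge0_subset_integral => //; exact: measurableT_comp.
Qed.

(* All components are cut off to [0] outside the domain and on a null set that
   contains the points where the contact equation fails, so that afterwards it
   holds everywhere. *)
Lemma borel_sobolev (n : nat) (Omega : set 'rV[R]_k) (f : 'rV[R]_k -> heis R n)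
    (Df : 'rV[R]_k -> 'M[R]_(k, (2 * n).+1)) :
  open Omega -> (lam Omega < +oo)%E -> sobolev11 Omega f Df ->
  {ae lamC, forall x, Omega x -> range (fun v : 'rV[R]_k => v *m Df x) `<=`
        [set w | contact_form (f x) w = 0]} ->
  exists (N : set B) (u : B -> heis R n) (v : 'I_k -> B -> heis R n),
  [/\ measurable N /\ lam N = 0%E,
      forall x, (Omega `\` N) x -> u x = f x,
      forall j, measurable_fun setT (fun x => u x 0 j) /\
                lam.-integrable setT (fun x => (u x 0 j)%:E),
      forall i j, measurable_fun setT (fun x => v i x 0 j) /\
                lam.-integrable setT (fun x => (v i x 0 j)%:E) &
      (forall i x, contact_form (u x) (v i x) = 0) /\
      (forall i j phi, test_function Omega phi ->
        \int[lam]_x (u x 0 j * partial i phi x) = - \int[lam]_x (v i x 0 j * phi x))].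
Proof.
move=> oO Ooo [intf intDf wk] ct.
have mO := open_borel oO.
have mf j := (integrableP _ _ _ (intf j)).1.
have mDf i j := (integrableP _ _ _ (intDf i j)).1.
have /choice[Nf HNf] j := borel_representative mO Ooo ((measurable_EFinP _ _).1 (mf j)).
have /choice[ND HND] (ij : 'I_k * 'I_(2 * n).+1) :=
  borel_representative mO Ooo ((measurable_EFinP _ _).1 (mDf ij.1 ij.2)).
have [Nc [mNc Nc0 ctN]] := ae_borel ct.
have [mN1 N10] := null_bigcup_countable (fun j => let: And3 a _ _ := HNf j in a)
  (fun j => let: And3 _ a _ := HNf j in a).
have [mN2 N20] := null_bigcup_countable (fun j => let: And3 a _ _ := HND j in a)
  (fun j => let: And3 _ a _ := HND j in a).
pose N : set B := Nc `|` (\bigcup_j Nf j `|` \bigcup_ij ND ij).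
have mN : measurable N by do 2! apply: measurableU => //.
have N0 : lam N = 0%E.
  by apply: measure_negligible => //; apply: negligibleU;
    [|apply: negligibleU]; apply/negligibleP.
pose S : set B := Omega `\` N.
have mfN j : measurable_fun S ((fun x => f x 0 j) : B -> R).
  have [_ _ H] := HNf j; apply: H => // x Nx.
  by right; left; exists j.
have mDfN i j : measurable_fun S ((fun x => Df x i j) : B -> R).
  have [_ _ H] := HND (i, j); apply: H => // x Nx.
  by right; right; exists (i, j).
have uE j : (fun x : B => (f \_ S) x 0 j) = (fun x => f x 0 j) \_ S.
  by apply/funext => x; rewrite !patchE; case: ifP => //; rewrite mxE.
have vE i j : (fun x : B => ((fun x => row i (Df x)) \_ S) x 0 j) =
    (fun x => Df x i j) \_ S.
  by apply/funext => x; rewrite !patchE; case: ifP => //; rewrite !mxE.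
exists N, (f \_ S), (fun i => (fun x => row i (Df x)) \_ S); split.
- by [].
- by move=> x Ox; rewrite patchE mem_set.
- move=> j; rewrite uE; split; first by apply/(measurable_restrictT _ _).1 => //; exact: measurableD.
  have := integrable_borel_restrict mO mN (intf j) (mfN j).
  by apply: eq_integrable => // x _; rewrite /= -uE.
- move=> i j; rewrite vE; split; first by apply/(measurable_restrictT _ _).1 => //; exact: measurableD.
  have := integrable_borel_restrict mO mN (intDf i j) (mDfN i j).
  by apply: eq_integrable => // x _; rewrite /= -vE.
- split=> [i x|i j phi tphi].
    rewrite !patchE; case: ifPn => [/set_mem[Ox nNx]|_]; last first.
      by rewrite /contact_form mxE add0r big1 ?mulr0// => l _; rewrite !mxE !mul0r subrr.
    have /(_ _ Ox) := ctN x _; apply; first by move=> Ncx; apply: nNx; left.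
    by exists (delta_mx 0 i) => //; rewrite -rowE.
  have [sphi _ _] := tphi.
  have mphi : measurable_fun setT (phi : B -> R).
    by apply: continuous_borel => x; apply: differentiable_continuous; exact: (sphi [::]).
  have mdphi : measurable_fun setT (partial i phi : B -> R).
    by apply: continuous_borel => x; apply: differentiable_continuous; exact: (sphi [:: i]).
  have := wk i j phi tphi.
  rewrite (Rintegral_borel_restrict mO mN N0 _ (mfN j) mdphi); last exact/measurable_EFinP.
  rewrite (Rintegral_borel_restrict mO mN N0 _ (mDfN i j) mphi); last exact/measurable_EFinP.
  by rewrite -uE -vE.
Qed.

End borel_sobolev.

Lemma ae_forall_countable d (T : measurableType d) (R : realType)
    (mu : {measure set T -> \bar R}) (I : countType) (P : I -> T -> Prop) :
  (forall i, {ae mu, forall x, P i x}) -> {ae mu, forall x, forall i, P i x}.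
Proof.
move=> /choice[N HN].
have mN i : measurable (N i) by have [] := HN i.
have N0 i : mu (N i) = 0%E by have [] := HN i.
have [mNN NN0] := null_bigcup_countable mN N0.
exists (\bigcup_i N i); split => // x /existsNP[i nP].
by exists i => //; have [_ _] := HN i; apply.
Qed.

(** * Almost every shift along a line is a controlled move *)

Section heis_near_on_lines.
Variables (R : realType) (k n : nat) (hn : (0 < n)%N).
Local Notation B := (borelRn R k).
Local Notation RR := (measurableTypeR R).
Local Notation lam := (@borel_lebesgue R k).
Local Notation leb := (@lebesgue_measure R).
Variables (u : B -> heis R n) (v : 'I_k -> B -> heis R n).
Hypothesis mu : forall j, measurable_fun setT (fun x => u x 0 j).
Hypothesis iu : forall j, lam.-integrable setT (fun x => (u x 0 j)%:E).
Hypothesis mv : forall i j, measurable_fun setT (fun x => v i x 0 j).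
Hypothesis iv : forall i j, lam.-integrable setT (fun x => (v i x 0 j)%:E).
Hypothesis contact : forall i x, contact_form (u x) (v i x) = 0.
Variable Omega : set 'rV[R]_k.
Hypothesis weak : forall i j phi, test_function Omega phi ->
  \int[lam]_x (u x 0 j * partial i phi x) = - \int[lam]_x (v i x 0 j * phi x).

Definition near_pairs i (m : nat) : set (B * RR) :=
  [set z | heis_near (u z.1) (u (line i z.1 z.2)) (m%:R * z.2)].

Lemma measurable_near_pairs i m : measurable (near_pairs i m).
Proof.
have mp j : measurable_fun setT (fun z : B * RR => u z.1 0 j).
  exact: (measurableT_comp (mu j) measurable_fst).
have mq j : measurable_fun setT (fun z : B * RR => u (line i z.1 z.2) 0 j).
  exact: (measurableT_comp (mu j) (measurable_line_pair i)).
have md j : measurable_fun setT (fun z : B * RR => u (line i z.1 z.2) 0 j - u z.1 0 j).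
  exact: measurable_funB.
have ma : measurable_fun setT (fun z : B * RR => m%:R * z.2 : R).
  by apply: measurable_funM; [exact: measurable_cst|exact: measurable_snd].
have le (g h : B * RR -> R) : measurable_fun setT g -> measurable_fun setT h ->
    measurable [set z | g z <= h z].
  by move=> mg mh; rewrite -[X in measurable X]setTI; exact: measurable_fun_le.
rewrite (_ : near_pairs i m =
    (\bigcap_(j in [set: 'I_n])
      ([set z | `|u (line i z.1 z.2) 0 (xi j) - u z.1 0 (xi j)| <= m%:R * z.2] `&`
       [set z | `|u (line i z.1 z.2) 0 (yi j) - u z.1 0 (yi j)| <= m%:R * z.2])) `&`
    [set z | `|contact_form (u z.1) (u (line i z.1 z.2) - u z.1)| <=
      2 * n%:R * (m%:R * z.2) ^+ 2]); last first.
  apply/seteqP; split => z /=.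
    by move=> [H1 H2]; split => // j _; exact: H1.
  by move=> [H1 H2]; split => // j; exact: H1.
apply: measurableI.
  apply: fin_bigcap_measurable => [|j _]; first exact: finite_finset.
  by apply: measurableI; apply: le => //; apply: measurableT_comp.
apply: le; last first.
  by apply: measurable_funM; [exact: measurable_cst|exact: measurable_funX].
apply: measurableT_comp => //; rewrite /contact_form.
under eq_fun do rewrite !mxE.
apply: measurable_funD; first exact: md.
apply: measurable_funM; first exact: measurable_cst.
under eq_fun do under eq_bigr do rewrite !mxE.
by apply: measurable_sum => j; apply: measurable_funB; apply: measurable_funM.
Qed.

Definition far_shifts i (m : nat) (r : R) (x : B) : set RR :=
  [set s | 0 < s < r /\ ~ near_pairs i m (x, s)].

Lemma measurable_far_pairs i m r : measurable
  [set z : B * RR | 0 < z.2 < r /\ ~ near_pairs i m z].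
Proof.
apply: measurableI; last by apply: measurableC; exact: measurable_near_pairs.
rewrite (_ : (fun z => _) = setT `*` `]0, r[%classic); first exact: measurableX.
by apply/seteqP; split => z /=; rewrite in_itv/= => // -[].
Qed.

Lemma far_shiftsE i m r x : far_shifts i m r x =
  xsection [set z : B * RR | 0 < z.2 < r /\ ~ near_pairs i m z] x.
Proof. by apply/seteqP; split => s; rewrite /xsection /= inE. Qed.

Lemma measurable_far_shifts i m r x : measurable (far_shifts i m r x).
Proof.
by rewrite far_shiftsE; apply: measurable_xsection; exact: measurable_far_pairs.
Qed.

Lemma far_shifts_le0 i m m' r r' x : (m <= m')%N -> r' <= r ->
  leb (far_shifts i m r x) = 0%E -> leb (far_shifts i m' r' x) = 0%E.
Proof.
move=> mm' rr' H; apply: measure_negligible; first exact: measurable_far_shifts.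
apply: (negligibleS _ (_ : leb.-negligible (far_shifts i m r x))); last first.
  by apply/negligibleP; [exact: measurable_far_shifts|exact: H].
move=> s [/andP[s0 sr'] nN]; split; first by rewrite s0 (lt_le_trans sr').
move=> nearm; apply: nN; apply: heis_near_le nearm; first by rewrite mulr_ge0// ltW.
by rewrite /= ler_wpM2r ?ler_nat// ltW.
Qed.

Lemma hnorm1_lty i : (\int[lam]_x (hnorm1 (v i x))%:E < +oo)%E.
Proof.
have H : lam.-integrable setT (fun x => (hnorm1 (v i x))%:E).
  have : lam.-integrable setT (fun x => (\sum_(j < n)
      (`|(v i x 0 (xi j))%:E| + `|(v i x 0 (yi j))%:E|))%E).
    by apply: integrable_sum => // j _; apply: integrableD => //; exact: (integrable_norm (iv _ _)).
  by apply: eq_integrable => // x _; rewrite -sumEFin; apply: eq_bigr.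
have := integrable_norm_lty H.
by under eq_integral do rewrite ger0_norm ?hnorm1_ge0//.
Qed.

(** Discard the shifts at which the integral identity fails for some component, a null set [Z]. At
    any other s the identity holds at s and at almost every earlier shift, so [heis_near_primitive]
    applies, and the maximal bound turns the L^1 norm into m s. *)
Lemma ae_heis_near_line i (c : 'rV[R]_k) (rho : R) : 0 < rho <= 1 ->
  box (c - const_mx (2 * rho), c + const_mx (2 * rho)) `<=` Omega ->
  {ae lam, forall x, obox (c - const_mx rho) (c + const_mx rho) x ->
    exists m : nat, leb (far_shifts i m rho x) = 0%E}.
Proof.
move=> /andP[rho0 rho1] cO.
have mh : measurable_fun setT (fun x => hnorm1 (v i x)).
  apply: measurable_sum => j; apply: measurable_funD; exact: measurableT_comp.
have A1 : {ae lam, forall x, forall l, obox (c - const_mx rho) (c + const_mx rho) x ->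
    leb [set s | 0 < s < rho /\ line_defect i (fun x => u x 0 l) (fun x => v i x 0 l) s x != 0] = 0%E}.
  apply: ae_forall_countable => l.
  apply: (ae_line_defect0 (mu l) (mv i l) (iu l) (iv i l) _ rho0 cO) => phi.
  exact: weak.
have A2 : {ae lam, forall x, forall l,
    leb.-integrable `[0, 1] (fun t => (v i (line i x t) 0 l)%:E)}.
  by apply: ae_forall_countable => l; exact: (ae_line_integrableV i (mv i l) (iv i l)).
have A3 := ae_line_maximal i mh (fun x => hnorm1_ge0 (v i x)) (hnorm1_lty i).
apply: ae_imply2 (A3) (ae_imply2 _ A1 A2) => [x [m Hm] Hx Qx|x H1 H2]; last exact: (conj H1 H2).
have [H1 H2] := Hx.
exists m.
pose Z l : set RR := [set s | 0 < s < rho /\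
  line_defect i (fun x => u x 0 l) (fun x => v i x 0 l) s x != 0].
have mr : measurable ([set s | 0 < s < rho] : set RR).
  rewrite (_ : [set s | _] = `]0, rho[%classic); first exact: measurable_itv.
  by apply/seteqP; split => s; rewrite /= in_itv.
have mZ l : measurable (Z l).
  rewrite (_ : Z l = [set s | 0 < s < rho] `&` ((fun s : RR =>
      line_defect i (fun x => u x 0 l) (fun x => v i x 0 l) s x) @^-1` (~` [set 0]))); last first.
    by apply/seteqP; split => s /= [sr /eqP d0].
  apply: measurableI => //; rewrite -[X in measurable X]setTI.
  have := measurable_line_defect i (mu l) (mv i l) => mld.
  by apply: (measurableT_comp mld (measurable_fun_pair (measurable_cst (x : B))
    (@measurable_id _ RR setT))) => //; exact: measurableC.
have [mZZ ZZ0] := null_bigcup_countable mZ (fun l => H1 l Qx).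
have dZ s l : 0 < s < rho -> ~ (\bigcup_l Z l) s ->
    u (line i x s) 0 l - u x 0 l = \int[leb]_(t in `[0, s]) (v i (line i x t) 0 l).
  move=> sr nZ; apply/eqP; rewrite -subr_eq0; apply/negPn/negP => d0.
  by apply: nZ; exists l.
apply: measure_negligible; first exact: measurable_far_shifts.
apply: (negligibleS _ (_ : leb.-negligible (\bigcup_l Z l))); last exact/negligibleP.
move=> s [sr nN]; apply: contrapT => nZ; apply: nN.
have /andP[s0 srho] := sr.
have := @heis_near_primitive _ _ hn (fun t => u (line i x t)) (fun t => v i (line i x t)) s s0.
rewrite line0 => /(_ _ (fun t => contact i _)) nearP.
apply: (heis_near_le _ _ (nearP _ _ _)).
- by apply: Rintegral_ge0 => // t _; exact: hnorm1_ge0.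
- have Is : (\int[leb]_(t in `[0%R, s]) (hnorm1 (v i (line i x t)))%:E <= (m%:R * s)%:E)%E.
    by apply: Hm; rewrite s0 (le_trans (ltW srho)).
  rewrite -lee_fin /Rintegral fineK// ge0_fin_numE; first exact: le_lt_trans Is (ltry _).
  by apply: integral_ge0 => t _; rewrite lee_fin hnorm1_ge0.
- move=> l; apply: integrableS (H2 l) => // t /=; rewrite !in_itv/= => /andP[-> ts].
  by apply: le_trans ts _; apply: le_trans rho1; exact: ltW.
- by move=> l; apply: dZ.
- exists (\bigcup_l Z l); split => // t nt; apply: contrapT => nZt; apply: nt => /andP[t0 ts] l.
  by apply: dZ => //; rewrite t0 (lt_trans ts).
Qed.

End heis_near_on_lines.

(** * Joining points by controlled moves, and conclusion *)

Lemma common_abscissa (R : realType) (A1 A2 : set (measurableTypeR R)) (a1 a2 r : R) :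
  measurable A1 -> measurable A2 -> 0 < r ->
  (lebesgue_measure A1 <= (r / 4)%:E)%E -> (lebesgue_measure A2 <= (r / 4)%:E)%E ->
  exists t, [/\ 0 < t < r, ~ A1 (a1 + t) & ~ A2 (a2 + t)].
Proof.
move=> mA1 mA2 r0 A1r A2r; apply: contrapT => H.
pose P (A : set (measurableTypeR R)) (a : R) : set (measurableTypeR R) :=
  (fun x : measurableTypeR R => a + x : measurableTypeR R) @^-1` A.
have mP (A : set (measurableTypeR R)) a : measurable A -> measurable (P A a).
  move=> mA; rewrite -[X in measurable X]setTI.
  by have := measurable_funD (measurable_cst a) (@measurable_id _ (measurableTypeR R) setT);
    exact.
have P1 : (lebesgue_measure (P A1 a1) <= (r / 4)%:E)%E.
  by rewrite lebesgue_measure_translate.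
have P2 : (lebesgue_measure (P A2 a2) <= (r / 4)%:E)%E.
  by rewrite lebesgue_measure_translate.
(* If no t were admissible, two translated sets of total measure at most r / 2 would cover an
   interval of length r. *)
have sub : `]0, r[%classic `<=` P A1 a1 `|` P A2 a2.
  move=> t /=; rewrite in_itv/= => tr.
  have [|n1] := pselect (A1 (a1 + t)); first by left.
  have [|n2] := pselect (A2 (a2 + t)); first by right.
  by exfalso; apply: H; exists t.
have : (lebesgue_measure (`]0%R, r[%classic : set (measurableTypeR R)) <= (r / 4)%:E + (r / 4)%:E)%E.
  apply: (@le_trans _ _ (lebesgue_measure (P A1 a1 `|` P A2 a2))).
    by apply: le_measure_sub => //; apply: measurableU; exact: mP.
  apply: (le_trans (measureU2 _ _ _)); [exact: mP|exact: mP|].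
  exact: leeD.
rewrite lebesgue_measure_itv/= lte_fin r0 -EFinB -EFinD lee_fin; lra.
Qed.

Lemma heis_near_refl (R : realType) (n : nat) (p : heis R n) : heis_near p p 0.
Proof.
split=> [j|]; first by rewrite !subrr normr0.
rewrite subrr /contact_form mxE add0r big1 ?mulr0 ?normr0 ?expr0n ?mulr0// => j _.
by rewrite !mxE !mulr0 subrr.
Qed.

(** Serves pairs of points that are not close to each other. The vertical term is at most 2 M + 8 n
    M^2, which 2 n (1 + 3 M)^2 dominates as n >= 1. *)
Lemma heis_near_bounded (R : realType) (n : nat) (hn : (0 < n)%N) (p q : heis R n) (M : R) :
  0 <= M -> (forall l, `|p 0 l| <= M) -> (forall l, `|q 0 l| <= M) ->
  heis_near p q (1 + 3 * M).
Proof.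
move=> M0 pM qM.
have d l : `|q 0 l - p 0 l| <= 2 * M.
  by apply: le_trans (ler_normB _ _) _; have := pM l; have := qM l; lra.
split=> [j|]; first by split; apply: le_trans (d _) _; lra.
rewrite /contact_form; apply: le_trans (ler_normD _ _) _.
apply: (@le_trans _ _ (2 * M + 2 * (n%:R * (4 * M ^+ 2)))).
  rewrite !mxE; apply: lerD; first exact: d.
  rewrite normrM ger0_norm// ler_wpM2l//.
  apply: le_trans (ler_norm_sum _ _ _) _.
  apply: (@le_trans _ _ (\sum_(j < n) (4 * M ^+ 2))); last first.
    by rewrite sumr_const card_ord -[_ *+ n]mulr_natl.
  apply: ler_sum => j _; apply: le_trans (ler_normB _ _) _; rewrite !normrM !mxE.
  have := ler_pM (normr_ge0 _) (normr_ge0 _) (pM (xi j)) (d (yi j)).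
  have := ler_pM (normr_ge0 _) (normr_ge0 _) (pM (yi j)) (d (xi j)).
  nra.
have n1 : (1 : R) <= n%:R by rewrite ler1n.
nra.
Qed.

Section lusin_lipschitz.
Variables (R : realType) (k n : nat) (hn : (0 < n)%N).
Local Notation B := (borelRn R k).
Local Notation RR := (measurableTypeR R).
Local Notation lam := (@borel_lebesgue R k).
Local Notation leb := (@lebesgue_measure R).
Variables (u : B -> heis R n).
Hypothesis mu : forall j, measurable_fun setT (fun x => u x 0 j).

(** A single integer governs the bound on u, the constant of the moves and their scale, so that the
    sets increase with m. *)
Definition good_points (m : nat) : set B :=
  [set x | (forall l, `|u x 0 l| <= m%:R) /\ forall i, leb (far_shifts u i m m.+1%:R^-1 x) = 0%E].

Lemma measurable_good_points m : measurable (good_points m).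
Proof.
rewrite (_ : good_points m =
  (\bigcap_(l in [set: 'I_(2 * n).+1]) [set x | `|u x 0 l| <= m%:R]) `&`
  (\bigcap_(i in [set: 'I_k]) [set x | leb (far_shifts u i m m.+1%:R^-1 x) = 0%E])); last first.
  apply/seteqP; split => x /=.
    by move=> [H1 H2]; split => l _; [exact: H1|exact: H2].
  by move=> [H1 H2]; split => l; [exact: H1|exact: H2].
apply: measurableI; apply: fin_bigcap_measurable; do 1? exact: finite_finset.
  move=> l _; rewrite -[X in measurable X]setTI.
  by apply: measurable_fun_le => //; apply: measurableT_comp.
move=> i _.
have := measurable_fun_xsection leb (measurable_far_pairs mu i m m.+1%:R^-1).
move=> /(_ measurableT [set 0%E] (emeasurable_set1 _)); rewrite setTI.
congr measurable; apply/seteqP; split => x /=; by rewrite far_shiftsE.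
Qed.

Lemma good_points_le : {homo good_points : m m' / (m <= m')%N >-> m `<=` m'}.
Proof.
move=> m m' mm' x [H1 H2]; split=> [l|i].
  by apply: le_trans (H1 l) _; rewrite ler_nat.
apply: far_shifts_le0 (H2 i) => //.
by rewrite lef_pV2 ?posrE// ler_nat.
Qed.

(** Induction on the list r of coordinates in which x and y may differ. For a new coordinate i, both
    points move along i into the set E of the previous stage, to a common i-th coordinate, which
    reduces to r. Two moves of length at most 2 d with constant m add 4 m to C. *)
Lemma near_subset (m : nat) (A0 : set B) (r : seq 'I_k) (e : R) :
  measurable A0 -> (lam A0 < +oo)%E -> A0 `<=` good_points m -> 0 < e ->
  exists E : set B, [/\ measurable E, E `<=` A0, (lam (A0 `\` E) < e%:E)%E &
    exists C : nat, exists2 r0 : R, 0 < r0 & forall x y d, E x -> E y -> 0 < d < r0 ->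
      (forall j, `|x 0 j - y 0 j| <= d) -> (forall j, j \notin r -> x 0 j = y 0 j) ->
      heis_near (u x) (u y) (C%:R * d)].
Proof.
move=> mA0 A0oo A0G; elim: r e => [|i r ih] e e0.
  exists A0; split => //; first by rewrite setDv measure0 lte_fin.
  exists 0, 1 => // x y d _ _ _ _ xy; rewrite mul0r (_ : x = y); first exact: heis_near_refl.
  by apply/rowP => j; exact: xy.
have e20 : 0 < e / 2 by rewrite divr_gt0.
have [E [mE EA0 A0E [C [r0 r00 HE]]]] := ih _ e20.
have Eoo : (lam E < +oo)%E by apply: le_lt_trans A0oo; apply: le_measure_sub.
have [E' [mE' E'E EE' [r1 r10 HE']]] := line_density_subset i mE Eoo e20.
exists E'; split => //; first exact: subset_trans EA0.
  apply: (@le_lt_trans _ _ (lam ((A0 `\` E) `|` (E `\` E')))).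
    apply: le_measure_sub; [exact: measurableD|by apply: measurableU; exact: measurableD|].
    move=> x [A0x nE'x]; have [Ex|nEx] := pselect (E x); first by right.
    by left.
  apply: (le_lt_trans (measureU2 _ _ _)); [exact: measurableD|exact: measurableD|].
  by rewrite [e]splitr EFinD; exact: lteD.
exists (C + 4 * m)%N.
(* The halves are there because the moves have length up to 2 d. *)
exists (Num.min r0 (Num.min (r1 / 2) (m.+1%:R^-1 / 2))).
  by rewrite !lt_min r00 !divr_gt0// invr_gt0.
move=> x y d E'x E'y /andP[d0]; rewrite !lt_min => /and3P[dr0 dr1 dm] xyd xyr.
(* A shift is bad if it lands outside E, which by density has measure at most 2 d / 8, or if it is
   not a controlled move, which is a null set. *)
pose Bad z : set RR := [set t | `[0, 2 * d]%classic t /\ ~ E (line i z t)] `|` far_shifts u i m m.+1%:R^-1 z.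
have mB z : measurable (Bad z).
  apply: measurableU; last exact: measurable_far_shifts.
  apply: measurableI; first exact: measurable_itv.
  apply: measurableC; rewrite -[X in measurable X]setTI.
  exact: (measurable_line_r i z).
have lB z : E' z -> (leb (Bad z) <= (d / 4)%:E)%E.
  move=> E'z; apply: (le_trans (measureU2 _ _ _)).
  - apply: measurableI; first exact: measurable_itv.
    apply: measurableC; rewrite -[X in measurable X]setTI.
    exact: (measurable_line_r i z).
  - exact: measurable_far_shifts.
  have [_ Hz] := A0G _ (EA0 _ (E'E _ E'z)).
  have Hz0 : (leb (far_shifts u i m m.+1%:R^-1 z) <= 0)%E by rewrite Hz.
  have Hz1 : (leb [set t | `[0%R, (2 * d)%R]%classic t /\ ~ E (line i z t)] <= (d / 4)%:E)%E.
    rewrite (_ : d / 4 = 2 * d / 8); last by lra.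
    by apply: HE' => //; apply/andP; split; lra.
  by have := leeD Hz1 Hz0; rewrite adde0.
(* Only forward shifts are controlled, so both points advance to the coordinate c + t with 0 < t <
   d. Each shift c - z_i + t then lies strictly between 0 and 2 d. *)
pose c := Num.max (x 0 i) (y 0 i).
have [t [/andP[t0 td] nx ny]] :=
  common_abscissa (c - x 0 i) (c - y 0 i) (mB x) (mB y) d0 (lB x E'x) (lB y E'y).
have xyi := xyd i.
have good z : ~ Bad z (c - z 0 i + t) -> 0 <= c - z 0 i <= d ->
    E (line i z (c - z 0 i + t)) /\ heis_near (u z) (u (line i z (c - z 0 i + t))) (m%:R * (2 * d)).
  move=> nB /andP[cz0 czd]; split.
    apply: contrapT => nE; apply: nB; left; split => //=.
    by rewrite in_itv/=; apply/andP; split; lra.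
  apply: (heis_near_le _ _ (_ : near_pairs u i m (z, c - z 0 i + t))).
  - by rewrite mulr_ge0//=; lra.
  - by apply: ler_wpM2l => //=; lra.
  - apply: contrapT => nN; apply: nB; right; split => //=.
    by move: dm; move: (m.+1%:R^-1 : R) => dl dm; apply/andP; split; lra.
have cx : 0 <= c - x 0 i <= d.
  move: xyi; rewrite /c ler_norml => /andP[? ?].
  by case: (leP (x 0 i) (y 0 i)) => ?; apply/andP; split; lra.
have cy : 0 <= c - y 0 i <= d.
  move: xyi; rewrite /c ler_norml => /andP[? ?].
  by case: (leP (x 0 i) (y 0 i)) => ?; apply/andP; split; lra.
have [Ex' nearx] := good x nx cx.
have [Ey' neary] := good y ny cy.
set x' := line i x _ in Ex' nearx; set y' := line i y _ in Ey' neary.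
have x'y' : heis_near (u x') (u y') (C%:R * d).
  apply: HE => //; first by rewrite d0.
    move=> j; have [->|ji] := eqVneq j i.
      by rewrite !line_coord [X in `|X|](_ : _ = 0) ?normr0 ?ltW//; ring.
    by rewrite !line_coord_neq.
  move=> j jr; have [->|ji] := eqVneq j i; first by rewrite !line_coord; ring.
  by rewrite !line_coord_neq//; apply: xyr; rewrite inE negb_or ji.
have := heis_near_trans (heis_near_trans nearx x'y') (heis_nearC neary).
congr heis_near; rewrite natrD natrM; ring.
Qed.

End lusin_lipschitz.

Lemma coord_le_enorm (R : realType) (m : nat) (v : 'rV[R]_m) i : `|v 0 i| <= enorm v.
Proof.
rewrite -sqrtr_sqr /enorm ler_wsqrtr// (bigD1 i)//= lerDl.
by apply: sumr_ge0 => j _; exact: sqr_ge0.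
Qed.

Lemma bounded_lebesgue_lty (R : realType) (k : nat) (A : set 'rV[R]_k) :
  bounded_set A -> (lebesgue_outer A < +oo)%E.
Proof.
move=> [M [_ AM]].
apply: le_lt_trans (borel_lebesgue_box_lty (cube k (M + 1))).
apply: le_lebesgue_outer => x Ax; apply/cubeP => i.
apply: le_trans (AM (M + 1) _ x Ax); last by rewrite ltrDl.
rewrite [leRHS]/Num.norm/= mx_normrE.
exact: (le_bigmax _ (fun ij => `|x ij.1 ij.2|) (0, i)).
Qed.

Lemma ae_good_points (R : realType) (k n : nat) (hn : (0 < n)%N) (Omega : set 'rV[R]_k)
    (u : borelRn R k -> heis R n) (v : 'I_k -> borelRn R k -> heis R n) :
  open Omega -> Omega !=set0 ->
  (forall j, measurable_fun setT (fun x => u x 0 j) /\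
     (@borel_lebesgue R k).-integrable setT (fun x => (u x 0 j)%:E)) ->
  (forall i j, measurable_fun setT (fun x => v i x 0 j) /\
     (@borel_lebesgue R k).-integrable setT (fun x => (v i x 0 j)%:E)) ->
  (forall i x, contact_form (u x) (v i x) = 0) ->
  (forall i j phi, test_function Omega phi ->
    \int[@borel_lebesgue R k]_x (u x 0 j * partial i phi x) =
    - \int[@borel_lebesgue R k]_x (v i x 0 j * phi x)) ->
  {ae @borel_lebesgue R k, forall x, Omega x -> exists m, good_points u m x}.
Proof.
move=> oO O0 hu hv ct wk.
have [c [rho [rho01 cO OE]]] := rational_cubes oO O0.
have mu j := (hu j).1.
have H : {ae @borel_lebesgue R k, forall x, forall z : nat * 'I_k,
    obox (c z.1 - const_mx (rho z.1)) (c z.1 + const_mx (rho z.1)) x ->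
    exists m : nat, lebesgue_measure (far_shifts u z.2 m (rho z.1) x) = 0%E}.
  apply: ae_forall_countable => -[l i] /=.
  apply: (ae_heis_near_line hn mu (fun j => (hu j).2) (fun i j => (hv i j).1)
    (fun i j => (hv i j).2) ct wk i (rho01 l)).
  apply: subset_trans (cO l) => x xb j; have := xb j; rewrite /= !mxE.
  by have /andP[? _] := rho01 l => /andP[? ?]; apply/andP; split; lra.
apply: ae_imply H => x Hx; rewrite {1}OE => -[l _ xl].
have /choice[g Hg] i := Hx (l, i) xl.
have /andP[r0 _] := rho01 l.
pose b := \sum_j `|u x 0 j|.
(* The sum dominates at once the constants of all directions, the size of u x and the inverse radius
   of the cube containing x. *)
pose m := (\max_i g i + (Num.truncn b).+1 + (Num.truncn (rho l)^-1).+1)%N.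
exists m; split=> [j|i].
  apply: (@le_trans _ _ b); first by rewrite /b (bigD1 j)//= lerDl sumr_ge0.
  apply: (@le_trans _ _ (Num.truncn b).+1%:R); first by apply/ltW; rewrite truncnS_gt.
  by rewrite ler_nat /m; lia.
have gm : (g i <= m)%N by apply: leq_trans (leq_bigmax i) _; rewrite /m; lia.
have mr : m.+1%:R^-1 <= rho l.
  rewrite -[leRHS]invrK lef_pV2 ?posrE ?invr_gt0//.
  apply: le_trans (_ : (Num.truncn (rho l)^-1).+1%:R <= _); first by apply/ltW; rewrite truncnS_gt.
  by rewrite ler_nat /m; lia.
exact: far_shifts_le0 (Hg i).
Qed.

Theorem theorem1p5 (R : realType) (k n : nat) (hk : (0 < k)%N) (hn : (0 < n)%N)
    (Omega : set 'rV[R]_k) (hOmega : smooth_bounded_domain Omega)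
    (f : 'rV[R]_k -> heis R n) (Df : 'rV[R]_k -> 'M[R]_(k, (2 * n).+1))
    (hf : sobolev11 Omega f Df)
    (hcontact : {ae lebesgueRn R k, forall x, Omega x ->
      range (fun v : 'rV[R]_k => v *m Df x) `<=`
        [set w | contact_form (f x) w = 0]})
    (eps : R) (heps : 0 < eps) :
  exists E : set (Rn R k), [/\ measurable E, E `<=` Omega,
    (lebesgueRn R k (Omega `\` E) < eps%:E)%E
    & exists2 L : R, 0 <= L & forall x y, E x -> E y ->
        (dcc (f x) (f y) <= (L * enorm (x - y))%:E)%E].
Proof.
have [oO _ O0 bO _] := hOmega.
have Ooo := bounded_lebesgue_lty bO.
have [N [u [v [[mN N0] uf hu hv [ct wk]]]]] := borel_sobolev oO Ooo hf hcontact.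
have mO := open_borel oO.
have mON : measurable (Omega `\` N : set (borelRn R k)) by exact: measurableD.
have mu j := (hu j).1.
have mG m : measurable (good_points u m) := measurable_good_points mu m.
pose G m : set (borelRn R k) := (Omega `\` N) `&` good_points u m.
(* One half of eps pays for the points outside [G m], the other for the passages to density
   points. *)
have e2 : 0 < eps / 2 by rewrite divr_gt0.
have [m GM] : exists m, (borel_lebesgue (Omega `\` G m) < (eps / 2)%:E)%E.
  apply: (nondecreasing_measure_approx (mu := @borel_lebesgue R k)) => //.
  - by move=> m; exact: measurableI.
  - by move=> m m' mm' x [ONx Gx]; split => //; exact: good_points_le Gx.
  - have [N1 [mN1 N10 HN1]] := ae_good_points hn oO O0 hu hv ct wk.
    apply: measure_negligible.
      by apply: measurableD => //; apply: bigcupT_measurable => m; exact: measurableI.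
    have neg : (@borel_lebesgue R k).-negligible (N `|` N1).
      by apply: negligibleU; apply/negligibleP.
    apply: negligibleS neg => x [Ox nG]; have [Nx|nNx] := pselect (N x); first by left.
    right; apply: HN1 => /(_ Ox)[m Gx]; apply: nG.
    by exists m.
have GO : G m `<=` Omega by move=> x [[]].
have mGm : measurable (G m) by exact: measurableI.
have Goo : (borel_lebesgue (G m) < +oo)%E.
  by apply: le_lt_trans Ooo; exact: le_lebesgue_outer.
have GG : G m `<=` good_points u m by move=> x [].
have [E [mE EG GE [C [r0 r00 HE]]]] := near_subset mu (enum 'I_k) mGm Goo GG e2.
have [C0 C00 dccC] := dcc_heis_near R hn.
exists E; split.
- exact: borel_caratheodory.
- exact: subset_trans GO.
- apply: (@le_lt_trans _ _ (@borel_lebesgue R k ((Omega `\` G m) `|` (G m `\` E)))).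
    apply: le_lebesgue_outer => x [Ox nEx].
    by have [Gx|nGx] := pselect (G m x); [right|left].
  apply: le_lt_trans (measureU2 _ _ _) _; [exact: measurableD|exact: measurableD|].
  by rewrite [eps]splitr EFinD; exact: lteD.
(* Any two values on [G m] are K-near, and at distance at least r0 this is at most (K / r0) times
   the distance. *)
pose K : R := 1 + 3 * m%:R.
have K0 : 0 <= K by rewrite addr_ge0// mulr_ge0.
exists (C0 * (C%:R + K / r0)); first by rewrite !(mulr_ge0, addr_ge0)// invr_ge0 ltW.
move=> x y Ex Ey.
have fu z : E z -> f z = u z by move=> Ez; rewrite uf//; have [] := EG _ Ez.
rewrite (fu x Ex) (fu y Ey).
have d0 : 0 <= enorm (x - y) by exact: sqrtr_ge0.
set d := enorm (x - y) in d0 *.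
have xyd j : `|x 0 j - y 0 j| <= d.
  by have := coord_le_enorm (x - y) j; rewrite !mxE.
suff [a [a0 near ad]] : exists a, [/\ 0 <= a, heis_near (u x) (u y) a & a <= (C%:R + K / r0) * d].
  apply: le_trans (dccC _ _ _ near) _; rewrite lee_fin -mulrA; exact: ler_wpM2l.
have Kr : 0 <= K / r0 by rewrite divr_ge0// ltW.
have [dr|rd] := ltP d r0; last first.
  exists K; split => //.
    by apply: heis_near_bounded => // l; [have [] := GG _ (EG _ Ex)|have [] := GG _ (EG _ Ey)].
  rewrite mulrDl -[leLHS]add0r lerD ?mulr_ge0//.
  by rewrite mulrAC -mulrA ler_peMr// ler_pdivlMr// mul1r.
(* [HE] asks for d > 0, so coinciding points are treated apart. *)
move: d0; rewrite le_eqVlt => /predU1P[d0|d0].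
  exists 0; rewrite -d0 mulr0; split => //.
  have -> : x = y; last exact: heis_near_refl.
  apply/rowP => j; apply/eqP; rewrite -subr_eq0 -normr_le0.
  by have := xyd j; rewrite -d0.
exists (C%:R * d); split.
- by rewrite mulr_ge0// ltW.
- by apply: HE => //; [rewrite d0|move=> j; rewrite mem_enum].
- by rewrite ler_wpM2r ?(ltW d0)// lerDl.
Qed.
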